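(* There exist Type III special rank-$1$ Bäcklund transformations relating a degenerate hyperbolic Euler-Lagrange system $(M,\mathcal I_0)$ with a non-degenerate hyperbolic Euler-Lagrange system $(\bar M,\bar{\mathcal I}_0)$. Moreover, such examples exist with $(\bar M,\bar{\mathcal I}_0)$ positive, and such examples exist with $(\bar M,\bar{\mathcal I}_0)$ negative.
   Context: **Hyperbolic Monge-Ampère systems.** A hyperbolic Monge-Ampère system $(M,\mathcal I)$ is a 5-manifold $M$ with a differential ideal $\mathcal I\subset\Omega^*(M)$ which is locally generated algebraically by a 1-form $\theta$ and 2-forms $d\theta,\Omega$ such that $\theta\wedge(d\theta)^2\neq 0$; $d\theta,\Omega$ are pointwise linearly independent modulo $\theta$; and $(\lambda d\theta+\mu\Omega)^2\equiv 0 \bmod \theta$ has exactly two distinct solutions $[\lambda:\mu]\in\mathbb{RP}^1$. Equivalently, locally $\mathcal I$ is algebraically generated by $\omega^0,\ \omega^1\wedge\omega^2,\ \omega^3\wedge\omega^4$ for some coframing $(\omega^0,\dots,\omega^4)$ with $\omega^0$ a contact form. **1-adapted coframings and invariants.** Such a local coframing is 1-adapted if $d\omega^0\equiv\omega^1\wedge\omega^2+\omega^3\wedge\omega^4 \bmod \omega^0$; $d\omega^1\equiv d\omega^2\equiv0\bmod\omega^0,\omega^1,\omega^2$; $d\omega^3\equiv d\omega^4\equiv 0\bmod\omega^0,\omega^3,\omega^4$. The values of 1-adapted coframings form a principal bundle $\mathcal G_1\to M$. Functions $V_1,\dots,V_8$ on $\mathcal G_1$ are defined by $d\omega^1\equiv(V_1+V_5)\omega^0\wedge\omega^3+(V_2+V_6)\omega^0\wedge\omega^4$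 and $d\omega^2\equiv(V_3+V_7)\omega^0\wedge\omega^3+(V_4+V_8)\omega^0\wedge\omega^4$, both mod $\omega^1,\omega^2$; $d\omega^3\equiv(V_8-V_4)\omega^0\wedge\omega^1+(V_2-V_6)\omega^0\wedge\omega^2$ and $d\omega^4\equiv(V_3-V_7)\omega^0\wedge\omega^1+(V_5-V_1)\omega^0\wedge\omega^2$, both mod $\omega^3,\omega^4$. Put $S_1=\begin{pmatrix} V_1 & V_2 \\ V_3 & V_4 \end{pmatrix}$, $S_2=\begin{pmatrix} V_5 & V_6 \\ V_7 & V_8 \end{pmatrix}$. The system is called Euler-Lagrange if $S_2=0$; a hyperbolic Euler-Lagrange system is positive, negative, or degenerate according to whether $\det S_1>0$, $<0$, or $=0$ (independent of the 1-adapted coframing), and non-degenerate if it is positive or negative. **Bäcklund transformations.** A rank-1 Bäcklund transformation relating $(M,\mathcal I)$ and $(\bar M,\bar{\mathcal I})$ (local generators $\theta,d\theta,\Omega$ and $\bar\theta,d\bar\theta,\bar\Omega$) is an embedded 6-manifold $\phi:N\to M\times\bar M$ whose projections $\pi,\bar\pi$ to $M,\bar M$ are submersions with $\ker d\pi\cap\ker d\bar\pi=0$ and such that, modulo $\pi^*\theta,\bar\pi^*\bar\theta$, the subbundles of $\Lambda^2T^*N$ spanned by $\{\pi^*d\theta,\bar\pi^*d\bar\theta\}$ and by $\{\pi^*\Omega,\bar\pi^*\bar\Omega\}$ coincide. **Liftings.** Let $\alpha=(\alpha_0,\dots,\alpha_4)$, $\beta=(\beta_0,\dots,\beta_4)$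 be the tautological 1-forms on $\mathcal G_1$ and on the corresponding bundle $\bar{\mathcal G}_1$ of $(\bar M,\bar{\mathcal I})$, and let $\mathcal P$ be the set of $(u,\bar u,s,t,\mu,\epsilon)$ with $u\in\mathcal G_1$, $\bar u\in\bar{\mathcal G}_1$, $s,t\in\mathbb R^4$, $\mu\ge1$, $\epsilon=\pm1$, $\epsilon\mu^2\ne1$. Let $\mathcal J$ be the Pfaffian system on $\mathcal P$ generated by $\beta_i-s_i\alpha_0-t_i\beta_0-\mu\alpha_i$ $(i=1,2)$, $\beta_3-s_3\alpha_0-t_3\beta_0-\mu^{-1}\alpha_3$, $\beta_4-s_4\alpha_0-t_4\beta_0-\epsilon\mu^{-1}\alpha_4$, with independence condition $\alpha_1\wedge\alpha_2\wedge\alpha_3\wedge\alpha_4\wedge\alpha_0\wedge\beta_0\neq0$. A 0-refined lifting of $\phi$ is a lift $\hat\phi:N\to\mathcal P$ of $\phi$ that is an integral manifold of $\mathcal J$ satisfying the independence condition. The functions $\mu\circ\hat\phi$, $\epsilon\circ\hat\phi$ depend only on $\phi$. A 1-refined lifting is a 0-refined lifting with image in the locus $\{s_1=t_1=s_3=t_3=0,\ s_4=-t_4\mu^2,\ t_2=-\epsilon s_2\mu^2\}$. **Type III.** A rank-1 Bäcklund transformation is special if $\mu=1$ (so $\epsilon=-1$). A special rank-1 Bäcklund transformation relating two hyperbolic Euler-Lagrange systems is of Type III if $V_2\neq0$ on its 1-refined liftings (independent of the chosen 1-refined lifting). *)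

(* Defs.v *)
From HB Require Import structures.
From mathcomp Require Import all_boot all_order all_algebra.
From mathcomp Require Import all_classical all_reals all_analysis.
Import Order.TTheory GRing.Theory Num.Theory.
Import numFieldNormedType.Exports.

Set Implicit Arguments.
Unset Strict Implicit.
Unset Printing Implicit Defensive.

Local Open Scope ring_scope.

(* Analysis over an arbitrary realType of MathComp-Analysis.

   Manifolds are presented as nonempty open subsets of 'rV[R]_n.  Functions,
   forms and maps are total on 'rV[R]_n, but only their values on the relevant
   open set are ever used. *)

(** * Exterior algebra of the dual of 'rV[R]_n *)

(* [w I] is the coefficient of dx_{i1} /\ ... /\ dx_{ik} in [w], where
   I = {i1 < ... < ik}. *)
Definition ext (R : realType) (n : nat) := {ffun {set 'I_n} -> R^o}.

Section Exterior.
Context {R : realType} {n : nat}.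
Implicit Types w z : ext R n.

Definition inversions (I J : {set 'I_n}) : nat :=
  #|[set p : 'I_n * 'I_n | [&& p.1 \in I, p.2 \in J & (p.2 < p.1)%N]]|.

Definition wedge w z : ext R n :=
  [ffun K => \sum_(I in powerset K)
     (-1) ^+ inversions I (K :\: I) * (w I * z (K :\: I))].

Definition ext1 : ext R n := [ffun I : {set 'I_n} => (I == finset.set0)%:R].
Definition dx (i : 'I_n) : ext R n := [ffun I : {set 'I_n} => (I == [set i])%:R].

Definition wedges (s : seq (ext R n)) : ext R n := foldr wedge ext1 s.

Definition grade (k : nat) w : ext R n :=
  [ffun I : {set 'I_n} => if #|I| == k then w I else 0].
Definition homog (k : nat) w : Prop := grade k w = w.

(* Congruence modulo the algebraic ideal generated by the entries of [G]. *)
Definition eqmod (G : seq (ext R n)) w z : Prop :=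
  exists a : 'I_(size G) -> ext R n,
    w - z = \sum_(i < size G) wedge (a i) G`_i.

(* The planes spanned by {w1, w2} and by {z1, z2} coincide modulo [G]. *)
Definition same_span_mod (G : seq (ext R n)) (w1 w2 z1 z2 : ext R n) : Prop :=
  forall w,
    (exists a b : R, eqmod G w (a *: w1 + b *: w2)) <->
    (exists a b : R, eqmod G w (a *: z1 + b *: z2)).

End Exterior.

(* Pullback by the linear map v |-> v *m J: the algebra morphism with
   dx_j |-> \sum_i J i j dx_i. *)
Definition pull (R : realType) (n m : nat) (J : 'M[R]_(n, m)) (w : ext R m) :
    ext R n :=
  \sum_(I : {set 'I_m})
    w I *: wedges [seq \sum_(i < n) J i j *: dx i | j <- enum I].

Local Open Scope classical_set_scope.
Local Open Scope ring_scope.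

(** * Smooth functions, differential forms and exterior derivative *)

Definition partial (R : realType) (n : nat) (i : 'I_n) (f : 'rV[R]_n -> R) :
    'rV[R]_n -> R :=
  fun x => 'D_(delta_mx 0 i) f x.

(* C^oo: every iterated partial derivative exists and is differentiable. *)
Definition smooth (R : realType) (n : nat) (U : set 'rV[R]_n)
    (f : 'rV[R]_n -> R) : Prop :=
  forall (s : seq 'I_n) x, U x -> differentiable (foldr (@partial R n) f s) x.

Definition smooth_map (R : realType) (n m : nat) (U : set 'rV[R]_n)
    (f : 'rV[R]_n -> 'rV[R]_m) : Prop :=
  forall j, smooth U (fun x => f x 0 j).

Definition smooth_ext (R : realType) (n m : nat) (U : set 'rV[R]_n)
    (w : 'rV[R]_n -> ext R m) : Prop :=
  forall I, smooth U (fun x => w x I).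

Section Forms.
Context {R : realType} {n : nat}.

Definition dform := 'rV[R]_n -> ext R n.

Definition extd (w : dform) : dform := fun x =>
  \sum_(i < n) wedge (dx i) [ffun I : {set 'I_n} => partial i (fun y => w y I) x].

Definition kform (k : nat) (U : set 'rV[R]_n) (w : dform) : Prop :=
  smooth_ext U w /\ forall x, U x -> homog k (w x).

(* Ideal of Omega^*(U) generated by the restrictions to U of the forms in S.
   When S is stable under homogeneous components, this left ideal is
   two-sided. *)
Definition ideal_on (U : set 'rV[R]_n) (S : set dform) : set dform :=
  [set w | smooth_ext U w /\
    exists (k : nat) (a g : 'I_k -> dform),
      (forall i, smooth_ext U (a i) /\ S (g i)) /\
      forall x, U x -> w x = \sum_(i < k) wedge (a i x) (g i x)].

(* [I] is a differential ideal of Omega^*(M). *)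
Record differential_ideal (M : set 'rV[R]_n) (I : set dform) : Prop := {
  di_smooth : forall w, I w -> smooth_ext M w;
  di_ext : forall w z, I w -> (forall x, M x -> z x = w x) -> I z;
  di_0 : I (fun=> 0);
  di_add : forall w z, I w -> I z -> I (fun x => w x + z x);
  di_wedgel : forall a w, smooth_ext M a -> I w ->
    I (fun x => wedge (a x) (w x));
  di_wedger : forall a w, smooth_ext M a -> I w ->
    I (fun x => wedge (w x) (a x));
  di_grade : forall k w, I w -> I (fun x => grade k (w x));
  di_d : forall w, I w -> I (extd w) }.

Definition generated_on (U : set 'rV[R]_n) (I S : set dform) : Prop :=
  ideal_on U I = ideal_on U S.

End Forms.
Arguments dform : clear implicits.

(** * Hyperbolic Monge-Ampere systems *)

Section MongeAmpere.
Context {R : realType}.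
Local Notation dform5 := (dform R 5).
Local Notation coframe := ('I_5 -> ext R 5).
Implicit Types (M U : set 'rV[R]_5) (I : set dform5).

Definition hyperbolic_at (th dth Om : ext R 5) : Prop :=
  [/\ wedges [:: th; dth; dth] != 0,
      forall a b : R, eqmod [:: th] (a *: dth + b *: Om) 0 -> a = 0 /\ b = 0
    & exists l1 m1 l2 m2 : R, l1 * m2 != l2 * m1 /\
      forall l m : R, (l, m) != (0, 0) ->
        let Psi := l *: dth + m *: Om in
        eqmod [:: th] (wedge Psi Psi) 0 <->
        (l * m1 = l1 * m \/ l * m2 = l2 * m)].

Record local_generators M I U (th Om : dform5) : Prop := {
  lg_open : open U;
  lg_sub : U `<=` M;
  lg_th : kform 1 U th;
  lg_Om : kform 2 U Om;
  lg_gen : generated_on U I [set w | [\/ w = th, w = extd th | w = Om]];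
  lg_hyp : forall x, U x -> hyperbolic_at (th x) (extd th x) (Om x) }.

Definition hyperbolic_MA M I : Prop :=
  [/\ open M, M !=set0, differential_ideal M I
    & forall x, M x -> exists U th Om, U x /\ local_generators M I U th Om].

(** 1-adapted coframings and their invariants *)

Record adapted1 M I U (om : 'I_5 -> dform5) : Prop := {
  ad_open : open U;
  ad_sub : U `<=` M;
  ad_form : forall i, kform 1 U (om i);
  ad_free : forall x, U x -> wedges [seq om i x | i <- enum 'I_5] != 0;
  ad_gen : generated_on U I
    [set w | [\/ w = om 0, w = (fun x => wedge (om 1 x) (om 2 x))
               | w = (fun x => wedge (om 3 x) (om 4 x))]];
  ad_d0 : forall x, U x -> eqmod [:: om 0 x] (extd (om 0) x)
    (wedge (om 1 x) (om 2 x) + wedge (om 3 x) (om 4 x));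
  ad_d12 : forall x, U x -> forall i : 'I_5, i \in [:: 1; 2] ->
    eqmod [:: om 0 x; om 1 x; om 2 x] (extd (om i) x) 0;
  ad_d34 : forall x, U x -> forall i : 'I_5, i \in [:: 3; 4] ->
    eqmod [:: om 0 x; om 3 x; om 4 x] (extd (om i) x) 0 }.

(* Membership of (x, u) in the bundle G_1 of 1-adapted coframes. *)
Definition G1 M I (x : 'rV[R]_5) (u : coframe) : Prop :=
  exists U om, [/\ adapted1 M I U om, U x & forall i, om i x = u i].

(* Coordinates numbered from 1. *)
Definition co (k : nat) (v : 'rV[R]_k.+1) (i : nat) : R := v 0 (inord i.-1).
Arguments co {k} v i%_N.

(* [V] is the value at (x, u) of the functions (V_1, ..., V_8) on G_1; as these
   are well defined, any 1-adapted coframing extending u computes them. *)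
Definition V_at M I (x : 'rV[R]_5) (u : coframe) (V : 'rV[R]_8) : Prop :=
  exists U om, [/\ adapted1 M I U om, U x, forall i, om i x = u i &
    let w i j := wedge (u i) (u j) in
    [/\ eqmod [:: u 1; u 2] (extd (om 1) x)
          ((co V 1 + co V 5) *: w 0 3 + (co V 2 + co V 6) *: w 0 4),
        eqmod [:: u 1; u 2] (extd (om 2) x)
          ((co V 3 + co V 7) *: w 0 3 + (co V 4 + co V 8) *: w 0 4),
        eqmod [:: u 3; u 4] (extd (om 3) x)
          ((co V 8 - co V 4) *: w 0 1 + (co V 2 - co V 6) *: w 0 2)
      & eqmod [:: u 3; u 4] (extd (om 4) x)
          ((co V 3 - co V 7) *: w 0 1 + (co V 5 - co V 1) *: w 0 2)]].

Definition S1 (V : 'rV[R]_8) : 'M[R]_2 := \matrix_(i, j) co V (2 * i + j + 1).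
Definition S2 (V : 'rV[R]_8) : 'M[R]_2 := \matrix_(i, j) co V (2 * i + j + 5).

Definition hyperbolic_EL M I : Prop :=
  hyperbolic_MA M I /\
  forall x u V, M x -> G1 M I x u -> V_at M I x u V -> S2 V = 0.

Definition det_S1_satisfies (P : R -> Prop) M I : Prop :=
  forall x u V, M x -> G1 M I x u -> V_at M I x u V -> P (\det (S1 V)).

Definition positive_EL M I : Prop :=
  hyperbolic_EL M I /\ det_S1_satisfies (fun r => 0 < r) M I.
Definition negative_EL M I : Prop :=
  hyperbolic_EL M I /\ det_S1_satisfies (fun r => r < 0) M I.
Definition degenerate_EL M I : Prop :=
  hyperbolic_EL M I /\ det_S1_satisfies (fun r => r = 0) M I.
Definition nondegenerate_EL M I : Prop :=
  positive_EL M I \/ negative_EL M I.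

End MongeAmpere.

(** * Rank-1 Backlund transformations *)

Section Backlund.
Context {R : realType}.
Local Notation coframe := ('I_5 -> ext R 5).
Variables (M : set 'rV[R]_5) (I : set (dform R 5)).
Variables (Mb : set 'rV[R]_5) (Ib : set (dform R 5)).
Variables (N : set 'rV[R]_6) (phi : 'rV[R]_6 -> 'rV[R]_5 * 'rV[R]_5).

Definition prl (p : 'rV[R]_6) : 'rV[R]_5 := (phi p).1.
Definition prr (p : 'rV[R]_6) : 'rV[R]_5 := (phi p).2.

(* Pullbacks to T^*_p N of forms at prl p and prr p. *)
Definition pl (p : 'rV[R]_6) (w : ext R 5) : ext R 6 := pull ('J prl p) w.
Definition pr (p : 'rV[R]_6) (w : ext R 5) : ext R 6 := pull ('J prr p) w.

(* [bk_ker] also says that phi is an immersion; together with [bk_inj] and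
   [bk_homeo] it makes phi an embedding.  The span condition is not invariant
   under Om |-> Om + f dth, so it is required for some local generators. *)
Record backlund : Prop := {
  bk_open : open N;
  bk_nonempty : N !=set0;
  bk_into : forall p, N p -> M (prl p) /\ Mb (prr p);
  bk_smooth : smooth_map N prl /\ smooth_map N prr;
  bk_inj : {in [set` N] &, injective phi};
  bk_homeo : forall p A, N p -> nbhs p A ->
    exists2 B, nbhs (phi p) B & forall q, N q -> B (phi q) -> A q;
  bk_subl : forall p, N p -> forall v, exists h, 'd prl p h = v;
  bk_subr : forall p, N p -> forall v, exists h, 'd prr p h = v;
  bk_ker : forall p, N p -> forall h, 'd prl p h = 0 -> 'd prr p h = 0 -> h = 0;
  bk_span : forall p, N p -> exists (U : set 'rV[R]_5) th Om (Ub : set 'rV[R]_5) thb Omb,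
    [/\ U (prl p), Ub (prr p),
        local_generators M I U th Om, local_generators Mb Ib Ub thb Omb
      & forall q, N q -> U (prl q) -> Ub (prr q) ->
        same_span_mod [:: pl q (th (prl q)); pr q (thb (prr q))]
          (pl q (extd th (prl q))) (pr q (extd thb (prr q)))
          (pl q (Om (prl q))) (pr q (Omb (prr q)))] }.

(** Liftings *)

Record lift_point := LiftPoint {
  base : 'rV[R]_5;
  fr : coframe;
  baseb : 'rV[R]_5;
  frb : coframe;
  sv : 'rV[R]_4;
  tv : 'rV[R]_4;
  mu : R;
  eps : R }.

(* The space P. *)
Definition in_P (z : lift_point) : Prop :=
  [/\ G1 M I (base z) (fr z), G1 Mb Ib (baseb z) (frb z), 1 <= mu z,
      eps z = 1 \/ eps z = -1 & eps z * mu z ^+ 2 != 1].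

Definition smooth_lift (W : set 'rV[R]_6) (h : 'rV[R]_6 -> lift_point) : Prop :=
  [/\ smooth_map W (base \o h) /\ smooth_map W (baseb \o h),
      forall i, smooth_ext W (fun p => fr (h p) i) /\
                smooth_ext W (fun p => frb (h p) i),
      smooth_map W (sv \o h) /\ smooth_map W (tv \o h),
      smooth W (mu \o h) & smooth W (eps \o h)].

(* 0-refined lifting over an open subset W of N.  Since h covers phi, the
   pullback by h of the tautological forms alpha_i, beta_i at p is the pullback
   by prl, prr of the i-th covectors of the coframes h(p). *)
Definition lifting0 (W : set 'rV[R]_6) (h : 'rV[R]_6 -> lift_point) : Prop :=
  [/\ open W, W `<=` N, smooth_lift W h &
    forall p, W p ->
      let z := h p in
      let alpha i := pl p (fr z i) in
      let beta i := pr p (frb z i) in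
      let rel (i : 'I_5) c := beta i =
        co (sv z) i *: alpha 0 + co (tv z) i *: beta 0 + c *: alpha i in
      [/\ in_P z, base z = prl p /\ baseb z = prr p,
          [/\ rel 1 (mu z), rel 2 (mu z),
              rel 3 (mu z)^-1 & rel 4 (eps z * (mu z)^-1)]
        & wedges [:: alpha 1; alpha 2; alpha 3; alpha 4; alpha 0; beta 0]
            != 0]].

Definition lifting1 (W : set 'rV[R]_6) (h : 'rV[R]_6 -> lift_point) : Prop :=
  lifting0 W h /\
  forall p, W p ->
    let z := h p in
    let s := sv z in let t := tv z in
    [/\ co s 1 = 0 /\ co t 1 = 0, co s 3 = 0 /\ co t 3 = 0,
        co s 4 = - co t 4 * mu z ^+ 2 & co t 2 = - eps z * co s 2 * mu z ^+ 2].

(* Liftings exist only locally in general; as mu o h depends only on phi, mu = 1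
   is required of every lifting, and the existence clause rules out
   vacuity.  On P, mu = 1 forces eps = -1. *)
Definition special : Prop :=
  (forall p, N p -> exists W h, W p /\ lifting0 W h) /\
  (forall W h, lifting0 W h -> forall p, W p -> mu (h p) = 1).

Definition type_III_backlund : Prop :=
  [/\ backlund, special, hyperbolic_EL M I, hyperbolic_EL Mb Ib &
    (forall p, N p -> exists W h, W p /\ lifting1 W h) /\
    (forall W h, lifting1 W h -> forall p V, W p ->
       V_at M I (base (h p)) (fr (h p)) V -> co V 2 != 0)].

End Backlund.

(* Main.v *)
Require Import Defs.
From HB Require Import structures.
From Stdlib Require Import PeanoNat.
From mathcomp Require Import all_boot all_order all_algebra.
From mathcomp Require Import all_classical all_reals all_analysis.
From mathcomp Require Import ring lra.
Import Order.TTheory GRing.Theory Num.Theory.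
Import numFieldNormedType.Exports.

(**
Take functions with c' = sg s, s' = c and c^2 - sg s^2 = 1 (cos and sin for sg = -1, cosh and
sinh for sg = 1), and on R^6 with coordinates (X, T, W, u, v, k) put E = exp W and
    A = E (c du + s dv),  B = - E (s du + sg c dv),  K = E^2 (dk - 2 sg u dv)
with c, s evaluated at T.  Then
    dA = dW A + sg B dT,   dB = dW B + A dT,   dK = 2 dW K + 2 A B,
so the two coframings
    a = (B - dX, A + dW, dX, A, dT - dX),   b = (K - B, A + dW, K, A, 2 B - dT - K)
have constant structure equations.  The first does not involve k and the second does not involve
X, hence they live on the quotients of R^6 by d/dk and d/dX, where they are 1-adapted with S_2 = 0
and S_1 = (0 sg; 0 0), respectively S_1 = (0 sg; 2 0), of determinants 0 and - 2 sg.  On R^6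
    b1 = a1,  b2 = a2 + (a0 + b0),  b3 = a3,  b4 = - a4 + (a0 - b0),
which is a 1-refined lifting with mu = 1, eps = -1 and s_2 = s_4 = 1.

Any other 1-adapted coframing is, up to exchanging the two characteristic systems, obtained from
the reference one by a scale f and two matrices P, Q with det P = det Q = f: this follows by
differentiating the identities om0 a0 = 0, om1 a0 a1 a2 = 0 and om1 a1 a2 = 0.  It turns S_1 into
P S_1 Q^-1 / f and keeps S_2 = 0.
*)

Set Implicit Arguments.
Unset Strict Implicit.
Unset Printing Implicit Defensive.

Local Open Scope ring_scope.

(** * Exterior algebra *)

(** The definitions quantify over all 1-adapted coframings and all liftings, so exhibiting good
    frames is the smaller half of the work. An arbitrary coframing is related to the reference one
    only pointwise, with coefficients not known to be smooth; so products of forms that vanish on an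
    open set are differentiated, never the coefficients. Once all coframings are known, wedging the
    lifting relations with a0 b0 compares decomposable 2-forms, and their scales give mu^4 = - eps,
    hence eps = -1 and mu = 1. On a 1-refined lifting the first and third covectors of the two
    frames agree; this kills two coefficients of the coframing and leaves V_2 a nonzero multiple of
    sg.

    The sign in b4 = - a4 + ... serves the span condition: modulo a0 and b0, d b0 is a1 a2 - a3 a4
    and d a0 is b1 b2 - b3 b4, so each contact differential is the second generator of the other
    system.

    As the structure equations are constant, most verifications are polynomial identities in a few
    1-forms, left to a reflective normaliser. *)

Notation "x &^ y" := (wedge x y) (at level 38, right associativity).

Section ExteriorAlgebra.
Context {R : realType} {n : nat}.
Implicit Types (v w x y z : ext R n) (I J K L : {set 'I_n}).

Lemma wedgeDl x y z : (x + y) &^ z = x &^ z + y &^ z.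
Proof.
apply/ffunP => K; rewrite !ffunE -big_split; apply: eq_bigr => I _ /=.
by rewrite !ffunE mulrDl mulrDr.
Qed.

Lemma wedgeDr x y z : x &^ (y + z) = x &^ y + x &^ z.
Proof.
apply/ffunP => K; rewrite !ffunE -big_split; apply: eq_bigr => I _ /=.
by rewrite !ffunE !mulrDr.
Qed.

Lemma wedgeZl c x y : (c *: x) &^ y = c *: (x &^ y).
Proof.
apply/ffunP => K; rewrite !ffunE /= scaler_sumr; apply: eq_bigr => I _ /=.
rewrite !ffunE /=; change (c *: (x I : R^o)) with (c * x I).
set t := (_ ^+ _); change ((t * (c * x I * y (K :\: I)) : R) = c * (t * (x I * y (K :\: I)))).
ring.
Qed.

Lemma wedgeZr c x y : x &^ (c *: y) = c *: (x &^ y).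
Proof.
apply/ffunP => K; rewrite !ffunE /= scaler_sumr; apply: eq_bigr => I _ /=.
rewrite !ffunE /=.
set t := (_ ^+ _); change ((t * (x I * (c * y (K :\: I))) : R) = c * (t * (x I * y (K :\: I)))).
ring.
Qed.

Lemma wedge0l x : 0 &^ x = 0.
Proof. by have := wedgeZl 0 0 x; rewrite !scale0r. Qed.
Lemma wedge0r x : x &^ 0 = 0.
Proof. by have := wedgeZr 0 x 0; rewrite !scale0r. Qed.
Lemma wedgeNl x y : (- x) &^ y = - (x &^ y).
Proof. by rewrite -scaleN1r wedgeZl scaleN1r. Qed.
Lemma wedgeNr x y : x &^ (- y) = - (x &^ y).
Proof. by rewrite -scaleN1r wedgeZr scaleN1r. Qed.
Lemma wedge_suml (T : Type) (r : seq T) (P : pred T) (F : T -> ext R n) x :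
  (\sum_(i <- r | P i) F i) &^ x = \sum_(i <- r | P i) (F i &^ x).
Proof.
apply: (big_morph (fun y => y &^ x)) => [y z|]; first exact: wedgeDl.
exact: wedge0l.
Qed.
Lemma wedge_sumr (T : Type) (r : seq T) (P : pred T) (F : T -> ext R n) x :
  x &^ (\sum_(i <- r | P i) F i) = \sum_(i <- r | P i) (x &^ F i).
Proof.
apply: (big_morph (fun y => x &^ y)) => [y z|]; first exact: wedgeDr.
exact: wedge0r.
Qed.

Definition ebase I : ext R n := [ffun J : {set 'I_n} => (J == I)%:R].

Lemma dx_ebase i : dx i = ebase [set i]. Proof. by []. Qed.
Lemma ext1_ebase : ext1 = ebase finset.set0. Proof. by []. Qed.

Lemma ext_ebase w : w = \sum_I w I *: ebase I.
Proof.
apply/ffunP => K; rewrite sum_ffunE (bigD1 K) //= big1 => [|I IK].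
  by rewrite !ffunE eqxx /= addr0; exact: (esym (mulr1 _)).
by rewrite !ffunE eq_sym (negbTE IK); exact: mulr0.
Qed.

(** The signs of the defining sum are evaluated once, on monomials; associativity, units and graded
    commutation then follow by bilinearity. *)
Lemma ebase_wedge I J : ebase I &^ ebase J =
  if [disjoint I & J] then (-1) ^+ inversions I J *: ebase (I :|: J) else 0.
Proof.
apply/ffunP => K; rewrite ffunE.
have [sIK|nsIK] := boolP (I \subset K); last first.
  rewrite big1 => [|L]; last first.
    rewrite powersetE => LK; rewrite !ffunE.
    have [LI|] := eqVneq L I; last by rewrite mul0r mulr0.
    by rewrite -LI LK in nsIK.
  case: ifP => _; rewrite ffunE //= ffunE.
  have [KE|] := eqVneq K (I :|: J); last by rewrite scaler0.
  by rewrite KE finset.subsetUl in nsIK.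
rewrite (bigD1 I) ?powersetE //= big1 => [|L /andP[_ LI]]; last first.
  by rewrite !ffunE (negbTE LI) mul0r mulr0.
rewrite addr0 !ffunE eqxx mul1r.
have [KJ|KJ] := eqVneq (K :\: I) J.
  have -> : [disjoint I & J].
    by rewrite -KJ finset.disjoints_subset finset.setDE finset.setCI finset.setCK finset.subsetUr.
  rewrite !ffunE -KJ; have -> : I :|: K :\: I = K.
    by apply/finset.setP => i; rewrite !inE; case iI: (i \in I) => //=; rewrite (fintype.subsetP sIK _ iI).
  by rewrite eqxx /=.
rewrite mulr0; case: ifP => dIJ; rewrite ffunE //= ffunE.
have [KE|] := eqVneq K (I :|: J); last by rewrite scaler0.
move: KJ; rewrite KE finset.setDUl finset.setDv finset.set0U => /eqP[].
by apply/finset.setDidPl; rewrite disjoint_sym.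
Qed.

Lemma inversionsUl I J K : [disjoint I & J] ->
  inversions (I :|: J) K = (inversions I K + inversions J K)%N.
Proof.
move=> dIJ; rewrite /inversions -finset.cardsUI [X in (_ + X)%N](_ : _ = 0)%N ?addn0.
  by apply: eq_card => -[i j]; rewrite !inE /=; case: (i \in I); case: (i \in J); case: (j \in K); case: (j < i)%N.
apply/eqP; rewrite finset.cards_eq0; apply/eqP/finset.setP => -[i j]; rewrite !inE /=.
by case iI: (i \in I) => //=; rewrite (disjointFr dIJ iI) andbF.
Qed.

Lemma inversionsUr I J K : [disjoint I & J] ->
  inversions K (I :|: J) = (inversions K I + inversions K J)%N.
Proof.
move=> dIJ; rewrite /inversions -finset.cardsUI [X in (_ + X)%N](_ : _ = 0)%N ?addn0.
  by apply: eq_card => -[i j]; rewrite !inE /=; case: (j \in I); case: (j \in J); case: (i \in K); case: (j < i)%N.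
apply/eqP; rewrite finset.cards_eq0; apply/eqP/finset.setP => -[i j]; rewrite !inE /=.
by case jI: (j \in I); rewrite ?(disjointFr dIJ jI) /= ?andbF.
Qed.

Lemma wedgeA x y z : x &^ (y &^ z) = (x &^ y) &^ z.
Proof.
rewrite [x]ext_ebase !wedge_suml; apply: eq_bigr => I _.
rewrite !wedgeZl; congr (_ *: _).
rewrite [y]ext_ebase wedge_suml !wedge_sumr wedge_suml; apply: eq_bigr => J _.
rewrite wedgeZr !wedgeZl wedgeZr; congr (_ *: _).
rewrite [z]ext_ebase !wedge_sumr; apply: eq_bigr => K _.
rewrite !wedgeZr; congr (_ *: _).
rewrite !ebase_wedge.
have [dIJ|dIJ] := boolP [disjoint I & J]; have [dJK|dJK] := boolP [disjoint J & K];
  rewrite ?(wedgeZl, wedgeZr, wedge0l, wedge0r, ebase_wedge) //.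
- have dU : [disjoint I & J :|: K] = [disjoint I & K].
    rewrite -!finset.setI_eq0 finset.setIUr finset.setU_eq0 !finset.setI_eq0.
    by rewrite dIJ.
  have dU' : [disjoint I :|: J & K] = [disjoint I & K].
    rewrite -!finset.setI_eq0 finset.setIUl finset.setU_eq0 !finset.setI_eq0.
    by rewrite dJK andbT.
  rewrite dU dU'; case: ifP => dIK; last by rewrite !scaler0.
  (* Both bracketings carry the sign exponent inv(I,J) + inv(I,K) + inv(J,K). *)
  rewrite !scalerA -!exprD finset.setUA inversionsUl // inversionsUr //.
  by congr (_ *: _); congr (_ ^+ _); ring.
- rewrite ifF ?scaler0 //; apply: contraNF dJK; apply: disjointWl.
  exact: finset.subsetUr.
- rewrite ifF ?scaler0 //; apply: contraNF dIJ; apply: disjointWr.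
  exact: finset.subsetUl.
Qed.

Lemma inversions0l I : inversions finset.set0 I = 0%N.
Proof. by apply/eqP; rewrite finset.cards_eq0; apply/eqP/finset.setP => i; rewrite !inE. Qed.
Lemma inversions0r I : inversions I finset.set0 = 0%N.
Proof. by apply/eqP; rewrite finset.cards_eq0; apply/eqP/finset.setP => i; rewrite !inE /= andbF. Qed.

Lemma wedge1l x : ext1 &^ x = x.
Proof.
rewrite [x]ext_ebase wedge_sumr; apply: eq_bigr => I _.
rewrite wedgeZr ext1_ebase ebase_wedge -finset.setI_eq0 finset.set0I eqxx.
by rewrite inversions0l scale1r finset.set0U.
Qed.
Lemma wedge1r x : x &^ ext1 = x.
Proof.
rewrite [x]ext_ebase wedge_suml; apply: eq_bigr => I _.
rewrite wedgeZl ext1_ebase ebase_wedge -finset.setI_eq0 finset.setI0 eqxx.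
by rewrite inversions0r scale1r finset.setU0.
Qed.

(** The grading involution. Elements of [ext] may be inhomogeneous, so moving a 1-form past one of
    them costs this involution rather than a single sign. *)
Definition ginv w : ext R n := [ffun I : {set 'I_n} => (-1) ^+ #|I| * w I].

Lemma ginvD x y : ginv (x + y) = ginv x + ginv y.
Proof. by apply/ffunP => I; rewrite !ffunE mulrDr. Qed.
Lemma ginvZ c x : ginv (c *: x) = c *: ginv x.
Proof. apply/ffunP => I; rewrite !ffunE; exact: mulrCA. Qed.
Lemma ginvK x : ginv (ginv x) = x.
Proof. by apply/ffunP => I; rewrite !ffunE mulrA -expr2 sqrr_sign mul1r. Qed.
Lemma ginv_sum (T : Type) (r : seq T) (F : T -> ext R n) :
  ginv (\sum_(i <- r) F i) = \sum_(i <- r) ginv (F i).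
Proof.
apply: (big_morph ginv) => [y z|]; first exact: ginvD.
by apply/ffunP => I; rewrite !ffunE mulr0.
Qed.

(** Each element of [I] lies either below or above [i], so it is counted in exactly one of the two
    terms. *)
Lemma inversions1 i I : i \notin I ->
  (inversions [set i] I + inversions I [set i])%N = #|I|.
Proof.
move=> iI; rewrite /inversions.
have -> : #|[set p : 'I_n * 'I_n | [&& p.1 \in [set i], p.2 \in I & (p.2 < p.1)%N]]|
  = #|[set j in I | (j < i)%N]|.
  rewrite -(finset.card_imset _ (f := fun j : 'I_n => (i, j))); last by move=> j k [].
  apply: eq_card => -[k j]; rewrite !inE /=; apply/and3P/imsetP => [[/eqP -> jI ji]|[j' ]].
    by exists j => //; rewrite !inE jI.
  by rewrite !inE => /andP[j'I j'i] [-> ->].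
have -> : #|[set p : 'I_n * 'I_n | [&& p.1 \in I, p.2 \in [set i] & (p.2 < p.1)%N]]|
  = #|[set j in I | ~~ (j < i)%N]|.
  rewrite -(finset.card_imset _ (f := fun j : 'I_n => (j, i))); last by move=> j k [].
  apply: eq_card => -[j k]; rewrite !inE /=; apply/and3P/imsetP => [[jI /eqP -> ji]|[j' ]].
    by exists j => //; rewrite !inE jI -leqNgt ltnW.
  rewrite !inE -leqNgt => /andP[j'I j'i] [-> ->]; split => //.
  rewrite ltn_neqAle j'i andbT; apply: contraNneq iI => ij.
  by rewrite (_ : i = j') //; apply: val_inj.
rewrite -(finset.cardsID [set j : 'I_n | (j < i)%N] I); congr (_ + _)%N.
  by apply: eq_card => j; rewrite !inE.
by apply: eq_card => j; rewrite !inE andbC.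
Qed.

Lemma dx_wedge i w : dx i &^ w = ginv w &^ dx i.
Proof.
rewrite [w]ext_ebase wedge_sumr ginv_sum wedge_suml; apply: eq_bigr => I _.
rewrite ginvZ !wedgeZr wedgeZl; congr (_ *: _).
have -> : ginv (ebase I) = (-1) ^+ #|I| *: ebase I.
  apply/ffunP => J; rewrite !ffunE; have [->//|_] := eqVneq J I.
  by rewrite mulr0; exact: (esym (mulr0 _)).
rewrite wedgeZl dx_ebase !ebase_wedge disjoint_sym.
case: ifP => dI; last by rewrite scaler0.
rewrite finset.setUC scalerA -exprD; congr (_ *: _).
rewrite -(@inversions1 i I) -?addnA ?addnn; last first.
  by rewrite disjoint_sym finset.disjoints1 in dI.
by rewrite exprD -mul2n exprM sqrrN !expr1n mulr1.
Qed.

Lemma homogE k w : homog k w <-> forall I, #|I| != k -> w I = 0.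
Proof.
split=> [<- I /negbTE Ik|H]; first by rewrite ffunE Ik.
by apply/ffunP => I; rewrite ffunE; case: eqVneq => // /H ->.
Qed.

Lemma homog_dx i : homog 1 (dx i : ext R n).
Proof.
apply/homogE => I; rewrite ffunE; have [->|//] := eqVneq I [set i].
by rewrite finset.cards1.
Qed.
Lemma homog0 k : homog k (0 : ext R n).
Proof. by apply/homogE => I _; rewrite ffunE. Qed.
Lemma homogD k x y : homog k x -> homog k y -> homog k (x + y).
Proof. by move=> /homogE hx /homogE hy; apply/homogE => I Ik; rewrite ffunE hx // hy // addr0. Qed.
Lemma homogZ k c x : homog k x -> homog k (c *: x).
Proof. by move=> /homogE hx; apply/homogE => I Ik; rewrite ffunE hx // scaler0. Qed.
Lemma homogN k x : homog k x -> homog k (- x).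
Proof. by rewrite -scaleN1r; exact: homogZ. Qed.
Lemma homogB k x y : homog k x -> homog k y -> homog k (x - y).
Proof. by move=> hx hy; apply: homogD => //; exact: homogN. Qed.

Lemma homog1E w : homog 1 w -> w = \sum_i w [set i] *: dx i.
Proof.
move=> /homogE hw; apply/ffunP => K; rewrite sum_ffunE.
have [/eqP/finset.cards1P[i ->]|K1] := eqVneq #|K| 1%N.
  rewrite (bigD1 i) //= big1 => [|j ji]; last first.
    rewrite !ffunE (inj_eq finset.set1_inj) eq_sym (negbTE ji); exact: mulr0.
  by rewrite !ffunE eqxx addr0; exact: (esym (mulr1 _)).
rewrite hw // big1 // => i _; rewrite !ffunE.
have [KE|_] := eqVneq K [set i]; last exact: mulr0.
by rewrite KE finset.cards1 eqxx in K1.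
Qed.

Lemma form1_wedge v w : homog 1 v -> v &^ w = ginv w &^ v.
Proof.
move=> /homog1E ->; rewrite wedge_suml wedge_sumr; apply: eq_bigr => i _.
by rewrite wedgeZl wedgeZr dx_wedge.
Qed.

Lemma ginv1 v : homog 1 v -> ginv v = - v.
Proof.
move=> /homogE hv; apply/ffunP => I; rewrite !ffunE.
have [-> |/hv ->] := eqVneq #|I| 1%N; first by rewrite expr1 mulN1r.
by rewrite mulr0 oppr0.
Qed.

Lemma form1C v w : homog 1 v -> homog 1 w -> v &^ w = - (w &^ v).
Proof. by move=> hv hw; rewrite form1_wedge // ginv1 // wedgeNl. Qed.

Lemma form1_sq v : homog 1 v -> v &^ v = 0.
Proof.
move=> hv; have : (2%:R : R) *: (v &^ v) = 0.
  by rewrite scaler_nat mulr2n {1}form1C // addNr.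
by move/eqP; rewrite scaler_eq0 pnatr_eq0 /= => /eqP.
Qed.

Lemma form1CA v w x : homog 1 v -> homog 1 w -> v &^ w &^ x = - (w &^ v &^ x).
Proof. by move=> hv hw; rewrite !wedgeA (form1C hv hw) wedgeNl. Qed.

Lemma form1_sqA v x : homog 1 v -> v &^ v &^ x = 0.
Proof. by move=> hv; rewrite wedgeA form1_sq // wedge0l. Qed.

(** Truncated subtraction would produce grade 0 when [k < j], hence the explicit case. *)
Lemma grade_wedge k j x y : homog j y ->
  grade k (x &^ y) = if (j <= k)%N then grade (k - j) x &^ y else 0.
Proof.
move=> /homogE hy; apply/ffunP => K; rewrite ffunE.
case: (leqP j k) => jk; last first.
  rewrite [RHS]ffunE; case: eqP => // Kk; rewrite ffunE big1 // => I.
  rewrite powersetE => IK; rewrite hy ?mulr0 //.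
  by rewrite neq_ltn (leq_ltn_trans _ jk) // -Kk subset_leq_card // finset.subsetDl.
case: eqP => Kk; rewrite !ffunE.
  apply: eq_bigr => I; rewrite powersetE => IK; rewrite ffunE.
  have [Kj|Kj] := eqVneq #|K :\: I| j; last by rewrite hy // !mulr0.
  have := finset.cardsID I K; rewrite Kj (finset.setIidPr IK) Kk => <-.
  by rewrite addnK eqxx.
rewrite big1 // => I; rewrite powersetE => IK; rewrite ffunE.
have [Kj|Kj] := eqVneq #|K :\: I| j; last by rewrite hy // !mulr0.
case: eqP => [Ik|_]; last by rewrite mul0r mulr0.
by have := finset.cardsID I K; rewrite Kj (finset.setIidPr IK) Ik subnK // => /esym/Kk.
Qed.

Lemma gradeD k x y : grade k (x + y) = grade k x + grade k y.
Proof. by apply/ffunP => I; rewrite !ffunE; case: ifP => //; rewrite addr0. Qed.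

Lemma homog_wedge k j x y : homog k x -> homog j y -> homog (k + j) (x &^ y).
Proof. by move=> hx hy; rewrite /homog (grade_wedge _ _ hy) leq_addl addnK hx. Qed.

Lemma homog11 v w : homog 1 v -> homog 1 w -> homog 2 (v &^ w).
Proof. exact: (@homog_wedge 1 1). Qed.
End ExteriorAlgebra.

Local Open Scope classical_set_scope.
Local Open Scope ring_scope.

(** * Smooth functions and forms *)

(** Forms are total functions of which only the values on an open set matter, so differentiability
    must be insensitive to changes away from the point. *)
Lemma near_eq_differentiable (R : realType) (V W : normedModType R)
    (f g : V -> W) (x : V) :
  (\forall y \near x, f y = g y) -> differentiable f x -> differentiable g x.
Proof.
move=> fg /diff_locallyP [cf fE]; have fgx : f x = g x := nbhs_singleton fg.
suff H : g \o shift x = cst (g x) + 'd f x +o_ 0 id.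
  have E := diff_unique cf H.
  by apply/diff_locallyP; split; rewrite E.
apply/eqaddoP => _/posnumP[eps].
move/eqaddoP: fE => /(_ eps%:num (gt0 _)) fE.
have fg' : \forall y \near (0 : V), f (y + x) = g (y + x).
  by move: fg; rewrite (near_shift 0 x); apply: filterS => y; rewrite /= subr0.
apply: filterS2 fg' fE => y e.
have -> : (f \o shift x - (cst (f x) + 'd f x)) y = f (y + x) - (f x + 'd f x y) by [].
have -> : (g \o shift x - (cst (g x) + 'd f x)) y = g (y + x) - (g x + 'd f x y) by [].
by rewrite e fgx.
Qed.

Section Smooth.
Context {R : realType} {n : nat}.
Implicit Types (U : set 'rV[R]_n) (f g : 'rV[R]_n -> R) (x : 'rV[R]_n).

Lemma open_near U x (P : 'rV[R]_n -> Prop) : open U -> U x ->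
  (forall y, U y -> P y) -> \forall y \near x, P y.
Proof. by move=> oU Ux UP; apply: filterS UP _; exact: open_nbhs_nbhs. Qed.

Lemma partial_near i f g x : (\forall y \near x, f y = g y) ->
  partial i f x = partial i g x.
Proof. by move=> fg; rewrite /partial; apply: near_eq_derive. Qed.

(** Coinductive access to smoothness. The definition runs over all sequences of partial derivatives,
    and induction on a sequence needs a class that contains, up to equality on [U], the partial
    derivatives of its members. *)
Lemma smooth_coind U (P : ('rV[R]_n -> R) -> Prop) : open U ->
  (forall f, P f -> (forall x, U x -> differentiable f x) /\
     forall i, exists2 g, P g & forall x, U x -> partial i f x = g x) ->
  forall f, P f -> smooth U f.
Proof.
move=> oU HP f Pf s.
suff [g Pg fg] : exists2 g, P g & forall x, U x -> foldr (@partial R n) f s x = g x.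
  move=> x Ux; apply: (@near_eq_differentiable _ _ _ g); last by apply: (HP _ Pg).1.
  by apply: open_near oU Ux _ => y /fg.
elim: s => [|i s [g Pg fg]] /=; first by exists f.
have [h Ph gh] := (HP _ Pg).2 i; exists h => // x Ux.
by rewrite -gh //; apply: partial_near; apply: open_near oU Ux _.
Qed.

Lemma smooth_diff U f x : smooth U f -> U x -> differentiable f x.
Proof. by move=> /(_ [::] x). Qed.
Lemma smooth_partial U f i : smooth U f -> smooth U (partial i f).
Proof. by move=> Sf s x Ux; have := Sf (rcons s i) x Ux; rewrite foldr_rcons. Qed.
Lemma smooth_sub U V f : U `<=` V -> smooth V f -> smooth U f.
Proof. by move=> UV Sf s x /UV; exact: Sf. Qed.
Lemma smooth_eq U f g : open U -> (forall x, U x -> f x = g x) -> smooth U f -> smooth U g.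
Proof.
move=> oU fg Sf; apply: (@smooth_coind U (fun g => exists2 f, smooth U f & forall x, U x -> f x = g x)) => //; last by exists f.
move=> {}g [{}f {}Sf {}fg]; split=> [x Ux|i].
  apply: near_eq_differentiable (smooth_diff Sf Ux).
  exact: open_near oU Ux _.
exists (partial i f); last first.
  by move=> x Ux; apply: partial_near; apply: open_near oU Ux _ => y /fg.
by exists (partial i f) => //; exact: smooth_partial.
Qed.

Lemma partialD i f g x : differentiable f x -> differentiable g x ->
  partial i (fun y => f y + g y) x = partial i f x + partial i g x.
Proof. by move=> df dg; rewrite /partial (@deriveD _ _ _ f g) //; exact: diff_derivable. Qed.
Lemma partialM i f g x : differentiable f x -> differentiable g x ->
  partial i (fun y => f y * g y) x = f x * partial i g x + g x * partial i f x.
Proof. by move=> df dg; rewrite /partial (@deriveM _ _ f g) //; exact: diff_derivable. Qed.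
Lemma partial_cst i c x : partial i (fun=> c) x = 0.
Proof. by rewrite /partial (@derive_cst _ _ _ c). Qed.

(** By the Leibniz rule the partial derivatives of a product are sums of products, so products alone
    do not form a class to which [smooth_coind] applies; this closure does. *)
Inductive smooth_poly U : ('rV[R]_n -> R) -> Prop :=
| SPbase f : smooth U f -> smooth_poly U f
| SPadd f g : smooth_poly U f -> smooth_poly U g -> smooth_poly U (fun x => f x + g x)
| SPmul f g : smooth_poly U f -> smooth_poly U g -> smooth_poly U (fun x => f x * g x).

Lemma smooth_polyP U f : open U -> smooth_poly U f -> smooth U f.
Proof.
move=> oU; apply: smooth_coind oU _ f => f; elim=> {f}.
- move=> f Sf; split=> [x Ux|i]; first exact: smooth_diff Sf Ux.
  by exists (partial i f) => //; apply: SPbase; exact: smooth_partial.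
- move=> f g _ [df Hf] _ [dg Hg]; split=> [x Ux|i].
    by apply: (@differentiableD _ _ _ f g); [exact: df | exact: dg].
  have [f' Pf' ff'] := Hf i; have [g' Pg' gg'] := Hg i.
  exists (fun x => f' x + g' x); first exact: SPadd.
  by move=> x Ux; rewrite partialD ?ff' ?gg' //; [exact: df | exact: dg].
- move=> f g Pf [df Hf] Pg [dg Hg]; split=> [x Ux|i].
    by apply: (@differentiableM _ _ f g); [exact: df | exact: dg].
  have [f' Pf' ff'] := Hf i; have [g' Pg' gg'] := Hg i.
  exists (fun x => f x * g' x + g x * f' x); first by apply: SPadd; exact: SPmul.
  by move=> x Ux; rewrite partialM ?ff' ?gg' //; [exact: df | exact: dg].
Qed.

Lemma smoothD U f g : open U -> smooth U f -> smooth U g -> smooth U (fun x => f x + g x).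
Proof. by move=> oU Sf Sg; apply: smooth_polyP => //; apply: SPadd; exact: SPbase. Qed.
Lemma smoothM U f g : open U -> smooth U f -> smooth U g -> smooth U (fun x => f x * g x).
Proof. by move=> oU Sf Sg; apply: smooth_polyP => //; apply: SPmul; exact: SPbase. Qed.

Lemma smooth_cst U c : open U -> smooth U (fun=> c).
Proof.
move=> oU; apply: (@smooth_coind U (fun f => exists c, f = fun=> c)) => //; last by exists c.
move=> f [{}c ->]; split=> [x _|i]; first exact: differentiable_cst.
by exists (fun=> 0); [exists 0 | move=> x _; exact: partial_cst].
Qed.
Lemma smooth_sum U (T : Type) (r : seq T) (P : pred T) (F : T -> 'rV[R]_n -> R) : open U ->
  (forall i, P i -> smooth U (F i)) -> smooth U (fun x => \sum_(i <- r | P i) F i x).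
Proof.
move=> oU SF; elim: r => [|i r IH].
  by under eq_fun do rewrite big_nil; exact: smooth_cst.
under eq_fun do rewrite big_cons.
by case Pi: (P i) => //; apply: smoothD => //; exact: SF.
Qed.

Lemma partial_sum i (T : Type) (r : seq T) (P : pred T) (F : T -> 'rV[R]_n -> R) x :
  (forall j, P j -> differentiable (F j) x) ->
  partial i (fun y => \sum_(j <- r | P j) F j y) x = \sum_(j <- r | P j) partial i (F j) x.
Proof.
move=> dF; suff [] : differentiable (fun y => \sum_(j <- r | P j) F j y) x /\
  partial i (fun y => \sum_(j <- r | P j) F j y) x = \sum_(j <- r | P j) partial i (F j) x by [].
elim: r => [|j r [IHd IHp]].
  have -> : (fun y => \sum_(j <- [::] | P j) F j y) = fun=> 0 by apply/funext => y; rewrite big_nil.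
  by rewrite partial_cst big_nil; split=> //; exact: differentiable_cst.
have -> : (fun y => \sum_(k <- j :: r | P k) F k y) =
    fun y => if P j then F j y + \sum_(k <- r | P k) F k y else \sum_(k <- r | P k) F k y.
  by apply/funext => y; rewrite big_cons.
rewrite big_cons; case Pj: (P j) => //; split.
  by apply: (@differentiableD _ _ _ (F j)) => //; exact: dF.
by rewrite partialD ?IHp //; exact: dF.
Qed.

Lemma is_derive_coord_comp (h : R -> R) d j i x : is_derive (x 0 j) 1 h d ->
  differentiable (fun y : 'rV[R]_n => h (y 0 j)) x /\
  partial i (fun y : 'rV[R]_n => h (y 0 j)) x = (i == j)%:R * d.
Proof.
move=> hd; have dh : differentiable h (x 0 j) by apply/derivable1_diffP; case: hd.
pose c := (fun y : 'rV[R]_n => y 0 j).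
have dc : differentiable c x by exact: differentiable_coord.
have dhc : differentiable (h \o c) x by exact: differentiable_comp.
split=> //; rewrite /partial -[fun y => _]/(h \o c) deriveE // diff_comp //=.
have clin : linear c by move=> a u v; rewrite /c !mxE.
pose cL := HB.pack c (GRing.isLinear.Build _ _ _ _ c clin) : {linear 'rV[R]_n -> R^o}.
have -> : 'd c x (delta_mx 0 i) = (i == j)%:R.
  rewrite -[c]/(cL : _ -> _) diff_lin; last exact: coord_continuous.
  by rewrite /= /c mxE eqxx /= eq_sym.
rewrite -[X in 'd h _ X]mulr1 -[_ * 1]/((i == j)%:R *: (1 : R^o)) linearZ /=.
by rewrite -deriveE //; case: hd => _ ->.
Qed.

(** Closure of [H] under scaling absorbs the Kronecker factor of the partial derivative, which is 0
    in every direction other than [j]. *)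
Lemma smooth_coord_comp (H : (R -> R) -> Prop) (h : R -> R) (j : 'I_n) U : open U ->
  (forall h, H h -> exists2 h', H h' & forall t : R, is_derive t (1 : R) h (h' t)) ->
  (forall h c, H h -> H (fun t => c * h t)) ->
  H h -> smooth U (fun x => h (x 0 j)).
Proof.
move=> oU Hd HZ Hh.
apply: (@smooth_coind U (fun f => exists2 h, H h & f = fun x => h (x 0 j))) => //; last by exists h.
move=> f [{}h {}Hh ->]; have [h' Hh' hh'] := Hd _ Hh; split=> [x _|i].
  by have [] := @is_derive_coord_comp h (h' (x 0 j)) j j x (hh' _).
exists (fun x => (i == j)%:R * h' (x 0 j)); last first.
  by move=> x _; have [] := @is_derive_coord_comp h (h' (x 0 j)) j i x (hh' _).
by exists (fun t => (i == j)%:R * h' t) => //; exact: HZ.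
Qed.

Lemma smooth_coord U j : open U -> smooth U (fun x => x 0 j).
Proof.
move=> oU; apply: (@smooth_coord_comp (fun h => exists a b, h = fun t => a * t + b) id) => //.
- move=> h [a [b ->]]; exists (fun=> a); first by exists 0, a; apply/funext => t; rewrite mul0r add0r.
  move=> t; apply: is_derive_eq; rewrite /=; by rewrite !(mulr1, addr0, scaler0) ?add0r; exact: mulr1.
- move=> h c [a [b ->]]; exists (c * a), (c * b); apply/funext => t; ring.
- by exists 1, 0; apply/funext => t; rewrite mul1r addr0.
Qed.
End Smooth.

Section SmoothForms.
Context {R : realType} {n m : nat}.
Implicit Types (U : set 'rV[R]_n) (w z : 'rV[R]_n -> ext R m).

Lemma smooth_ext_eq U w z : open U -> (forall x, U x -> w x = z x) ->
  smooth_ext U w -> smooth_ext U z.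
Proof. by move=> oU wz Sw I; apply: smooth_eq oU _ (Sw I) => x Ux; rewrite wz. Qed.
Lemma smooth_ext_sub U V w : U `<=` V -> smooth_ext V w -> smooth_ext U w.
Proof. by move=> UV Sw I; exact: smooth_sub (Sw I). Qed.
Lemma smooth_ext_cst U (c : ext R m) : open U -> smooth_ext U (fun=> c).
Proof. by move=> oU I; exact: smooth_cst. Qed.
Lemma smooth_extD U w z : open U -> smooth_ext U w -> smooth_ext U z ->
  smooth_ext U (fun x => w x + z x).
Proof.
move=> oU Sw Sz I; apply: (smooth_eq (f := fun x => w x I + z x I)) => //.
  by move=> x _; rewrite ffunE.
exact: smoothD.
Qed.
Lemma smooth_extZ U (f : 'rV[R]_n -> R) w : open U -> smooth U f -> smooth_ext U w ->
  smooth_ext U (fun x => f x *: w x).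
Proof.
move=> oU Sf Sw I; apply: (smooth_eq (f := fun x => f x * w x I)) => //.
  by move=> x _; rewrite ffunE.
exact: smoothM.
Qed.
Lemma smooth_extN U w : open U -> smooth_ext U w -> smooth_ext U (fun x => - w x).
Proof.
move=> oU Sw; apply: (smooth_ext_eq (w := fun x => (-1) *: w x)) => //.
  by move=> x _; rewrite scaleN1r.
by apply: smooth_extZ => //; exact: smooth_cst.
Qed.
Lemma smooth_extB U w z : open U -> smooth_ext U w -> smooth_ext U z ->
  smooth_ext U (fun x => w x - z x).
Proof. by move=> oU Sw Sz; apply: smooth_extD => //; exact: smooth_extN. Qed.
Lemma smooth_ext_wedge U w z : open U -> smooth_ext U w -> smooth_ext U z ->
  smooth_ext U (fun x => w x &^ z x).
Proof.
move=> oU Sw Sz K; apply: (smooth_eq (f := fun x => \sum_(I in powerset K)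
     (-1) ^+ inversions I (K :\: I) * (w x I * z x (K :\: I)))) => //.
  by move=> x _; rewrite ffunE.
apply: smooth_sum => // I _; apply: smoothM; [by []|exact: smooth_cst|].
exact: smoothM.
Qed.
Lemma smooth_ext_grade U k w : open U -> smooth_ext U w -> smooth_ext U (fun x => grade k (w x)).
Proof.
move=> oU Sw I; apply: (smooth_eq (f := fun x => if #|I| == k then w x I else 0)) => //.
  by move=> x _; rewrite ffunE.
by case: (#|I| == k); [exact: Sw | exact: smooth_cst].
Qed.
Lemma smooth_ext_ginv U w : open U -> smooth_ext U w -> smooth_ext U (fun x => ginv (w x)).
Proof.
move=> oU Sw I; apply: (smooth_eq (f := fun x => (-1) ^+ #|I| * w x I)) => //.
  by move=> x _; rewrite ffunE.
by apply: smoothM => //; exact: smooth_cst.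
Qed.
Lemma smooth_ext_sum U (T : Type) (r : seq T) (F : T -> 'rV[R]_n -> ext R m) : open U ->
  (forall i, smooth_ext U (F i)) -> smooth_ext U (fun x => \sum_(i <- r) F i x).
Proof.
move=> oU SF; elim: r => [|i r IH].
  by apply: (smooth_ext_eq (w := fun=> 0)) => [||] //; [move=> x _; rewrite big_nil | exact: smooth_ext_cst].
apply: (smooth_ext_eq (w := fun x => F i x + \sum_(i <- r) F i x)) => //; last exact: smooth_extD.
by move=> x _; rewrite big_cons.
Qed.

Definition pd (i : 'I_n) w : 'rV[R]_n -> ext R m :=
  fun x => [ffun I : {set 'I_m} => partial i (fun y => w y I) x].

Lemma smooth_ext_pd U i w : open U -> smooth_ext U w -> smooth_ext U (pd i w).
Proof.
move=> oU Sw I; apply: (smooth_eq (f := partial i (fun y => w y I))) => //.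
  by move=> x _; rewrite ffunE.
exact: smooth_partial.
Qed.

Lemma pd_near i w z x : (\forall y \near x, w y = z y) -> pd i w x = pd i z x.
Proof.
move=> wz; apply/ffunP => I; rewrite !ffunE; apply: partial_near.
by apply: filterS wz => y ->.
Qed.

Lemma pdD U i w z x : smooth_ext U w -> smooth_ext U z -> U x ->
  pd i (fun y => w y + z y) x = pd i w x + pd i z x.
Proof.
move=> Sw Sz Ux; apply/ffunP => I; rewrite !ffunE -partialD; last 2 first.
- exact: smooth_diff (Sw I) Ux.
- exact: smooth_diff (Sz I) Ux.
by congr (partial i _ x); apply/funext => y; rewrite ffunE.
Qed.

Lemma pdZ U i (f : 'rV[R]_n -> R) w x : smooth U f -> smooth_ext U w -> U x ->
  pd i (fun y => f y *: w y) x = partial i f x *: w x + f x *: pd i w x.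
Proof.
move=> Sf Sw Ux; apply/ffunP => I; rewrite !ffunE addrC.
transitivity (f x * partial i (fun y => w y I) x + w x I * partial i f x); last first.
  by congr (_ + _); rewrite mulrC.
rewrite -partialM; last 2 first.
- exact: smooth_diff Sf Ux.
- exact: smooth_diff (Sw I) Ux.
by congr (partial i _ x); apply/funext => y; rewrite ffunE.
Qed.

Lemma pd_cst i c x : pd i (fun=> c) x = 0.
Proof. by apply/ffunP => I; rewrite !ffunE partial_cst. Qed.

Lemma pd_wedge U i w z x : open U -> smooth_ext U w -> smooth_ext U z -> U x ->
  pd i (fun y => w y &^ z y) x = pd i w x &^ z x + w x &^ pd i z x.
Proof.
move=> oU Sw Sz Ux; apply/ffunP => K; rewrite !ffunE -big_split /=.
transitivity (partial i (fun y => \sum_(I in powerset K)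
     (-1) ^+ inversions I (K :\: I) * (w y I * z y (K :\: I))) x).
  by congr (partial i _ x); apply/funext => y; rewrite ffunE.
have dM I : differentiable (fun y => w y I * z y (K :\: I)) x.
  by apply: (@smooth_diff _ _ U) => //; exact: smoothM.
rewrite partial_sum; last first.
  move=> I _; apply: (@smooth_diff _ _ U) => //; apply: smoothM => //; first exact: smooth_cst.
  exact: smoothM.
apply: eq_bigr => I _; rewrite partialM; [|exact: differentiable_cst|exact: dM].
rewrite partial_cst mulr0 addr0 -mulrDr !ffunE; congr (_ * _).
rewrite partialM; last 2 first.
- exact: smooth_diff (Sw I) Ux.
- exact: smooth_diff (Sz (K :\: I)) Ux.
by rewrite addrC [z x _ * _]mulrC.
Qed.
End SmoothForms.

Section ExteriorDerivative.
Context {R : realType} {n : nat}.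
Implicit Types (U : set 'rV[R]_n) (w z : dform R n).

Lemma extdE w x : extd w x = \sum_i dx i &^ pd i w x. Proof. by []. Qed.

Lemma smooth_ext_extd U w : open U -> smooth_ext U w -> smooth_ext U (extd w).
Proof.
move=> oU Sw; apply: smooth_ext_sum => // i; apply: smooth_ext_wedge => //.
  exact: smooth_ext_cst.
exact: smooth_ext_pd.
Qed.

Lemma extd_near w z x : (\forall y \near x, w y = z y) -> extd w x = extd z x.
Proof. by move=> wz; rewrite !extdE; apply: eq_bigr => i _; rewrite (pd_near i wz). Qed.

Lemma extd_eq U w z x : open U -> (forall y, U y -> w y = z y) -> U x -> extd w x = extd z x.
Proof. by move=> oU wz Ux; apply: extd_near; exact: open_near oU Ux wz. Qed.

Lemma extd_cst c x : extd (fun=> c : ext R n) x = 0.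
Proof. by rewrite extdE big1 // => i _; rewrite pd_cst wedge0r. Qed.

Lemma extdD U w z x : smooth_ext U w -> smooth_ext U z -> U x ->
  extd (fun y => w y + z y) x = extd w x + extd z x.
Proof.
move=> Sw Sz Ux; rewrite !extdE -big_split; apply: eq_bigr => i _ /=.
by rewrite (pdD i Sw Sz Ux) wedgeDr.
Qed.

Lemma extdZ U (f : 'rV[R]_n -> R) w x : smooth U f -> smooth_ext U w -> U x ->
  extd (fun y => f y *: w y) x = (\sum_i partial i f x *: dx i) &^ w x + f x *: extd w x.
Proof.
move=> Sf Sw Ux; rewrite !extdE scaler_sumr wedge_suml -big_split; apply: eq_bigr => i _ /=.
by rewrite (pdZ i Sf Sw Ux) wedgeDr !wedgeZr wedgeZl.
Qed.

(** The Leibniz sign is [ginv] because [w] may be inhomogeneous; it appears when [dx i] moves past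
    [w]. *)
Lemma extd_wedge U w z x : open U -> smooth_ext U w -> smooth_ext U z -> U x ->
  extd (fun y => w y &^ z y) x = extd w x &^ z x + ginv (w x) &^ extd z x.
Proof.
move=> oU Sw Sz Ux; rewrite !extdE wedge_suml wedge_sumr -big_split; apply: eq_bigr => i _ /=.
rewrite (pd_wedge i oU Sw Sz Ux) wedgeDr !wedgeA; congr (_ + _ &^ _).
exact: dx_wedge.
Qed.

Lemma extd_wedge1 U w z x : open U -> kform 1 U w -> smooth_ext U z -> U x ->
  extd (fun y => w y &^ z y) x = extd w x &^ z x - w x &^ extd z x.
Proof.
move=> oU [Sw hw] Sz Ux; rewrite (extd_wedge oU Sw Sz Ux) ginv1 ?wedgeNl //.
exact: hw.
Qed.

End ExteriorDerivative.

(** * Normal forms of polynomials in 1-forms *)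

Section Reflection.
Context {R : realType} {n : nat}.
Implicit Types (env : seq (ext R n)).

(** Syntax for a reflective decision procedure: in the algebra generated by finitely many 1-forms,
    every expression becomes a combination of strictly increasing words, and an identity follows
    from scalar identities between coefficients. *)
Inductive eexpr :=
| EAtom of nat | EZero | EAdd of eexpr & eexpr | EOpp of eexpr
| EScale of R & eexpr | EWedge of eexpr & eexpr.

Fixpoint einterp env e : ext R n :=
  match e with
  | EAtom k => nth 0 env k
  | EZero => 0
  | EAdd e1 e2 => einterp env e1 + einterp env e2
  | EOpp e1 => - einterp env e1
  | EScale c e1 => c *: einterp env e1
  | EWedge e1 e2 => einterp env e1 &^ einterp env e2
  end.

Definition word := list nat.
Definition epoly := list (R * word).

Fixpoint winterp env (w : word) : ext R n :=
  match w with nil => ext1 | i :: w' => nth 0 env i &^ winterp env w' end.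
Fixpoint pinterp env (p : epoly) : ext R n :=
  match p with nil => 0 | (c, w) :: p' => c *: winterp env w + pinterp env p' end.

(** Insertion into a strictly increasing word. [None] stands for a repeated letter, hence a zero
    product; the boolean records a sign change. *)
Fixpoint wins (i : nat) (w : word) : option (bool * word) :=
  match w with
  | nil => Some (false, i :: nil)
  | j :: w' =>
    if Nat.eqb i j then None else
    if Nat.ltb i j then Some (false, i :: w) else
    match wins i w' with
    | None => None
    | Some (s, w'') => Some (negb s, j :: w'')
    end
  end.
Fixpoint wmul (w z : word) : option (bool * word) :=
  match w with
  | nil => Some (false, z)
  | i :: w' =>
    match wmul w' z with
    | None => None
    | Some (s, z') =>
      match wins i z' with
      | None => None
      | Some (s', z'') => Some (xorb s s', z'')
      end
    end
  end.

Fixpoint weqb (w z : word) : bool :=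
  match w, z with
  | nil, nil => true
  | i :: w', j :: z' => if Nat.eqb i j then weqb w' z' else false
  | _, _ => false
  end.
Fixpoint padd1 (c : R) (w : word) (p : epoly) : epoly :=
  match p with
  | nil => (c, w) :: nil
  | (d, z) :: p' => if weqb w z then (c + d, z) :: p' else (d, z) :: padd1 c w p'
  end.
Fixpoint padd (p q : epoly) : epoly :=
  match p with nil => q | (c, w) :: p' => padd1 c w (padd p' q) end.
Fixpoint pscale (c : R) (p : epoly) : epoly :=
  match p with nil => nil | (d, w) :: p' => (c * d, w) :: pscale c p' end.
Fixpoint popp (p : epoly) : epoly :=
  match p with nil => nil | (d, w) :: p' => (- d, w) :: popp p' end.
Fixpoint pmul1 (c : R) (w : word) (p : epoly) : epoly :=
  match p with
  | nil => nil
  | (d, z) :: p' =>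
    match wmul w z with
    | None => pmul1 c w p'
    | Some (s, u) => padd1 (if s then - (c * d) else c * d) u (pmul1 c w p')
    end
  end.
Fixpoint pmul (p q : epoly) : epoly :=
  match p with nil => nil | (c, w) :: p' => padd (pmul1 c w q) (pmul p' q) end.

Fixpoint enorm (e : eexpr) : epoly :=
  match e with
  | EAtom k => (1, k :: nil) :: nil
  | EZero => nil
  | EAdd e1 e2 => padd (enorm e1) (enorm e2)
  | EOpp e1 => popp (enorm e1)
  | EScale c e1 => pscale c (enorm e1)
  | EWedge e1 e2 => pmul (enorm e1) (enorm e2)
  end.

(** A sufficient condition for the polynomial to vanish, in the form of a conjunction of scalar
    equations that [ring] can treat one by one. *)
Fixpoint pzero (p : epoly) : Prop :=
  match p with nil => True | (c, _) :: p' => c = 0 /\ pzero p' end.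

Definition forms1 env := foldr (fun v P => homog 1 v /\ P) True env.

Lemma forms1_nth env : forms1 env -> forall k, homog 1 (nth 0 env k).
Proof.
elim: env => [_ k|v env IH [hv /IH hk] [|k]] //=.
by rewrite nth_nil; exact: homog0.
Qed.

Variables (env : seq (ext R n)) (henv : forms1 env).
Let hom k : homog 1 (nth 0 env k) := forms1_nth henv k.

Definition sgi (s : bool) (x : ext R n) := if s then - x else x.
Definition ointerp (o : option (bool * word)) : ext R n :=
  match o with None => 0 | Some (s, w) => sgi s (winterp env w) end.

Lemma winsP i w : nth 0 env i &^ winterp env w = ointerp (wins i w).
Proof.
elim: w => [//|j w IH] /=.
case: PeanoNat.Nat.eqb_spec => [->|_] /=; first exact: form1_sqA.
case: (Nat.ltb i j) => //=.
rewrite form1CA // IH; case: (wins i w) => [[s w']|] /=.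
  by case: s; rewrite /= ?wedgeNr ?opprK.
by rewrite wedge0r oppr0.
Qed.

Lemma wmulP w z : winterp env w &^ winterp env z = ointerp (wmul w z).
Proof.
elim: w => [|i w IH] /=; first exact: wedge1l.
rewrite -wedgeA IH; case: (wmul w z) => [[s z']|] /=; last by rewrite wedge0r.
transitivity (sgi s (nth 0 env i &^ winterp env z')); first by case: s => //=; rewrite wedgeNr.
rewrite winsP; case: (wins i z') => [[s' z'']|] /=; last by case: s; rewrite /= ?oppr0.
by case: s; case: s'; rewrite /= ?opprK.
Qed.

Lemma weqbP w z : weqb w z -> w = z.
Proof.
by elim: w z => [|i w IH] [|j z] //=; case: PeanoNat.Nat.eqb_spec => // -> /IH ->.
Qed.

Lemma padd1P c w p : pinterp env (padd1 c w p) = c *: winterp env w + pinterp env p.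
Proof.
elim: p => [//|[d z] p IH] /=; case E: (weqb w z) => /=.
  by rewrite (weqbP E) scalerDl addrA.
by rewrite IH addrCA.
Qed.
Lemma paddP p q : pinterp env (padd p q) = pinterp env p + pinterp env q.
Proof. by elim: p => [|[c w] p IH] /=; rewrite ?add0r // padd1P IH addrA. Qed.
Lemma pscaleP c p : pinterp env (pscale c p) = c *: pinterp env p.
Proof. by elim: p => [|[d w] p IH] /=; rewrite ?scaler0 // IH scalerDr scalerA. Qed.
Lemma poppP p : pinterp env (popp p) = - pinterp env p.
Proof. by elim: p => [|[d w] p IH] /=; rewrite ?oppr0 // IH opprD scaleNr. Qed.
Lemma pmul1P c w p : pinterp env (pmul1 c w p) = (c *: winterp env w) &^ pinterp env p.
Proof.
elim: p => [|[d z] p IH] /=; first by rewrite wedge0r.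
rewrite wedgeDr wedgeZl wedgeZr wmulP -IH; case: (wmul w z) => [[s u]|] /=.
  by rewrite padd1P; case: s; rewrite /= ?scalerN ?scaleNr scalerA.
by rewrite !scaler0 add0r.
Qed.
Lemma pmulP p q : pinterp env (pmul p q) = pinterp env p &^ pinterp env q.
Proof. by elim: p => [|[c w] p IH] /=; rewrite ?wedge0l // paddP pmul1P IH wedgeDl. Qed.

Lemma enormP e : pinterp env (enorm e) = einterp env e.
Proof.
elim: e => [k||e1 IH1 e2 IH2|e IH|c e IH|e1 IH1 e2 IH2] //=.
- by rewrite wedge1r scale1r addr0.
- by rewrite paddP IH1 IH2.
- by rewrite poppP IH.
- by rewrite pscaleP IH.
- by rewrite pmulP IH1 IH2.
Qed.

Lemma pzeroP p : pzero p -> pinterp env p = 0.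
Proof. by elim: p => [//|[c w] p IH] /= [-> /IH ->]; rewrite scale0r add0r. Qed.

Lemma ext_ring_correct e1 e2 : pzero (enorm (EAdd e1 (EOpp e2))) ->
  einterp env e1 = einterp env e2.
Proof. by move=> /pzeroP; rewrite enormP /= => /eqP; rewrite subr_eq0 => /eqP. Qed.
End Reflection.
Arguments EAtom {R} _.
Arguments EZero {R}.

Ltac ext_index v env :=
  lazymatch env with
  | ?u :: ?env' =>
    match constr:(Set) with
    | _ => let _ := match constr:(Set) with _ => constr_eq u v end in constr:(0%N)
    | _ => let k := ext_index v env' in constr:(S k)
    end
  end.

Ltac ext_reify R env e :=
  lazymatch e with
  | wedge ?a ?b => let x := ext_reify R env a in let y := ext_reify R env b in
                   constr:(@EWedge R x y)
  | ?a + ?b => let x := ext_reify R env a in let y := ext_reify R env b in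
                   constr:(@EAdd R x y)
  | - ?a => let x := ext_reify R env a in constr:(@EOpp R x)
  | ?c *: ?a => let x := ext_reify R env a in constr:(@EScale R c x)
  | 0 => constr:(@EZero R)
  | _ => let k := ext_index e env in constr:(@EAtom R k)
  end.

(** Only the symbolic functions are unfolded; the scalars stay as written, for [ring]. The atoms are
    the 1-forms listed in the type of [H], and any other atom makes reification fail. *)
Ltac ext_norm H :=
  lazymatch type of H with
  | @forms1 ?R ?n ?env =>
    lazymatch goal with
    | |- ?a = ?b =>
      let x := ext_reify R env a in let y := ext_reify R env b in
      apply: (@ext_ring_correct R n env H x y);
      cbv [enorm pmul pmul1 popp pscale padd padd1 weqb wmul wins pzero
           Nat.eqb Nat.ltb Nat.leb negb xorb]
    end
  end.
Ltac ext_ring H := ext_norm H; repeat (apply: conj); try exact: I; try ring.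

(** * Adapted frames of hyperbolic systems *)

Lemma scale_eq0_coef (R : realType) n (a : R) (v : ext R n) : v != 0 -> a *: v = 0 -> a = 0.
Proof. by move=> v0 /eqP; rewrite scaler_eq0 (negbTE v0) orbF => /eqP. Qed.

Section Frame.
Context {R : realType}.
Implicit Types (a b : ext R 5).
Variables (b0 b1 b2 b3 b4 : ext R 5).
Hypothesis (h : forms1 [:: b0; b1; b2; b3; b4]).
Local Notation vol := (b0 &^ b1 &^ b2 &^ b3 &^ b4).
Hypothesis vol0 : vol != 0.

(** Wedging the relation with the four other covectors isolates one coefficient times the volume. *)
Lemma frame_free c0 c1 c2 c3 c4 :
  c0 *: b0 + c1 *: b1 + c2 *: b2 + c3 *: b3 + c4 *: b4 = 0 ->
  [/\ c0 = 0, c1 = 0, c2 = 0, c3 = 0 & c4 = 0].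
Proof.
move=> E.
have H y : (c0 *: b0 + c1 *: b1 + c2 *: b2 + c3 *: b3 + c4 *: b4) &^ y = 0.
  by rewrite E wedge0l.
split; apply: (scale_eq0_coef vol0).
- by rewrite -(H (b1 &^ b2 &^ b3 &^ b4)); ext_ring h.
- by rewrite -oppr0 -(H (b0 &^ b2 &^ b3 &^ b4)); ext_ring h.
- by rewrite -(H (b0 &^ b1 &^ b3 &^ b4)); ext_ring h.
- by rewrite -oppr0 -(H (b0 &^ b1 &^ b2 &^ b4)); ext_ring h.
- by rewrite -(H (b0 &^ b1 &^ b2 &^ b3)); ext_ring h.
Qed.

(** The coefficient matrix of the five covectors is invertible, since a vector in its left kernel is
    a linear relation excluded by [frame_free]. *)
Lemma frame_span p : homog 1 p -> exists c0 c1 c2 c3 c4,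
  p = c0 *: b0 + c1 *: b1 + c2 *: b2 + c3 *: b3 + c4 *: b4.
Proof.
move=> hp; pose s := [:: b0; b1; b2; b3; b4].
pose A : 'M[R]_5 := \matrix_(i, j) (nth 0 s i : ext R 5) [set j]%SET.
have rowE (v : 'rV[R]_5) : \sum_(j < 5) (v *m A) 0 j *: dx j = \sum_(i < 5) v 0 i *: (nth 0 s i : ext R 5).
  under eq_bigr do rewrite !mxE scaler_suml.
  rewrite exchange_big; apply: eq_bigr => i _.
  rewrite [X in _ = _ *: X]homog1E ?scaler_sumr; last exact: (forms1_nth h).
  by apply: eq_bigr => j _; rewrite mxE scalerA.
have sumE (v : 'rV[R]_5) : \sum_(i < 5) v 0 i *: (nth 0 s i : ext R 5) =
  v 0 0 *: b0 + v 0 1 *: b1 + v 0 2%:R *: b2 + v 0 3%:R *: b3 + v 0 4%:R *: b4.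
  rewrite !big_ord_recr big_ord0 /= add0r.
  by do 4?[congr (_ + _)]; congr (v 0 _ *: _); apply/val_inj.
have uA : A \in unitmx.
  rewrite unitmxE unitfE; apply/det0P => -[v v0 vA].
  have := rowE v; rewrite vA big1 => [|j _]; last by rewrite mxE scale0r.
  rewrite sumE => /esym/frame_free[e0 e1 e2 e3 e4].
  case/eqP: v0; apply/rowP => i; rewrite mxE.
  case: i => [[|[|[|[|[|//]]]]] H]; [move: e0|move: e1|move: e2|move: e3|move: e4];
    by move=> <-; congr (v 0 _); apply/val_inj.
pose v := (\row_j p [set j]%SET) *m invmx A.
exists (v 0 0), (v 0 1), (v 0 2%:R), (v 0 3%:R), (v 0 4%:R).
rewrite -sumE -rowE /v -mulmxA mulVmx // mulmx1 [LHS]homog1E //.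
by apply: eq_bigr => j _; rewrite mxE.
Qed.

(** The test forms [y] are killed by the three generators, hence they kill [p], and each of them
    isolates one of the coefficients c1, ..., c4. The multipliers may be inhomogeneous. *)
Lemma ideal_form1 p x0 x1 x2 : homog 1 p ->
  p = x0 &^ b0 + x1 &^ b1 &^ b2 + x2 &^ b3 &^ b4 -> exists f, p = f *: b0.
Proof.
move=> /frame_span[c0 [c1 [c2 [c3 [c4 ->]]]]] E; exists c0.
have H y : b0 &^ y = 0 -> b1 &^ b2 &^ y = 0 -> b3 &^ b4 &^ y = 0 ->
  (c0 *: b0 + c1 *: b1 + c2 *: b2 + c3 *: b3 + c4 *: b4) &^ y = 0.
  by move=> y0 y1 y2; rewrite E !wedgeDl -!wedgeA y0 y1 y2 !wedge0r !addr0.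
have -> : c1 = 0.
  apply: (scale_eq0_coef vol0); rewrite -oppr0 -(H (b0 &^ b2 &^ b3 &^ b4)); ext_ring h.
have -> : c2 = 0.
  apply: (scale_eq0_coef vol0); rewrite -(H (b0 &^ b1 &^ b3 &^ b4)); ext_ring h.
have -> : c3 = 0.
  apply: (scale_eq0_coef vol0); rewrite -oppr0 -(H (b0 &^ b1 &^ b2 &^ b4)); ext_ring h.
have -> : c4 = 0.
  apply: (scale_eq0_coef vol0); rewrite -(H (b0 &^ b1 &^ b2 &^ b3)); ext_ring h.
by rewrite !scale0r !addr0.
Qed.

(** Membership in the ideal kills the four 2 x 2 minors that mix the indices {1,2} with {3,4}, and
    the last hypothesis says that the minor on {1,2} is nonzero. Solving with that minor gives c3 =
    c4 = d3 = d4 = 0. *)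
Lemma ideal_form2 p q x0 x1 x2 : homog 1 p -> homog 1 q ->
  p &^ q = x0 &^ b0 + x1 &^ b1 &^ b2 + x2 &^ b3 &^ b4 ->
  p &^ q &^ b0 &^ b3 &^ b4 != 0 ->
  (exists c0 c1 c2, p = c0 *: b0 + c1 *: b1 + c2 *: b2) /\
  (exists d0 d1 d2, q = d0 *: b0 + d1 *: b1 + d2 *: b2).
Proof.
move=> /frame_span[c0 [c1 [c2 [c3 [c4 ->]]]]] /frame_span[d0 [d1 [d2 [d3 [d4 ->]]]]] E.
set P := _ + c4 *: b4; set Q := _ + d4 *: b4 => D.
have {}D : c1 * d2 - c2 * d1 != 0.
  apply: contraNneq D => D; apply/eqP.
  transitivity ((c1 * d2 - c2 * d1) *: vol); last by rewrite D scale0r.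
  by rewrite /P /Q; ext_ring h.
have H y : b0 &^ y = 0 -> b1 &^ b2 &^ y = 0 -> b3 &^ b4 &^ y = 0 -> P &^ Q &^ y = 0.
  by move=> y0 y1 y2; rewrite wedgeA E !wedgeDl -!wedgeA y0 y1 y2 !wedge0r !addr0.
have e24 : c2 * d4 - c4 * d2 = 0.
  apply: (scale_eq0_coef vol0); rewrite -oppr0 -(H (b0 &^ b1 &^ b3)) /P /Q; ext_ring h.
have e23 : c2 * d3 - c3 * d2 = 0.
  apply: (scale_eq0_coef vol0); rewrite -(H (b0 &^ b1 &^ b4)) /P /Q; ext_ring h.
have e14 : c1 * d4 - c4 * d1 = 0.
  apply: (scale_eq0_coef vol0); rewrite -(H (b0 &^ b2 &^ b3)) /P /Q; ext_ring h.
have e13 : c1 * d3 - c3 * d1 = 0.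
  apply: (scale_eq0_coef vol0); rewrite -oppr0 -(H (b0 &^ b2 &^ b4)) /P /Q; ext_ring h.
have z e : (c1 * d2 - c2 * d1) * e = 0 -> e = 0.
  by move=> /eqP; rewrite mulf_eq0 (negbTE D) => /eqP.
have c30 : c3 = 0.
  apply: z; transitivity (c2 * (c1 * d3 - c3 * d1) - c1 * (c2 * d3 - c3 * d2)); first by ring.
  by rewrite e13 e23 !mulr0 subr0.
have c40 : c4 = 0.
  apply: z; transitivity (c2 * (c1 * d4 - c4 * d1) - c1 * (c2 * d4 - c4 * d2)); first by ring.
  by rewrite e14 e24 !mulr0 subr0.
have d30 : d3 = 0.
  apply: z; transitivity (d2 * (c1 * d3 - c3 * d1) - d1 * (c2 * d3 - c3 * d2)); first by ring.
  by rewrite e13 e23 !mulr0 subr0.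
have d40 : d4 = 0.
  apply: z; transitivity (d2 * (c1 * d4 - c4 * d1) - d1 * (c2 * d4 - c4 * d2)); first by ring.
  by rewrite e14 e24 !mulr0 subr0.
split; [exists c0, c1, c2|exists d0, d1, d2]; rewrite /P /Q.
  by rewrite c30 c40 !scale0r !addr0.
by rewrite d30 d40 !scale0r !addr0.
Qed.
End Frame.

(** * Forms of fixed degree, and ideals with three generators *)

Section Kforms.
Context {R : realType} {n : nat}.
Implicit Types (U : set 'rV[R]_n) (w z : dform R n).

Lemma kform_cst U k c : open U -> homog k c -> kform k U (fun=> c).
Proof. by move=> oU hc; split => //; exact: smooth_ext_cst. Qed.
Lemma kformD U k w z : open U -> kform k U w -> kform k U z -> kform k U (fun x => w x + z x).
Proof. by move=> oU [Sw hw] [Sz hz]; split; [exact: smooth_extD | move=> x Ux; apply: homogD; auto]. Qed.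
Lemma kformN U k w : open U -> kform k U w -> kform k U (fun x => - w x).
Proof. by move=> oU [Sw hw]; split; [exact: smooth_extN | move=> x Ux; apply: homogN; auto]. Qed.
Lemma kformB U k w z : open U -> kform k U w -> kform k U z -> kform k U (fun x => w x - z x).
Proof. by move=> oU kw kz; apply: kformD => //; exact: kformN. Qed.
Lemma kformZ U k (f : 'rV[R]_n -> R) w : open U -> smooth U f -> kform k U w ->
  kform k U (fun x => f x *: w x).
Proof. by move=> oU Sf [Sw hw]; split; [exact: smooth_extZ | move=> x Ux; apply: homogZ; auto]. Qed.
Lemma kformZc U k (c : R) w : open U -> kform k U w -> kform k U (fun x => c *: w x).
Proof. by move=> oU kw; apply: kformZ => //; exact: smooth_cst. Qed.
Lemma kform_wedge11 U w z : open U -> kform 1 U w -> kform 1 U z -> kform 2 U (fun x => w x &^ z x).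
Proof. by move=> oU [Sw hw] [Sz hz]; split; [exact: smooth_ext_wedge | move=> x Ux; apply: homog11; auto]. Qed.
Lemma kform_sub U V k w : U `<=` V -> kform k V w -> kform k U w.
Proof. by move=> UV [Sw hw]; split; [exact: smooth_ext_sub Sw | move=> x /UV; exact: hw]. Qed.
End Kforms.

Section Ideals.
Context {R : realType} {n : nat}.
Implicit Types (U : set 'rV[R]_n) (S : set (dform R n)) (w z : dform R n).

Lemma ideal_on_gen U S w : open U -> smooth_ext U w -> S w -> ideal_on U S w.
Proof.
move=> oU Sw SSw; split=> //; exists 1%N, (fun=> fun=> ext1), (fun=> w); split.
  by move=> _; split=> //; exact: smooth_ext_cst.
by move=> x _; rewrite big_ord1 wedge1l.
Qed.

Lemma ideal_on_eq U S w z : open U -> (forall x, U x -> w x = z x) ->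
  ideal_on U S w -> ideal_on U S z.
Proof.
move=> oU wz [Sw [k [a [g [ag wE]]]]]; split; first exact: smooth_ext_eq Sw.
by exists k, a, g; split=> // x Ux; rewrite -wz // wE.
Qed.

Lemma ideal_onD U S w z : open U -> ideal_on U S w -> ideal_on U S z ->
  ideal_on U S (fun x => w x + z x).
Proof.
move=> oU [Sw [k [a [g [ag wE]]]]] [Sz [l [b [h [bh zE]]]]]; split; first exact: smooth_extD.
exists (k + l)%N, (fun i => match fintype.split i with inl j => a j | inr j => b j end),
  (fun i => match fintype.split i with inl j => g j | inr j => h j end).
split=> [i|x Ux]; first by case: (fintype.split i).
rewrite big_split_ord wE // zE //=; congr (_ + _); apply: eq_bigr => i _.
  by rewrite -[lshift _ _]/(unsplit (inl i)) unsplitK.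
by rewrite -[rshift _ _]/(unsplit (inr i)) unsplitK.
Qed.

Lemma ideal_onM U S a w : open U -> smooth_ext U a -> ideal_on U S w ->
  ideal_on U S (fun x => a x &^ w x).
Proof.
move=> oU Sa [Sw [k [b [g [bg wE]]]]]; split; first exact: smooth_ext_wedge.
exists k, (fun i x => a x &^ b i x), g; split=> [i|x Ux].
  by have [? ?] := bg i; split=> //; exact: smooth_ext_wedge.
by rewrite wE // wedge_sumr; apply: eq_bigr => i _; rewrite wedgeA.
Qed.

(** Normal form of a member of an ideal with three generators: [ideal_on] allows any number of
    summands, over generators that may be repeated or be members of a larger ideal. *)
Definition comb3 U (g0 g1 g2 w : dform R n) := smooth_ext U w /\
  exists x0 x1 x2 : dform R n, [/\ smooth_ext U x0, smooth_ext U x1, smooth_ext U x2 &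
    forall x, U x -> w x = x0 x &^ g0 x + x1 x &^ g1 x + x2 x &^ g2 x].

Lemma ideal_comb3 U S g0 g1 g2 w : open U -> (forall g, S g -> comb3 U g0 g1 g2 g) ->
  ideal_on U S w -> comb3 U g0 g1 g2 w.
Proof.
move=> oU HS [Sw [k [a [g [ag wE]]]]]; split=> //.
have /choice[c cP] : forall i : 'I_k, exists c : dform R n * dform R n * dform R n,
    [/\ smooth_ext U c.1.1, smooth_ext U c.1.2, smooth_ext U c.2 &
    forall x, U x -> g i x = c.1.1 x &^ g0 x + c.1.2 x &^ g1 x + c.2 x &^ g2 x].
  by move=> i; have [_ [x0 [x1 [x2 H]]]] := HS _ (ag i).2; exists (x0, x1, x2).
exists (fun x => \sum_i a i x &^ (c i).1.1 x), (fun x => \sum_i a i x &^ (c i).1.2 x),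
  (fun x => \sum_i a i x &^ (c i).2 x); split.
- apply: smooth_ext_sum => // i; have [? _ _ _] := cP i; apply: smooth_ext_wedge => //; exact: (ag i).1.
- apply: smooth_ext_sum => // i; have [_ ? _ _] := cP i; apply: smooth_ext_wedge => //; exact: (ag i).1.
- apply: smooth_ext_sum => // i; have [_ _ ? _] := cP i; apply: smooth_ext_wedge => //; exact: (ag i).1.
move=> x Ux; rewrite wE // !wedge_suml -!big_split; apply: eq_bigr => i _ /=.
by have [_ _ _ ->] := cP i; rewrite // !wedgeDr !wedgeA.
Qed.

Lemma comb3_ideal U S g0 g1 g2 w : open U ->
  ideal_on U S g0 -> ideal_on U S g1 -> ideal_on U S g2 ->
  comb3 U g0 g1 g2 w -> ideal_on U S w.
Proof.
move=> oU H0 H1 H2 [Sw [x0 [x1 [x2 [S0 S1 S2 wE]]]]].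
apply: (ideal_on_eq (w := fun x => x0 x &^ g0 x + x1 x &^ g1 x + x2 x &^ g2 x)) => //.
  by move=> x Ux; rewrite wE.
by apply: ideal_onD => //; [apply: ideal_onD => //|]; exact: ideal_onM.
Qed.

Lemma comb3_intro U g0 g1 g2 (w x0 x1 x2 : dform R n) : open U ->
  smooth_ext U g0 -> smooth_ext U g1 -> smooth_ext U g2 ->
  smooth_ext U x0 -> smooth_ext U x1 -> smooth_ext U x2 ->
  (forall x, U x -> w x = x0 x &^ g0 x + x1 x &^ g1 x + x2 x &^ g2 x) -> comb3 U g0 g1 g2 w.
Proof.
move=> oU s0 s1 s2 S0 S1 S2 wE; split; last by exists x0, x1, x2.
apply: (smooth_ext_eq (w := fun x => x0 x &^ g0 x + x1 x &^ g1 x + x2 x &^ g2 x)) => //.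
  by move=> x Ux; rewrite wE.
by apply: smooth_extD => //; [apply: smooth_extD => //|]; exact: smooth_ext_wedge.
Qed.

Lemma comb3_sub U V g0 g1 g2 w : U `<=` V -> comb3 V g0 g1 g2 w -> comb3 U g0 g1 g2 w.
Proof.
move=> UV [Sw [x0 [x1 [x2 [S0 S1 S2 wE]]]]]; split; first exact: smooth_ext_sub Sw.
by exists x0, x1, x2; split; [exact: smooth_ext_sub S0|exact: smooth_ext_sub S1|exact: smooth_ext_sub S2|move=> x /UV; exact: wE].
Qed.
End Ideals.

(** * Monge-Ampère systems given by a global framing *)

Definition fr5 T (a0 a1 a2 a3 a4 : T) : 'I_5 -> T := fun i => nth a0 [:: a0; a1; a2; a3; a4] i.

Lemma enum_I5 : enum 'I_5 = [:: 0; 1; 2%:R; 3%:R; 4%:R] :> seq 'I_5.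
Proof. by apply: (inj_map val_inj); rewrite val_enum_ord. Qed.

Definition mgens (R : realType) (a0 a1 a2 a3 a4 : dform R 5) : set (dform R 5) :=
  [set w | [\/ w = a0, w = (fun x => a1 x &^ a2 x) | w = (fun x => a3 x &^ a4 x)]].
Definition mideal (R : realType) (a0 a1 a2 a3 a4 : dform R 5) : set (dform R 5) :=
  ideal_on setT (mgens a0 a1 a2 a3 a4).

(* A 1-adapted coframing whose invariants are S_1 = (0 s; t 0) and S_2 = 0; the
   2-form [m1 /\ a1 + m2 /\ a2] collects the terms of [d a_i] that the V_i do not see. *)
Record mframe (R : realType) (s t : R) (a0 a1 a2 a3 a4 : dform R 5) : Prop := {
  mf0 : kform 1 setT a0;
  mf1 : kform 1 setT a1;
  mf2 : kform 1 setT a2;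
  mf3 : kform 1 setT a3;
  mf4 : kform 1 setT a4;
  mf_vol : forall x, a0 x &^ a1 x &^ a2 x &^ a3 x &^ a4 x != 0;
  mf_d0 : exists m, kform 1 setT m /\ forall x,
    extd a0 x = m x &^ a0 x + a1 x &^ a2 x + a3 x &^ a4 x;
  mf_d1 : exists m1 m2, [/\ kform 1 setT m1, kform 1 setT m2 & forall x,
    extd a1 x = m1 x &^ a1 x + m2 x &^ a2 x + s *: (a0 x &^ a4 x)];
  mf_d2 : exists m1 m2, [/\ kform 1 setT m1, kform 1 setT m2 & forall x,
    extd a2 x = m1 x &^ a1 x + m2 x &^ a2 x + t *: (a0 x &^ a3 x)];
  mf_d3 : exists m1 m2, [/\ kform 1 setT m1, kform 1 setT m2 & forall x,
    extd a3 x = m1 x &^ a3 x + m2 x &^ a4 x + s *: (a0 x &^ a2 x)];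
  mf_d4 : exists m1 m2, [/\ kform 1 setT m1, kform 1 setT m2 & forall x,
    extd a4 x = m1 x &^ a3 x + m2 x &^ a4 x + t *: (a0 x &^ a1 x)] }.

Section MFrame.
Context {R : realType} (s t : R) (a0 a1 a2 a3 a4 : dform R 5).
Hypothesis F : mframe s t a0 a1 a2 a3 a4.

Local Notation g1 := (fun x => a1 x &^ a2 x).
Local Notation g2 := (fun x => a3 x &^ a4 x).

Let oT : open (setT : set 'rV[R]_5) := openT.
Let S0 : smooth_ext setT a0 := (mf0 F).1.
Let S1 : smooth_ext setT a1 := (mf1 F).1.
Let S2 : smooth_ext setT a2 := (mf2 F).1.
Let S3 : smooth_ext setT a3 := (mf3 F).1.
Let S4 : smooth_ext setT a4 := (mf4 F).1.
Let Sg1 : smooth_ext setT g1. Proof. exact: smooth_ext_wedge. Qed.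
Let Sg2 : smooth_ext setT g2. Proof. exact: smooth_ext_wedge. Qed.

Lemma mf_forms1 x : forms1 [:: a0 x; a1 x; a2 x; a3 x; a4 x].
Proof.
by do !split; [case: (mf0 F)|case: (mf1 F)|case: (mf2 F)|case: (mf3 F)|case: (mf4 F)] => _; apply.
Qed.

(** The two characteristic systems enter symmetrically, with the same [s] and [t], and exchanging
    two pairs of covectors is an even permutation. This lets one argument serve both systems
    throughout. *)
Lemma mf_swap : mframe s t a0 a3 a4 a1 a2.
Proof.
case: (F) => ? ? ? ? ? vol [m [km d0]] d1 d2 d3 d4; constructor => //.
  move=> x; have h := mf_forms1 x.
  rewrite (_ : _ &^ _ = a0 x &^ a1 x &^ a2 x &^ a3 x &^ a4 x) //; ext_ring h.
by exists m; split=> // x; rewrite d0 addrAC.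
Qed.

(** Adapted coframings refer to the ideal over [U] generated by the members of the global ideal;
    flattening the two levels of combinations leaves the three original generators. *)
Lemma midealP U w : open U ->
  ideal_on U (mideal a0 a1 a2 a3 a4) w <-> comb3 U a0 g1 g2 w.
Proof.
move=> oU; have sU : U `<=` setT by [].
have G g : mgens a0 a1 a2 a3 a4 g -> comb3 setT a0 g1 g2 g.
  have S01 : smooth_ext (setT : set 'rV[R]_5) (fun=> 0 : ext R 5) by exact: smooth_ext_cst.
  have S11 : smooth_ext (setT : set 'rV[R]_5) (fun=> ext1 : ext R 5) by exact: smooth_ext_cst.
  case=> ->.
  - by apply: (@comb3_intro _ _ _ _ _ _ _ (fun=> ext1) (fun=> 0) (fun=> 0)) => // x _; rewrite wedge1l !wedge0l !addr0.
  - by apply: (@comb3_intro _ _ _ _ _ _ _ (fun=> 0) (fun=> ext1) (fun=> 0)) => // x _; rewrite wedge1l !wedge0l addr0 add0r.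
  - by apply: (@comb3_intro _ _ _ _ _ _ _ (fun=> 0) (fun=> 0) (fun=> ext1)) => // x _; rewrite wedge1l !wedge0l !add0r.
split.
  apply: ideal_comb3 => // g Ig; apply: (comb3_sub sU).
  by apply: ideal_comb3 Ig.
apply: comb3_ideal => //; apply: ideal_on_gen => //.
- exact: smooth_ext_sub sU S0.
- by apply: ideal_on_gen => //; constructor 1.
- exact: smooth_ext_sub sU Sg1.
- by apply: ideal_on_gen => //; constructor 2.
- exact: smooth_ext_sub sU Sg2.
- by apply: ideal_on_gen => //; constructor 3.
Qed.

Lemma mideal_comb3 w : mideal a0 a1 a2 a3 a4 w <-> comb3 setT a0 g1 g2 w.
Proof.
rewrite -midealP //; split=> [Iw|].
  by apply: ideal_on_gen => //; case: Iw.
move/(midealP _ oT); apply: comb3_ideal => //; apply: ideal_on_gen => //.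
- by constructor 1.
- by constructor 2.
- by constructor 3.
Qed.
End MFrame.

Section Eqmod.
Context {R : realType} {n : nat}.
Implicit Types g w z : ext R n.

Lemma eqmod1P g w z : eqmod [:: g] w z <-> exists y, w - z = y &^ g.
Proof.
split=> [[a]|[y E]]; first by rewrite big_ord1 /= => E; exists (a ord0).
by exists (fun=> y); rewrite big_ord1.
Qed.
Lemma eqmod2P g1 g2 w z : eqmod [:: g1; g2] w z <-> exists y1 y2, w - z = y1 &^ g1 + y2 &^ g2.
Proof.
split=> [[a]|[y1 [y2 E]]].
  by rewrite !big_ord_recr big_ord0 /= add0r => E; eexists; eexists; exact: E.
exists (fun i : 'I_2 => nth 0 [:: y1; y2] i).
by rewrite !big_ord_recr big_ord0 /= add0r.
Qed.
Lemma eqmod3P g1 g2 g3 w z : eqmod [:: g1; g2; g3] w z <->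
  exists y1 y2 y3, w - z = y1 &^ g1 + y2 &^ g2 + y3 &^ g3.
Proof.
split=> [[a]|[y1 [y2 [y3 E]]]].
  by rewrite !big_ord_recr big_ord0 /= add0r => E; do 3!eexists; exact: E.
exists (fun i : 'I_3 => nth 0 [:: y1; y2; y3] i).
by rewrite !big_ord_recr big_ord0 /= add0r.
Qed.
End Eqmod.

Lemma scale_eq0_vec (R : realType) n (c : R) (v : ext R n) : c != 0 -> c *: v = 0 -> v = 0.
Proof. by move=> c0 /eqP; rewrite scaler_eq0 (negbTE c0) => /eqP. Qed.

Section MFrameDifferential.
Context {R : realType} (s t : R) (a0 a1 a2 a3 a4 : dform R 5).
Hypothesis F : mframe s t a0 a1 a2 a3 a4.

Local Notation g1 := (fun x => a1 x &^ a2 x).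

Let oT : open (setT : set 'rV[R]_5) := openT.
Let S1 : smooth_ext setT a1 := (mf1 F).1.
Let S2 : smooth_ext setT a2 := (mf2 F).1.
Let S3 : smooth_ext setT a3 := (mf3 F).1.
Let S4 : smooth_ext setT a4 := (mf4 F).1.
Let H0 x : homog 1 (a0 x). Proof. by case: (mf0 F) => _; apply. Qed.
Let H1 x : homog 1 (a1 x). Proof. by case: (mf1 F) => _; apply. Qed.
Let H2 x : homog 1 (a2 x). Proof. by case: (mf2 F) => _; apply. Qed.
Let H3 x : homog 1 (a3 x). Proof. by case: (mf3 F) => _; apply. Qed.
Let H4 x : homog 1 (a4 x). Proof. by case: (mf4 F) => _; apply. Qed.

(** The terms of d a1 and d a2 outside the span of a1 and a2 all contain a0, so d (a1 a2) stays in
    the ideal of a0 and a1 a2. This is what closes the ideal under d. *)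
Lemma mf_dg1 : exists y z : dform R 5, [/\ smooth_ext setT y, smooth_ext setT z & forall x,
  extd g1 x = y x &^ a0 x + z x &^ a1 x &^ a2 x].
Proof.
have [m1 [m2 [k1 k2 d1]]] := mf_d1 F; have [n1 [n2 [l1 l2 d2]]] := mf_d2 F.
exists (fun x => s *: (a4 x &^ a2 x) + t *: (a1 x &^ a3 x)), (fun x => m1 x + n2 x); split.
- by apply: smooth_extD => //; apply: smooth_extZ => //; first [exact: smooth_cst | exact: smooth_ext_wedge].
- by apply: smooth_extD => //; [case: k1 | case: l2].
move=> x; rewrite (extd_wedge1 oT (mf1 F) S2 (x := x)) // d1 d2.
have h : forms1 [:: m1 x; m2 x; n1 x; n2 x; a0 x; a1 x; a2 x; a3 x; a4 x].
  by do !split => //; [case: k1 | case: k2 | case: l1 | case: l2] => _; apply.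
by ext_ring h.
Qed.
End MFrameDifferential.

Section MFrameSystem.
Context {R : realType} (s t : R) (a0 a1 a2 a3 a4 : dform R 5).
Hypothesis F : mframe s t a0 a1 a2 a3 a4.

Local Notation g1 := (fun x => a1 x &^ a2 x).
Local Notation g2 := (fun x => a3 x &^ a4 x).
Local Notation I := (mideal a0 a1 a2 a3 a4).

Let oT : open (setT : set 'rV[R]_5) := openT.
Let S0 : smooth_ext setT a0 := (mf0 F).1.
Let S1 : smooth_ext setT a1 := (mf1 F).1.
Let S2 : smooth_ext setT a2 := (mf2 F).1.
Let S3 : smooth_ext setT a3 := (mf3 F).1.
Let S4 : smooth_ext setT a4 := (mf4 F).1.
Let Sg1 : smooth_ext setT g1. Proof. exact: smooth_ext_wedge. Qed.
Let Sg2 : smooth_ext setT g2. Proof. exact: smooth_ext_wedge. Qed.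
Let H0 x : homog 1 (a0 x). Proof. by case: (mf0 F) => _; apply. Qed.
Let H1 x : homog 1 (a1 x). Proof. by case: (mf1 F) => _; apply. Qed.
Let H2 x : homog 1 (a2 x). Proof. by case: (mf2 F) => _; apply. Qed.
Let H3 x : homog 1 (a3 x). Proof. by case: (mf3 F) => _; apply. Qed.
Let H4 x : homog 1 (a4 x). Proof. by case: (mf4 F) => _; apply. Qed.
Let SC c : smooth_ext (setT : set 'rV[R]_5) (fun=> c : ext R 5). Proof. exact: smooth_ext_cst. Qed.

Lemma comb3T w x0 x1 x2 : smooth_ext setT x0 -> smooth_ext setT x1 -> smooth_ext setT x2 ->
  (forall x, w x = x0 x &^ a0 x + x1 x &^ a1 x &^ a2 x + x2 x &^ a3 x &^ a4 x) ->
  comb3 setT a0 g1 g2 w.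
Proof. by move=> X0 X1 X2 wE; apply: (comb3_intro oT S0 Sg1 Sg2 X0 X1 X2) => x _. Qed.

Lemma mideal_differential : differential_ideal setT I.
Proof.
constructor.
- by move=> w [].
- by move=> w z Iw wz; rewrite (_ : z = w) //; apply/funext => x; rewrite wz.
- apply/(mideal_comb3 F); apply: (@comb3T _ (fun=> 0) (fun=> 0) (fun=> 0)) => // x.
  by rewrite !wedge0l !addr0.
- move=> w z Iw Iz; exact: ideal_onD.
- move=> a w Sa Iw; exact: ideal_onM.
- move=> a w Sa /(mideal_comb3 F)[_ [x0 [x1 [x2 [X0 X1 X2 wE]]]]].
  (* The ideal is built from left multiples. From the right, [a] passes a0 up to [ginv] and passes
     the two 2-form generators unchanged. *)
  have Sga := smooth_ext_ginv oT Sa.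
  apply/(mideal_comb3 F); apply: (@comb3T _ (fun x => x0 x &^ ginv (a x))
    (fun x => x1 x &^ a x) (fun x => x2 x &^ a x)); try exact: smooth_ext_wedge.
  move=> x; rewrite wE // !wedgeDl -!wedgeA (form1_wedge (a x)) // (form1_wedge (a x) (H2 x)).
  rewrite (form1_wedge (a x) (H4 x)) (wedgeA (a1 x)) (form1_wedge _ (H1 x)).
  by rewrite (wedgeA (a3 x)) (form1_wedge _ (H3 x)) ginvK -!wedgeA.
- move=> k w /(mideal_comb3 F)[_ [x0 [x1 [x2 [X0 X1 X2 wE]]]]].
  pose G j (x : dform R 5) : dform R 5 := fun p => if (j <= k)%N then grade (k - j) (x p) else 0.
  have SG j x : smooth_ext setT x -> smooth_ext setT (G j x).
    by rewrite /G => Sx; case: (j <= k)%N => //; exact: smooth_ext_grade.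
  apply/(mideal_comb3 F); apply: (@comb3T _ (G 1%N x0) (G 2 x1) (G 2 x2)); try exact: SG.
  move=> x; rewrite wE // !gradeD (grade_wedge _ _ (H0 x)).
  rewrite (grade_wedge _ _ (homog11 (H1 x) (H2 x))) (grade_wedge _ _ (homog11 (H3 x) (H4 x))) /G.
  by case: (1 <= k)%N; case: (2 <= k)%N; rewrite ?wedge0l.
- move=> w /(mideal_comb3 F)[_ [x0 [x1 [x2 [X0 X1 X2 wE]]]]].
  have [y [z [Sy Sz dg1]]] := mf_dg1 F.
  have [y' [z' [Sy' Sz' dg2]]] := mf_dg1 (mf_swap F).
  have [m [[Sm hm] d0]] := mf_d0 F.
  have -> : w = (fun x => x0 x &^ a0 x + x1 x &^ g1 x + x2 x &^ g2 x) by apply/funext => x; exact: wE.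
  have E i := smooth_ext_extd oT i; have Gi i := smooth_ext_ginv oT i.
  have W := smooth_ext_wedge oT; have D := smooth_extD oT.
  (* [ginv (x0 x)] enters the second and third coefficients through the terms a1 a2 + a3 a4 of d
     a0. *)
  apply/(mideal_comb3 F); apply: (@comb3T _
    (fun x => extd x0 x + ginv (x0 x) &^ m x + ginv (x1 x) &^ y x + ginv (x2 x) &^ y' x)
    (fun x => extd x1 x + ginv (x0 x) + ginv (x1 x) &^ z x)
    (fun x => extd x2 x + ginv (x0 x) + ginv (x2 x) &^ z' x)); try by auto 10.
  move=> x; rewrite (@extdD _ _ setT (fun x => x0 x &^ a0 x + x1 x &^ g1 x)) //; try by auto.
  rewrite (@extdD _ _ setT) //; try by auto.
  rewrite (@extd_wedge _ _ setT x0) // (@extd_wedge _ _ setT x1) // (@extd_wedge _ _ setT x2) //.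
  rewrite d0 dg1 dg2 !wedgeDr !wedgeDl -!wedgeA.
  (* The multipliers are not 1-forms, so [ext_ring] does not apply; what remains is additive and is
     checked coefficientwise. *)
  set A := extd x0 x &^ _; set B := ginv (x0 x) &^ m x &^ _.
  set C := ginv (x0 x) &^ a1 x &^ _; set C' := ginv (x0 x) &^ a3 x &^ _.
  set X := extd x1 x &^ _; set X' := extd x2 x &^ _.
  set Y := ginv (x1 x) &^ y x &^ _; set Z := ginv (x1 x) &^ z x &^ _.
  set Y' := ginv (x2 x) &^ y' x &^ _; set Z' := ginv (x2 x) &^ z' x &^ _.
  clearbody A B C C' X X' Y Z Y' Z'; apply/ffunP => K; rewrite !ffunE.
  by move: (A K : R) (B K : R) (C K : R) (C' K : R) (X K : R) (X' K : R) (Y K : R) (Z K : R) (Y' K : R) (Z' K : R) => *; ring.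
Qed.

(** With g1 = a1 a2 and g2 = a3 a4, the pencil is (l + k) g1 + (l - k) g2 modulo a0, and its square
    is 2 (l^2 - k^2) g1 g2. The two roots are thus [1:1] and [1:-1]. *)
Lemma mframe_hyperbolic x : hyperbolic_at (a0 x) (extd a0 x) (a1 x &^ a2 x - a3 x &^ a4 x).
Proof.
have [m [[Sm hm] d0]] := mf_d0 F.
have h : forms1 [:: m x; a0 x; a1 x; a2 x; a3 x; a4 x] by do !split => //; exact: hm.
have V := mf_vol F x.
split.
- rewrite /wedges /= wedge1r d0; apply: contraNneq V => E; apply/eqP.
  apply: (@scale_eq0_vec _ _ 2%:R) => //.
  by rewrite -E; ext_ring h.
- move=> a b /eqmod1P[y]; rewrite subr0 => E.
  have H z : a0 x &^ z = 0 -> (a *: extd a0 x + b *: (a1 x &^ a2 x - a3 x &^ a4 x)) &^ z = 0.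
    by move=> z0; rewrite E -wedgeA z0 wedge0r.
  have E1 : a + b = 0.
    apply: (scale_eq0_coef V); rewrite -(H (a0 x &^ a3 x &^ a4 x)) ?d0; ext_ring h.
  have E2 : a - b = 0.
    apply: (scale_eq0_coef V); rewrite -(H (a0 x &^ a1 x &^ a2 x)) ?d0; ext_ring h.
  by split; lra.
- exists 1, 1, 1, (-1); split; first by rewrite !mul1r; apply/eqP => ?; lra.
  move=> l k _ Psi; split=> [/eqmod1P[y]|].
    rewrite subr0 => E.
    have E1 : (l - k) * (l + k) = 0.
      apply: (scale_eq0_coef V); apply: (@scale_eq0_vec _ _ 2%:R) => //.
      have <- : (Psi &^ Psi) &^ a0 x = 0 by rewrite E -wedgeA form1_sq ?wedge0r.
      by rewrite /Psi d0; ext_ring h.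
    by move/eqP: E1; rewrite mulf_eq0 => /orP[]/eqP ?; [left|right]; lra.
  rewrite {}/Psi => lk; apply/eqmod1P; rewrite subr0.
  (* The multiplier collects the cross terms of the square that involve the summand m a0 of d a0. *)
  exists (2%:R * l *: (((l + k) *: (a1 x &^ a2 x) + (l - k) *: (a3 x &^ a4 x)) &^ m x)).
  have {lk}[-> | ->] : k = l \/ k = - l by case: lk => ?; [left|right]; lra.
    by rewrite d0; ext_ring h.
  by rewrite d0; ext_ring h.
Qed.

Lemma mframe_local_generators :
  local_generators setT I setT a0 (fun x => a1 x &^ a2 x - a3 x &^ a4 x).
Proof.
have [m [[Sm hm] d0]] := mf_d0 F.
constructor; [exact: oT|by move=> x|exact: (mf0 F)|..].
- by apply: kformB => //; apply: kform_wedge11 => //; first [exact: (mf1 F)|exact: (mf2 F)|exact: (mf3 F)|exact: (mf4 F)].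
- have SO : smooth_ext setT (fun x => a1 x &^ a2 x - a3 x &^ a4 x) by exact: smooth_extB.
  have SE := smooth_ext_extd oT S0.
  rewrite /generated_on predeqE => w; rewrite (midealP F _ oT); split.
    have I0 : ideal_on setT [set w | [\/ w = a0, w = extd a0 | w = (fun x => a1 x &^ a2 x - a3 x &^ a4 x)]] a0.
      by apply: ideal_on_gen => //; constructor 1.
    have I1 : ideal_on setT [set w | [\/ w = a0, w = extd a0 | w = (fun x => a1 x &^ a2 x - a3 x &^ a4 x)]] (extd a0).
      by apply: ideal_on_gen => //; constructor 2.
    have I2 : ideal_on setT [set w | [\/ w = a0, w = extd a0 | w = (fun x => a1 x &^ a2 x - a3 x &^ a4 x)]] (fun x => a1 x &^ a2 x - a3 x &^ a4 x).
      by apply: ideal_on_gen => //; constructor 3.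
    apply: comb3_ideal => //.
      (* Up to a multiple of a0, a1 a2 is half the sum of the two 2-form generators; a3 a4 below is
         half their difference. *)
      apply: (@ideal_on_eq _ _ _ _ (fun x => (- (2^-1 *: m x) &^ a0 x + (2^-1 *: ext1) &^ extd a0 x) +
         (2^-1 *: ext1) &^ (a1 x &^ a2 x - a3 x &^ a4 x))) => //.
        move=> x _; rewrite d0 !wedgeZl !wedge1l.
        have h : forms1 [:: m x; a0 x; a1 x; a2 x; a3 x; a4 x] by do !split => //; exact: hm.
        by rewrite /=; ext_ring h; field.
      apply: ideal_onD => //; first apply: ideal_onD => //; apply: ideal_onM => //.
      by apply: smooth_extN => //; apply: smooth_extZ => //; exact: smooth_cst.
    apply: (@ideal_on_eq _ _ _ _ (fun x => (- (2^-1 *: m x) &^ a0 x + (2^-1 *: ext1) &^ extd a0 x) +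
         (- (2^-1 *: ext1)) &^ (a1 x &^ a2 x - a3 x &^ a4 x))) => //.
      move=> x _; rewrite d0 !wedgeNl !wedgeZl !wedge1l.
      have h : forms1 [:: m x; a0 x; a1 x; a2 x; a3 x; a4 x] by do !split => //; exact: hm.
      by rewrite /=; ext_ring h; field.
    apply: ideal_onD => //; first apply: ideal_onD => //; apply: ideal_onM => //.
    by apply: smooth_extN => //; apply: smooth_extZ => //; exact: smooth_cst.
  apply: ideal_comb3 => // g [] ->.
  - by apply: (@comb3T _ (fun=> ext1) (fun=> 0) (fun=> 0)) => // x; rewrite wedge1l !wedge0l !addr0.
  - apply: (@comb3T _ m (fun=> ext1) (fun=> ext1)) => // x; rewrite !wedge1l d0.
    by [].
  - apply: (@comb3T _ (fun=> 0) (fun=> ext1) (fun=> - ext1)) => // x.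
    by rewrite wedge0l wedgeNl !wedge1l add0r.
- by move=> x _; exact: mframe_hyperbolic.
Qed.

Lemma mframe_hyperbolic_MA : hyperbolic_MA setT I.
Proof.
split=> //; first by exists 0.
  exact: mideal_differential.
by move=> x _; do 3!eexists; split; last exact: mframe_local_generators.
Qed.

Lemma mframe_adapted : adapted1 setT I setT (fr5 a0 a1 a2 a3 a4).
Proof.
constructor; [exact: oT|by move=> x|..].
- by case=> [[|[|[|[|[|//]]]]] Hi]; [exact: (mf0 F)|exact: (mf1 F)|exact: (mf2 F)|exact: (mf3 F)|exact: (mf4 F)].
- move=> x _; rewrite enum_I5 /= wedge1r; exact: (mf_vol F x).
- rewrite /generated_on predeqE => w; rewrite (midealP F _ oT) -(mideal_comb3 F); by [].
- move=> x _; have [m [_ d0]] := mf_d0 F; apply/eqmod1P; exists (m x).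
  by apply/eqP; rewrite subr_eq addrA; apply/eqP; exact: d0.
- move=> x _ i; have [m1 [m2 [_ _ d1]]] := mf_d1 F; have [n1 [n2 [_ _ d2]]] := mf_d2 F.
  rewrite !inE => /orP[]/eqP ->; apply/eqmod3P.
    exists (- s *: a4 x), (m1 x), (m2 x); rewrite /= subr0 d1.
    rewrite wedgeZl (form1C (H4 x)) // scaleNr scalerN opprK addrC addrA; by [].
  exists (- t *: a3 x), (n1 x), (n2 x); rewrite /= subr0 d2.
  rewrite wedgeZl (form1C (H3 x)) // scaleNr scalerN opprK addrC addrA; by [].
- move=> x _ i; have [m1 [m2 [_ _ d1]]] := mf_d3 F; have [n1 [n2 [_ _ d2]]] := mf_d4 F.
  rewrite !inE => /orP[]/eqP ->; apply/eqmod3P.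
    exists (- s *: a2 x), (m1 x), (m2 x); rewrite /= subr0 d1.
    rewrite wedgeZl (form1C (H2 x)) // scaleNr scalerN opprK addrC addrA; by [].
  exists (- t *: a1 x), (n1 x), (n2 x); rewrite /= subr0 d2.
  rewrite wedgeZl (form1C (H1 x)) // scaleNr scalerN opprK addrC addrA; by [].
Qed.

Lemma mframe_G1 x : G1 setT I x (fr5 (a0 x) (a1 x) (a2 x) (a3 x) (a4 x)).
Proof.
exists setT, (fr5 a0 a1 a2 a3 a4); split=> //; first exact: mframe_adapted.
by case=> [[|[|[|[|[|//]]]]] Hi].
Qed.
End MFrameSystem.

(** * Change of adapted frame *)

Section ZeroProducts.
Context {R : realType} {n : nat}.
Variables (V : set 'rV[R]_n) (oV : open V).
Implicit Types p q r s : dform R n.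

(** Expansions such as p = c0 a0 + c1 a1 + c2 a2 come pointwise, without smooth coefficients. They
    are therefore restated as vanishing products, which can be differentiated on [V]; the next two
    lemmas do this for three and four factors. *)
Lemma extd_wedge2_eq0 p q x : kform 1 V p -> kform 1 V q -> V x ->
  (forall y, V y -> p y &^ q y = 0) -> extd p x &^ q x = p x &^ extd q x.
Proof.
move=> kp [Sq _] Vx E; apply/eqP; rewrite -subr_eq0; apply/eqP.
by rewrite -(extd_wedge1 oV kp Sq Vx) (extd_eq (z := fun=> 0) oV _ Vx) ?extd_cst.
Qed.

Lemma extd_wedge3_eq0 p q r x : kform 1 V p -> kform 1 V q -> kform 1 V r -> V x ->
  (forall y, V y -> p y &^ q y &^ r y = 0) ->
  extd p x &^ q x &^ r x = p x &^ (extd q x &^ r x - q x &^ extd r x).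
Proof.
move=> kp kq kr Vx E; apply/eqP; rewrite -subr_eq0; apply/eqP.
have Sr := kr.1; have Sqr := smooth_ext_wedge oV kq.1 Sr.
rewrite -(extd_wedge1 oV kq Sr Vx) -(extd_wedge1 oV kp Sqr Vx).
by rewrite (extd_eq (z := fun=> 0) oV _ Vx) ?extd_cst.
Qed.

Lemma extd_wedge4_eq0 p q r s x :
  kform 1 V p -> kform 1 V q -> kform 1 V r -> kform 1 V s -> V x ->
  (forall y, V y -> p y &^ q y &^ r y &^ s y = 0) ->
  extd p x &^ q x &^ r x &^ s x =
    p x &^ (extd q x &^ r x &^ s x - q x &^ (extd r x &^ s x - r x &^ extd s x)).
Proof.
move=> kp kq kr ks Vx E; apply/eqP; rewrite -subr_eq0; apply/eqP.
have Ss := ks.1; have Srs := smooth_ext_wedge oV kr.1 Ss.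
have Sqrs := smooth_ext_wedge oV kq.1 Srs.
rewrite -(extd_wedge1 oV kr Ss Vx) -(extd_wedge1 oV kq Srs Vx) -(extd_wedge1 oV kp Sqrs Vx).
by rewrite (extd_eq (z := fun=> 0) oV _ Vx) ?extd_cst.
Qed.

(** A nonvanishing condition known at one point thereby holds on an open set, as differentiation
    requires. *)
Lemma open_neq0 (w : dform R n) : smooth_ext V w -> open (V `&` [set x | w x != 0]).
Proof.
move=> Sw; rewrite openE => x [Vx wx].
have [I wI] : exists I, w x I != 0.
  apply: contrapT => H; move/eqP: wx; apply; apply/ffunP => I; rewrite ffunE.
  by apply: contrapT => /eqP wI; apply: H; exists I.
have cw : {for x, continuous (fun y => w y I)}.
  by apply: differentiable_continuous; exact: smooth_diff (Sw I) Vx.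
have nw : \forall y \near x, w y I != 0 by move/cvgr_neq0: cw => /(_ wI).
have nV : \forall y \near x, V y by exact: open_nbhs_nbhs.
rewrite /interior; apply: filterS2 nV nw => y Vy wyI; split=> //=.
by apply: contraNneq wyI => ->; rewrite ffunE.
Qed.
End ZeroProducts.

Lemma form2_wedge (R : realType) n (v w y : ext R n) : homog 1 v -> homog 1 w ->
  v &^ w &^ y = y &^ v &^ w.
Proof.
move=> hv hw; rewrite (form1_wedge y hw) (wedgeA v) (form1_wedge _ hv) ginvK.
by rewrite -wedgeA.
Qed.

(* [du] stands for the derivatives of a coframing extending [u]; only the part of them that
   enters the V_i is prescribed. *)
Definition frame_rel (R : realType) (s t : R) (b0 b1 b2 b3 b4 : ext R 5)
    (u du : 'I_5 -> ext R 5) (f c1 c2 d1 d2 e3 e4 k3 k4 : R) : Prop :=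
  [/\ f != 0, u 0 = f *: b0,
    [/\ u 1 = c1 *: b1 + c2 *: b2, u 2%:R = d1 *: b1 + d2 *: b2,
        u 3%:R = e3 *: b3 + e4 *: b4 & u 4%:R = k3 *: b3 + k4 *: b4],
    c1 * d2 - c2 * d1 = f /\ e3 * k4 - e4 * k3 = f
  & [/\ du 1 &^ b1 &^ b2 = ((c1 * s) *: (b0 &^ b4) + (c2 * t) *: (b0 &^ b3)) &^ b1 &^ b2,
        du 2%:R &^ b1 &^ b2 = ((d1 * s) *: (b0 &^ b4) + (d2 * t) *: (b0 &^ b3)) &^ b1 &^ b2,
        du 3%:R &^ b3 &^ b4 = ((e3 * s) *: (b0 &^ b2) + (e4 * t) *: (b0 &^ b1)) &^ b3 &^ b4
      & du 4%:R &^ b3 &^ b4 = ((k3 * s) *: (b0 &^ b2) + (k4 * t) *: (b0 &^ b1)) &^ b3 &^ b4]].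

Section Invariance.
Context {R : realType} (s t : R) (a0 a1 a2 a3 a4 : dform R 5).
Hypothesis F : mframe s t a0 a1 a2 a3 a4.
Local Notation g1 := (fun x => a1 x &^ a2 x).
Local Notation g2 := (fun x => a3 x &^ a4 x).
Local Notation I := (mideal a0 a1 a2 a3 a4).
Variables (U : set 'rV[R]_5) (om : 'I_5 -> dform R 5).
Hypothesis A : adapted1 setT I U om.

Let oU : open U := ad_open A.
Let hom i x (Ux : U x) : homog 1 (om i x) := (ad_form A i).2 x Ux.
Let Som i : smooth_ext U (om i) := (ad_form A i).1.

Lemma adapted_comb3 g : smooth_ext U g ->
  [\/ g = om 0, g = (fun x => om 1 x &^ om 2%:R x) | g = (fun x => om 3%:R x &^ om 4%:R x)] ->
  comb3 U a0 g1 g2 g.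
Proof.
move=> Sg H; apply/(midealP F _ oU).
by rewrite (ad_gen A); apply: ideal_on_gen.
Qed.

Lemma adapted_om0 x : U x -> exists f, om 0 x = f *: a0 x.
Proof.
move=> Ux; have [|_ [x0 [x1 [x2 [_ _ _ E]]]]] := adapted_comb3 (Som 0); first by constructor 1.
exact: (ideal_form1 (mf_forms1 F x) (mf_vol F x) (hom 0 Ux) (E x Ux)).
Qed.

Lemma adapted_om12 x : U x -> exists x0 x1 x2,
  om 1 x &^ om 2%:R x = x0 &^ a0 x + x1 &^ a1 x &^ a2 x + x2 &^ a3 x &^ a4 x.
Proof.
move=> Ux; have [||_ [x0 [x1 [x2 [_ _ _ E]]]]] := @adapted_comb3 (fun x => om 1 x &^ om 2%:R x).
- exact: smooth_ext_wedge.
- by constructor 2.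
by exists (x0 x), (x1 x), (x2 x); exact: E.
Qed.

Lemma adapted_om34 x : U x -> exists x0 x1 x2,
  om 3%:R x &^ om 4%:R x = x0 &^ a0 x + x1 &^ a1 x &^ a2 x + x2 &^ a3 x &^ a4 x.
Proof.
move=> Ux; have [||_ [x0 [x1 [x2 [_ _ _ E]]]]] := @adapted_comb3 (fun x => om 3%:R x &^ om 4%:R x).
- exact: smooth_ext_wedge.
- by constructor 3.
by exists (x0 x), (x1 x), (x2 x); exact: E.
Qed.

Lemma adapted_vol x : U x ->
  om 0 x &^ om 1 x &^ om 2%:R x &^ om 3%:R x &^ om 4%:R x != 0.
Proof. by move=> /(ad_free A); rewrite enum_I5 /= wedge1r. Qed.

(* In the second case the coframing exchanges the two characteristic systems. *)
Lemma adapted_dichotomy x : U x ->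
  om 1 x &^ om 2%:R x &^ a0 x &^ a3 x &^ a4 x != 0 \/
  om 1 x &^ om 2%:R x &^ a0 x &^ a1 x &^ a2 x != 0.
Proof.
move=> Ux; have [f E0] := adapted_om0 Ux; have [y0 [y1 [y2 E34]]] := adapted_om34 Ux.
have V := adapted_vol Ux.
have [h0 h1 h2 h3 h4] : [/\ homog 1 (a0 x), homog 1 (a1 x), homog 1 (a2 x), homog 1 (a3 x) & homog 1 (a4 x)].
  by have [? [? [? [? [? _]]]]] := mf_forms1 F x.
have [D1|?] := eqVneq (om 1 x &^ om 2%:R x &^ a0 x &^ a3 x &^ a4 x) 0; last by left.
have [D2|?] := eqVneq (om 1 x &^ om 2%:R x &^ a0 x &^ a1 x &^ a2 x) 0; last by right.
case/eqP: V.
have C := hom 1 Ux; have D := hom 2%:R Ux.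
(* If both products vanish, expanding om3 om4 in the three generators makes the whole volume
   vanish. *)
rewrite E0 wedgeZl form1CA // (form1CA _ h0) // wedgeNr opprK.
rewrite E34 -[y0]ginvK -(form1_wedge _ h0) -(form2_wedge y1 h1 h2) -(form2_wedge y2 h3 h4).
rewrite !wedgeDr form1_sqA // !wedge0r add0r.
have -> : om 1 x &^ om 2%:R x &^ a0 x &^ a1 x &^ a2 x &^ y1 =
   (om 1 x &^ om 2%:R x &^ a0 x &^ a1 x &^ a2 x) &^ y1 by rewrite -!wedgeA.
have -> : om 1 x &^ om 2%:R x &^ a0 x &^ a3 x &^ a4 x &^ y2 =
   (om 1 x &^ om 2%:R x &^ a0 x &^ a3 x &^ a4 x) &^ y2 by rewrite -!wedgeA.
by rewrite D1 D2 !wedge0l addr0 scaler0.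
Qed.

Variables (V : set 'rV[R]_5) (oV : open V).
Hypothesis VU : V `<=` U.
Hypothesis W : V `<=` [set x | om 1 x &^ om 2%:R x &^ a0 x &^ a3 x &^ a4 x != 0].

(** The hypothesis [W] places om1 and om2 in the span of a0, a1, a2. The volume then forces om3 om4
    a0 a1 a2 to be nonzero, so the same argument applies to om3 and om4 with the characteristic
    systems exchanged. *)
Lemma adapted_split x : V x ->
  [/\ exists c0 c1 c2, om 1 x = c0 *: a0 x + c1 *: a1 x + c2 *: a2 x,
      exists d0 d1 d2, om 2%:R x = d0 *: a0 x + d1 *: a1 x + d2 *: a2 x,
      exists e0 e3 e4, om 3%:R x = e0 *: a0 x + e3 *: a3 x + e4 *: a4 x
    & exists k0 k3 k4, om 4%:R x = k0 *: a0 x + k3 *: a3 x + k4 *: a4 x].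
Proof.
move=> Vx; have Ux := VU Vx; have [f E0] := adapted_om0 Ux.
have [x0 [x1 [x2 E12]]] := adapted_om12 Ux; have [y0 [y1 [y2 E34]]] := adapted_om34 Ux.
have h := mf_forms1 F x; have v := mf_vol F x; have v' := mf_vol (mf_swap F) x.
have [P1 P2] := ideal_form2 h v (hom 1 Ux) (hom 2%:R Ux) E12 (W Vx).
have E34' : om 3%:R x &^ om 4%:R x = y0 &^ a0 x + y2 &^ a3 x &^ a4 x + y1 &^ a1 x &^ a2 x.
  by rewrite E34 addrAC.
have N34 : om 3%:R x &^ om 4%:R x &^ a0 x &^ a1 x &^ a2 x != 0.
  have := adapted_vol Ux; apply: contraNneq => Z.
  case: P1 => c0 [c1 [c2 ->]]; case: P2 => d0 [d1 [d2 ->]]; rewrite E0.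
  have hh : forms1 [:: om 3%:R x; om 4%:R x; a0 x; a1 x; a2 x].
    have [? [? [? _]]] := h; do !split => //; exact: hom.
  apply/eqP; transitivity ((f * (c1 * d2 - c2 * d1)) *: (om 3%:R x &^ om 4%:R x &^ a0 x &^ a1 x &^ a2 x)).
    by ext_ring hh.
  by rewrite Z scaler0.
have [P3 P4] := ideal_form2 (mf_forms1 (mf_swap F) x) v' (hom 3%:R Ux) (hom 4%:R Ux) E34' N34.
by split.
Qed.

Let k0 : kform 1 V a0 := kform_sub (@subsetT _ V) (mf0 F).
Let k1 : kform 1 V a1 := kform_sub (@subsetT _ V) (mf1 F).
Let k2 : kform 1 V a2 := kform_sub (@subsetT _ V) (mf2 F).
Let k3 : kform 1 V a3 := kform_sub (@subsetT _ V) (mf3 F).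
Let k4 : kform 1 V a4 := kform_sub (@subsetT _ V) (mf4 F).
Let kom i : kform 1 V (om i) := kform_sub VU (ad_form A i).

(* Differentiating [p a0 a1 a2 = 0] for [p] in the span of [a0, a1, a2]; the term [a3 a4] of
   [d a0] forces the [a0]-component of [p] to vanish. *)
Lemma adapted_no_a0 (p : dform R 5) x : V x -> kform 1 V p ->
  (forall y, V y -> exists c0 c1 c2, p y = c0 *: a0 y + c1 *: a1 y + c2 *: a2 y) ->
  extd p x &^ a0 x &^ a1 x &^ a2 x = 0 ->
  exists c1 c2, p x = c1 *: a1 x + c2 *: a2 x.
Proof.
move=> Vx kp Hp dp0.
have E := extd_wedge4_eq0 oV kp k0 k1 k2 Vx.
have {}E : extd p x &^ a0 x &^ a1 x &^ a2 x = p x &^ (extd a0 x &^ a1 x &^ a2 x - a0 x &^ (extd a1 x &^ a2 x - a1 x &^ extd a2 x)).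
  apply: E => y /Hp[c0 [c1 [c2 ->]]]; have h := mf_forms1 F y; by ext_ring h.
have [m [[_ hm] d0]] := mf_d0 F; have [m1 [m2 [[_ hm1] [_ hm2] d1]]] := mf_d1 F.
have [n1 [n2 [[_ hn1] [_ hn2] d2]]] := mf_d2 F.
have h : forms1 [:: m x; m1 x; m2 x; n1 x; n2 x; a0 x; a1 x; a2 x; a3 x; a4 x].
  by have [? [? [? [? [? _]]]]] := mf_forms1 F x; do !split => //; first [exact: hm | exact: hm1 | exact: hm2 | exact: hn1 | exact: hn2].
have [c0 [c1 [c2 px]]] := Hp x Vx.
exists c1, c2; rewrite px; have -> : c0 = 0; last by rewrite scale0r add0r.
apply: (scale_eq0_coef (mf_vol F x)); rewrite -dp0 E px d0 d1 d2; ext_ring h.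
Qed.

(** Obtained by differentiating p a1 a2 = 0, so no derivative of c1 or c2 occurs. This is why
    [frame_rel] prescribes derivatives only after multiplication by two frame covectors. *)
Lemma adapted_d (p : dform R 5) c1 c2 x : V x -> kform 1 V p ->
  (forall y, V y -> exists c1 c2, p y = c1 *: a1 y + c2 *: a2 y) ->
  p x = c1 *: a1 x + c2 *: a2 x ->
  extd p x &^ a1 x &^ a2 x = ((c1 * s) *: (a0 x &^ a4 x) + (c2 * t) *: (a0 x &^ a3 x)) &^ a1 x &^ a2 x.
Proof.
move=> Vx kp Hp px.
rewrite (extd_wedge3_eq0 oV kp k1 k2 Vx); last first.
  by move=> y /Hp[b1 [b2 ->]]; have h := mf_forms1 F y; ext_ring h.
have [m1 [m2 [[_ hm1] [_ hm2] d1]]] := mf_d1 F.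
have [n1 [n2 [[_ hn1] [_ hn2] d2]]] := mf_d2 F.
have h : forms1 [:: m1 x; m2 x; n1 x; n2 x; a0 x; a1 x; a2 x; a3 x; a4 x].
  by have [? [? [? [? [? _]]]]] := mf_forms1 F x; do !split => //; first [exact: hm1 | exact: hm2 | exact: hn1 | exact: hn2].
by rewrite px d1 d2; ext_ring h.
Qed.

(** Adaptedness puts d om1 and d om2 in the ideal of om0, om1, om2, which all lie in the span of a0,
    a1, a2; their products with a0 a1 a2 therefore vanish, as [adapted_no_a0] demands. *)
Lemma adapted_no_a0_12 x : V x ->
  (exists c1 c2, om 1 x = c1 *: a1 x + c2 *: a2 x) /\
  (exists d1 d2, om 2%:R x = d1 *: a1 x + d2 *: a2 x).
Proof.
move=> Vx; have Ux := VU Vx; have h := mf_forms1 F x.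
have [f E0] := adapted_om0 Ux.
have [[c0 [c1 [c2 E1]]] [d0 [d1 [d2 E2]]] _ _] := adapted_split Vx.
have d12 i : i \in [:: 1; 2%:R] -> extd (om i) x &^ a0 x &^ a1 x &^ a2 x = 0.
  move=> /(ad_d12 A Ux)/eqmod3P[y1 [y2 [y3]]]; rewrite subr0 => ->.
  rewrite E0 E1 E2 !wedgeDl -!wedgeA.
  have -> : (f *: a0 x) &^ a0 x &^ a1 x &^ a2 x = 0 by ext_ring h.
  have -> : (c0 *: a0 x + c1 *: a1 x + c2 *: a2 x) &^ a0 x &^ a1 x &^ a2 x = 0 by ext_ring h.
  have -> : (d0 *: a0 x + d1 *: a1 x + d2 *: a2 x) &^ a0 x &^ a1 x &^ a2 x = 0 by ext_ring h.
  by rewrite !wedge0r !addr0.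
split; apply: adapted_no_a0 => //.
- by move=> y /adapted_split[].
- by apply: d12; rewrite inE eqxx.
- by move=> y /adapted_split[].
- by apply: d12; rewrite !inE eqxx orbT.
Qed.
End Invariance.

Lemma mideal_swap (R : realType) (a0 a1 a2 a3 a4 : dform R 5) :
  mideal a0 a3 a4 a1 a2 = mideal a0 a1 a2 a3 a4.
Proof.
rewrite /mideal; congr (ideal_on _ _); apply/seteqP; split=> w [->|->|->];
  by [constructor 1|constructor 2|constructor 3].
Qed.

Section Invariance34.
Context {R : realType} (s t : R) (a0 a1 a2 a3 a4 : dform R 5).
Hypothesis F : mframe s t a0 a1 a2 a3 a4.
Local Notation I := (mideal a0 a1 a2 a3 a4).
Variables (U : set 'rV[R]_5) (om : 'I_5 -> dform R 5).
Hypothesis A : adapted1 setT I U om.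

Lemma adapted_frame_rel_split x : U x ->
  om 1 x &^ om 2%:R x &^ a0 x &^ a3 x &^ a4 x != 0 ->
  exists f c1 c2 d1 d2 e3 e4 k3 k4,
    frame_rel s t (a0 x) (a1 x) (a2 x) (a3 x) (a4 x) (om^~ x)
      (fun i => extd (om i) x) f c1 c2 d1 d2 e3 e4 k3 k4.
Proof.
move=> Ux Dx.
have oU : open U := ad_open A.
have kU i : kform 1 U (om i) := ad_form A i.
have T a : kform 1 setT a -> smooth_ext U a by move=> ka; exact: (kform_sub (@subsetT _ U) ka).1.
(* The case distinction is made at [x] only; it persists on a neighbourhood, where the identities
   can be differentiated. *)
have := @open_neq0 R 5 U oU (fun y => om 1 y &^ om 2%:R y &^ a0 y &^ a3 y &^ a4 y).
set V := U `&` _ => oV; have {}oV : open V.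
  by apply: oV; do !apply: smooth_ext_wedge => //; first [exact: (kU _).1 | apply: T; first [exact: mf0 F|exact: mf3 F|exact: mf4 F]].
have Vx : V x by [].
have VU : V `<=` U by move=> y [].
have W : V `<=` [set y | om 1 y &^ om 2%:R y &^ a0 y &^ a3 y &^ a4 y != 0] by move=> y [].
have k i : kform 1 V (om i) := kform_sub VU (kU i).
have F' := mf_swap F.
have A' : adapted1 setT (mideal a0 a3 a4 a1 a2) U om by rewrite mideal_swap.
have H12 y (Vy : V y) := adapted_no_a0_12 F A oV VU W Vy.
(* Exchanging the pairs of the reference frame does not renumber [om], so om3 and om4 get their own
   argument, based on [ad_d34]. *)
have H34 y : V y -> (exists c1 c2, om 3%:R y = c1 *: a3 y + c2 *: a4 y) /\
    (exists d1 d2, om 4%:R y = d1 *: a3 y + d2 *: a4 y).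
  move=> Vy; have Uy := VU _ Vy; have h := mf_forms1 F y.
  have [f E0] := adapted_om0 F A Uy.
  have [_ _ [e0 [e3 [e4 E3]]] [k0 [k3 [k4 E4]]]] := adapted_split F A VU W Vy.
  have d34 i : i \in [:: 3%:R; 4%:R] -> extd (om i) y &^ a0 y &^ a3 y &^ a4 y = 0.
    move=> /(ad_d34 A Uy)/eqmod3P[y1 [y2 [y3]]]; rewrite subr0 => ->.
    rewrite E0 E3 E4 !wedgeDl -!wedgeA.
    have -> : (f *: a0 y) &^ a0 y &^ a3 y &^ a4 y = 0 by ext_ring h.
    have -> : (e0 *: a0 y + e3 *: a3 y + e4 *: a4 y) &^ a0 y &^ a3 y &^ a4 y = 0 by ext_ring h.
    have -> : (k0 *: a0 y + k3 *: a3 y + k4 *: a4 y) &^ a0 y &^ a3 y &^ a4 y = 0 by ext_ring h.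
    by rewrite !wedge0r !addr0.
  split; apply: (adapted_no_a0 F' oV Vy) => //.
  - by move=> z /(adapted_split F A VU W)[].
  - by apply: d34; rewrite inE eqxx.
  - by move=> z /(adapted_split F A VU W)[].
  - by apply: d34; rewrite !inE eqxx orbT.
have [f E0] := adapted_om0 F A Ux.
have [[c1 [c2 E1]] [d1 [d2 E2]]] := H12 x Vx.
have [[e3 [e4 E3]] [k3 [k4 E4]]] := H34 x Vx.
have f0 : f != 0.
  have := adapted_vol A Ux; apply: contraNneq => f0.
  by rewrite E0 f0 scale0r wedge0l.
exists f, c1, c2, d1, d2, e3, e4, k3, k4; split => //.
  have [m [[_ hm] d0]] := mf_d0 F.
  have h : forms1 [:: m x; a0 x; a1 x; a2 x; a3 x; a4 x].
    by have [? [? [? [? [? _]]]]] := mf_forms1 F x; do !split => //; exact: hm.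
  (* Differentiating om0 a0 = 0 and inserting the adapted form of d om0 gives (om1 om2 + om3 om4) a0
     = f (a1 a2 + a3 a4) a0; its two components say that both determinants equal [f]. *)
  have E := extd_wedge2_eq0 oV (k 0) (kform_sub (@subsetT _ V) (mf0 F)) Vx.
  have {}E : extd (om 0) x &^ a0 x = om 0 x &^ extd a0 x.
    apply: E => y Vy; have [f' ->] := adapted_om0 F A (VU _ Vy).
    by rewrite wedgeZl form1_sq ?scaler0 //; case: (mf0 F) => _; apply.
  have /eqmod1P[z dE] := ad_d0 A Ux.
  have {}dE : extd (om 0) x = z &^ om 0 x + (om 1 x &^ om 2%:R x + om 3%:R x &^ om 4%:R x).
    by rewrite -dE subrK.
  have Z : (om 1 x &^ om 2%:R x + om 3%:R x &^ om 4%:R x) &^ a0 x = f *: ((a1 x &^ a2 x + a3 x &^ a4 x) &^ a0 x).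
    have zz : (z &^ om 0 x) &^ a0 x = 0.
      rewrite E0 -wedgeA wedgeZl form1_sq ?scaler0 ?wedge0r //.
      by case: (mf0 F) => _; apply.
    move: E; rewrite dE wedgeDl zz add0r => ->.
    by rewrite E0 d0; ext_ring h.
  have v := mf_vol F x.
  split; apply/eqP; rewrite -subr_eq0; apply/eqP; apply: (scale_eq0_coef v).
    transitivity ((om 1 x &^ om 2%:R x + om 3%:R x &^ om 4%:R x) &^ a0 x &^ a3 x &^ a4 x -
      f *: ((a1 x &^ a2 x + a3 x &^ a4 x) &^ a0 x &^ a3 x &^ a4 x)).
      by rewrite E1 E2 E3 E4; ext_ring h.
    by rewrite wedgeA Z wedgeZl -wedgeA subrr.
  transitivity ((om 1 x &^ om 2%:R x + om 3%:R x &^ om 4%:R x) &^ a0 x &^ a1 x &^ a2 x -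
      f *: ((a1 x &^ a2 x + a3 x &^ a4 x) &^ a0 x &^ a1 x &^ a2 x)).
    by rewrite E1 E2 E3 E4; ext_ring h.
  by rewrite wedgeA Z wedgeZl -wedgeA subrr.
split.
- by apply: (adapted_d F oV Vx) => // y /H12[].
- by apply: (adapted_d F oV Vx) => // y /H12[].
- by apply: (adapted_d F' oV Vx) => // y /H34[].
- by apply: (adapted_d F' oV Vx) => // y /H34[].
Qed.
End Invariance34.

Theorem adapted_frame_rel (R : realType) (s t : R) (a0 a1 a2 a3 a4 : dform R 5)
    (F : mframe s t a0 a1 a2 a3 a4) (U : set 'rV[R]_5) (om : 'I_5 -> dform R 5)
    (A : adapted1 setT (mideal a0 a1 a2 a3 a4) U om) x : U x ->
  exists f c1 c2 d1 d2 e3 e4 k3 k4,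
    frame_rel s t (a0 x) (a1 x) (a2 x) (a3 x) (a4 x) (om^~ x)
      (fun i => extd (om i) x) f c1 c2 d1 d2 e3 e4 k3 k4 \/
    frame_rel s t (a0 x) (a3 x) (a4 x) (a1 x) (a2 x) (om^~ x)
      (fun i => extd (om i) x) f c1 c2 d1 d2 e3 e4 k3 k4.
Proof.
move=> Ux; have [D|D] := adapted_dichotomy F A Ux.
  have [f [c1 [c2 [d1 [d2 [e3 [e4 [k3 [k4 H]]]]]]]]] := adapted_frame_rel_split F A Ux D.
  by exists f, c1, c2, d1, d2, e3, e4, k3, k4; left.
have A' : adapted1 setT (mideal a0 a3 a4 a1 a2) U om by rewrite mideal_swap.
have [f [c1 [c2 [d1 [d2 [e3 [e4 [k3 [k4 H]]]]]]]]] := adapted_frame_rel_split (mf_swap F) A' Ux D.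
by exists f, c1, c2, d1, d2, e3, e4, k3, k4; right.
Qed.

(** * Invariants of a framed system *)

(** The matrix has determinant [f], so inverting it brings a second factor 1/f; the solution is kept
    free of division. *)
Lemma cramer2 (R : realType) (f p q a b c d x y : R) : a * d - b * c = f ->
  x = f * (p * a + q * c) -> y = f * (p * b + q * d) ->
  f ^+ 2 * p = x * d - y * c /\ f ^+ 2 * q = y * a - x * b.
Proof. by move=> <- -> ->; split; ring. Qed.

Lemma det2E (R : comPzRingType) (M : 'M[R]_2) : \det M = M 0 0 * M 1 1 - M 0 1 * M 1 0.
Proof.
rewrite (expand_det_row _ 0) !big_ord_recl big_ord0 addr0 /cofactor !det_mx11 !mxE /=.
rewrite /bump /= expr0 mul1r expr1 mulN1r mulrN.
by congr (M _ _ * M _ _ - M _ _ * M _ _); apply/val_inj.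
Qed.

(** The derivatives of om1, om2 determine the sums of S_1 and S_2 and those of om3, om4 their
    differences. Both give the same S_1, so S_2 = 0, and the determinant scales by the two
    transition determinants. *)
Lemma frame_rel_V (R : realType) (s t : R) (b0 b1 b2 b3 b4 : ext R 5) (u du : 'I_5 -> ext R 5)
    (f c1 c2 d1 d2 e3 e4 k3 k4 : R) (V : 'rV[R]_8) :
  forms1 [:: b0; b1; b2; b3; b4] -> b0 &^ b1 &^ b2 &^ b3 &^ b4 != 0 ->
  frame_rel s t b0 b1 b2 b3 b4 u du f c1 c2 d1 d2 e3 e4 k3 k4 ->
  (let w i j := wedge (u i) (u j) in
   [/\ eqmod [:: u 1; u 2%:R] (du 1)
          ((co V 1 + co V 5) *: w 0 3%:R + (co V 2 + co V 6) *: w 0 4%:R),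
        eqmod [:: u 1; u 2%:R] (du 2%:R)
          ((co V 3 + co V 7) *: w 0 3%:R + (co V 4 + co V 8) *: w 0 4%:R),
        eqmod [:: u 3%:R; u 4%:R] (du 3%:R)
          ((co V 8 - co V 4) *: w 0 1 + (co V 2 - co V 6) *: w 0 2%:R)
      & eqmod [:: u 3%:R; u 4%:R] (du 4%:R)
          ((co V 3 - co V 7) *: w 0 1 + (co V 5 - co V 1) *: w 0 2%:R)]) ->
  [/\ S2 V = 0, \det (S1 V) = - (s * t) / f ^+ 2 & f ^+ 2 * co V 2 = c1 * s * e3 - c2 * t * e4].
Proof.
move=> h v [f0 E0 [E1 E2 E3 E4] [cd ek] [D1 D2 D3 D4]] /= [].
move=> /eqmod2P[x1 [x2 M1]] /eqmod2P[y1 [y2 M2]] /eqmod2P[z1 [z2 M3]] /eqmod2P[w1 [w2 M4]].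
move: M1 M2 M3 M4 D1 D2 D3 D4; rewrite E0 E1 E2 E3 E4.
set v1 := co V 1; set v2 := co V 2; set v3 := co V 3; set v4 := co V 4.
set v5 := co V 5; set v6 := co V 6; set v7 := co V 7; set v8 := co V 8.
have hsw : forms1 [:: b0; b3; b4; b1; b2] by case: h => ? [? [? [? [? _]]]].
have vsw : b0 &^ b3 &^ b4 &^ b1 &^ b2 != 0.
  by rewrite (_ : _ &^ _ = b0 &^ b1 &^ b2 &^ b3 &^ b4) //; ext_ring h.
(* Wedging with p1 p2 removes the terms of the congruence; wedging further with p4 or p3 compares
   the components along b0 p3 and b0 p4. *)
have key (p1 p2 p3 p4 : ext R 5) (w z y y' : ext R 5) (p q c d c' d' e e' k k' i j : R) :
    forms1 [:: b0; p1; p2; p3; p4] -> b0 &^ p1 &^ p2 &^ p3 &^ p4 != 0 ->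
    w - (p *: ((f *: b0) &^ (e *: p3 + e' *: p4)) + q *: ((f *: b0) &^ (k *: p3 + k' *: p4))) =
      y &^ (c *: p1 + d *: p2) + y' &^ (c' *: p1 + d' *: p2) ->
    w &^ p1 &^ p2 = (i *: (b0 &^ p4) + j *: (b0 &^ p3)) &^ p1 &^ p2 ->
    j = f * (p * e + q * k) /\ i = f * (p * e' + q * k').
  move=> hp vp /eqP; rewrite subr_eq => /eqP -> {w}; rewrite !wedgeDl -!wedgeA.
  have -> : (c *: p1 + d *: p2) &^ p1 &^ p2 = 0 by ext_ring hp.
  have -> : (c' *: p1 + d' *: p2) &^ p1 &^ p2 = 0 by ext_ring hp.
  rewrite !wedge0r !add0r => E; split; apply/eqP; rewrite -subr_eq0; apply/eqP; apply: (scale_eq0_coef vp).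
    transitivity (((i *: (b0 &^ p4)) &^ p1 &^ p2 + (j *: (b0 &^ p3)) &^ p1 &^ p2) &^ p4 -
       ((p *: ((f *: b0) &^ (e *: p3 + e' *: p4))) &^ p1 &^ p2 + (q *: ((f *: b0) &^ (k *: p3 + k' *: p4))) &^ p1 &^ p2) &^ p4).
      by ext_ring hp.
    by rewrite E subrr.
  transitivity (- (((i *: (b0 &^ p4)) &^ p1 &^ p2 + (j *: (b0 &^ p3)) &^ p1 &^ p2) &^ p3 -
       ((p *: ((f *: b0) &^ (e *: p3 + e' *: p4))) &^ p1 &^ p2 + (q *: ((f *: b0) &^ (k *: p3 + k' *: p4))) &^ p1 &^ p2) &^ p3)).
    by ext_ring hp.
  by rewrite E subrr oppr0.
move=> M1 M2 M3 M4 D1 D2 D3 D4.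
have [A1 B1] := key _ _ _ _ _ 0 _ _ _ _ _ _ _ _ _ _ _ _ _ _ h v M1 D1.
have [A2 B2] := key _ _ _ _ _ 0 _ _ _ _ _ _ _ _ _ _ _ _ _ _ h v M2 D2.
have [A3 B3] := key _ _ _ _ _ 0 _ _ _ _ _ _ _ _ _ _ _ _ _ _ hsw vsw M3 D3.
have [A4 B4] := key _ _ _ _ _ 0 _ _ _ _ _ _ _ _ _ _ _ _ _ _ hsw vsw M4 D4.
have [P1 Q1] := cramer2 ek A1 B1.
have [P2 Q2] := cramer2 ek A2 B2.
have [P3 Q3] := cramer2 cd A3 B3.
have [P4 Q4] := cramer2 cd A4 B4.
have f20 : f ^+ 2 != 0 by rewrite expf_neq0.
have can z : f ^+ 2 * z = 0 -> z = 0 by move/eqP; rewrite mulf_eq0 (negbTE f20) => /eqP.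
(* d om1 gives V_1 + V_5 and d om4 gives V_5 - V_1, with opposite values; the other three pairs
   behave alike up to sign. *)
have e5 : v5 = 0.
  have : f ^+ 2 * (2%:R * v5) = 0.
    transitivity (f ^+ 2 * (v1 + v5) + f ^+ 2 * (v5 - v1)); first by ring.
    by rewrite P1 Q4; ring.
  by move/can => ?; lra.
have e6 : v6 = 0.
  have : f ^+ 2 * (2%:R * v6) = 0.
    transitivity (f ^+ 2 * (v2 + v6) - f ^+ 2 * (v2 - v6)); first by ring.
    by rewrite Q1 Q3; ring.
  by move/can => ?; lra.
have e7 : v7 = 0.
  have : f ^+ 2 * (2%:R * v7) = 0.
    transitivity (f ^+ 2 * (v3 + v7) - f ^+ 2 * (v3 - v7)); first by ring.
    by rewrite P2 P4; ring.
  by move/can => ?; lra.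
have e8 : v8 = 0.
  have : f ^+ 2 * (2%:R * v8) = 0.
    transitivity (f ^+ 2 * (v4 + v8) + f ^+ 2 * (v8 - v4)); first by ring.
    by rewrite Q2 P3; ring.
  by move/can => ?; lra.
move: P1 Q1 P2 Q2; rewrite e5 e6 e7 e8 !addr0 => P1 Q1 P2 Q2; split.
- apply/matrixP => i j; rewrite !mxE.
  by case: i j => [[|[|//]] ?] [[|[|//]] ?] /=; rewrite ?e5 ?e6 ?e7 ?e8.
- rewrite det2E !mxE /= -/v1 -/v2 -/v3 -/v4.
  (* After multiplication by f^4, the determinant factors through the two transition determinants,
     each equal to [f]. *)
  apply: (mulfI f20); apply: (mulfI f20); transitivity (f ^+ 2 * v1 * (f ^+ 2 * v4) - f ^+ 2 * v2 * (f ^+ 2 * v3)); first by ring.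
  rewrite P1 P2 Q1 Q2 [X in _ = _ * X]mulrC divfK //.
  transitivity (- (s * t) * ((c1 * d2 - c2 * d1) * (e3 * k4 - e4 * k3))); first by ring.
  by rewrite cd ek; ring.
- by rewrite Q1.
Qed.

Section EL.
Context {R : realType} (s t : R) (a0 a1 a2 a3 a4 : dform R 5).
Hypothesis F : mframe s t a0 a1 a2 a3 a4.
Local Notation I := (mideal a0 a1 a2 a3 a4).

Lemma mframe_V x u V : V_at setT I x u V ->
  S2 V = 0 /\ exists2 f, f != 0 & \det (S1 V) = - (s * t) / f ^+ 2.
Proof.
move=> [U [om [A Ux omu Veq]]].
have Veq' := Veq; rewrite -(funext omu) in Veq'.
have [f [c1 [c2 [d1 [d2 [e3 [e4 [k3 [k4 [H|H]]]]]]]]]] := adapted_frame_rel F A Ux.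
  have [? ? _] := frame_rel_V (mf_forms1 F x) (mf_vol F x) H Veq'.
  by split=> //; exists f => //; case: H.
have [? ? _] := frame_rel_V (mf_forms1 (mf_swap F) x) (mf_vol (mf_swap F) x) H Veq'.
by split=> //; exists f => //; case: H.
Qed.

Lemma mframe_EL : hyperbolic_EL setT I.
Proof.
by split; [exact: mframe_hyperbolic_MA F | move=> x u V _ _ /mframe_V[]].
Qed.

Lemma mframe_degenerate : t = 0 -> degenerate_EL setT I.
Proof.
move=> t0; split; first exact: mframe_EL.
by move=> x u V _ _ /mframe_V[_ [f _ ->]]; rewrite t0 mulr0 oppr0 mul0r.
Qed.

Lemma mframe_positive : s * t < 0 -> positive_EL setT I.
Proof.
move=> st; split; first exact: mframe_EL.
move=> x u V _ _ /mframe_V[_ [f f0 ->]]; rewrite divr_gt0 ?oppr_gt0 //.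
by rewrite exprn_even_gt0.
Qed.

Lemma mframe_negative : 0 < s * t -> negative_EL setT I.
Proof.
move=> st; split; first exact: mframe_EL.
move=> x u V _ _ /mframe_V[_ [f f0 ->]]; rewrite mulNr oppr_lt0 divr_gt0 //.
by rewrite exprn_even_gt0.
Qed.
End EL.

(** * Liftings *)

Section Pull.
Context {R : realType} {n m : nat} (J : 'M[R]_(n, m)).
Implicit Types v w : ext R m.

Lemma pullD v w : pull J (v + w) = pull J v + pull J w.
Proof. by rewrite /pull -big_split; apply: eq_bigr => I _; rewrite ffunE scalerDl. Qed.
Lemma pullZ c v : pull J (c *: v) = c *: pull J v.
Proof. by rewrite /pull scaler_sumr; apply: eq_bigr => I _; rewrite ffunE scalerA. Qed.
Lemma pull0 : pull J 0 = 0.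
Proof. by rewrite /pull big1 // => I _; rewrite ffunE scale0r. Qed.
Lemma pullN v : pull J (- v) = - pull J v.
Proof. by rewrite -scaleN1r pullZ scaleN1r. Qed.
Lemma pull_sum (T : Type) (r : seq T) (f : T -> ext R m) :
  pull J (\sum_(i <- r) f i) = \sum_(i <- r) pull J (f i).
Proof. by apply: (big_morph (pull J)); [exact: pullD | exact: pull0]. Qed.

Lemma pull_ebase (I : {set 'I_m}) :
  pull J (ebase I) = wedges [seq \sum_(i < n) J i j *: dx i | j <- enum I].
Proof.
rewrite /pull (bigD1 I) //= big1 ?addr0 => [|K KI]; first by rewrite ffunE eqxx scale1r.
by rewrite ffunE (negbTE KI) scale0r.
Qed.

Lemma pull_dx j : pull J (dx j) = \sum_(i < n) J i j *: dx i.
Proof. by rewrite dx_ebase pull_ebase finset.enum_set1 /= wedge1r. Qed.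

Lemma homog_pull_dx j : homog 1 (pull J (dx j)).
Proof.
rewrite pull_dx; apply: (big_ind (homog 1)); first exact: homog0.
  by move=> x y; exact: homogD.
by move=> i _; apply: homogZ; exact: homog_dx.
Qed.

Lemma homog_pull v : homog 1 v -> homog 1 (pull J v).
Proof.
move=> /homog1E ->; rewrite pull_sum; apply: (big_ind (homog 1)); first exact: homog0.
  by move=> x y; exact: homogD.
by move=> i _; rewrite pullZ; apply: homogZ; exact: homog_pull_dx.
Qed.

(** [pull] multiplies the images of the dx_j in the order of [enum]; that this order is increasing
    fixes the sign. *)
Lemma enum_set2_lt (i j : 'I_m) : (i < j)%N -> enum [set i; j]%SET = [:: i; j].
Proof.
move=> ij; apply: (@irr_sorted_eq _ (fun i j : 'I_m => (i < j)%N)).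
- by move=> a b c; exact: ltn_trans.
- by move=> a; exact: ltnn.
- rewrite /enum_mem -enumT; apply: sorted_filter; first by move=> a b c; exact: ltn_trans.
  rewrite -(@sorted_map _ _ val ltn) val_enum_ord; exact: iota_ltn_sorted.
- by rewrite /= ij.
- by move=> k; rewrite mem_enum !inE.
Qed.

Lemma pull_dx2 i j : pull J (dx i &^ dx j) = pull J (dx i) &^ pull J (dx j).
Proof.
have lt (a b : 'I_m) : (a < b)%N -> pull J (dx a &^ dx b) = pull J (dx a) &^ pull J (dx b).
  move=> ab; rewrite [in LHS]dx_ebase [in LHS]dx_ebase ebase_wedge ifT; last first.
    by rewrite finset.disjoints1 finset.inE; apply/eqP => E; rewrite E ltnn in ab.
  rewrite pullZ pull_ebase enum_set2_lt //= wedge1r !pull_dx.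
  have -> : inversions [set a]%SET [set b]%SET = 0%N; last by rewrite scale1r.
  apply/eqP; rewrite finset.cards_eq0; apply/eqP/finset.setP => -[c d]; rewrite !finset.inE /=.
  by case: eqP => //= ->; case: eqP => //= ->; rewrite ltnNge ltnW.
case: (ltngtP i j) => [/lt //|ji|/val_inj ->].
  rewrite form1C; [|exact: homog_dx|exact: homog_dx].
  by rewrite pullN lt // -form1C //; exact: homog_pull_dx.
rewrite !form1_sq ?pull0 //; [exact: homog_pull_dx|exact: homog_dx].
Qed.

(** Every 2-form to be pulled back is a sum of products of two 1-forms, so multiplicativity in this
    degree is enough. *)
Lemma pull_wedge v w : homog 1 v -> homog 1 w -> pull J (v &^ w) = pull J v &^ pull J w.
Proof.
move=> /homog1E -> /homog1E ->; rewrite wedge_suml !pull_sum wedge_suml.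
apply: eq_bigr => i _; rewrite [in LHS]wedge_sumr pull_sum [in RHS]wedge_sumr; apply: eq_bigr => j _.
by rewrite wedgeZl wedgeZr !pullZ wedgeZl wedgeZr pull_dx2.
Qed.
End Pull.

Lemma same_span_mod_swap (R : realType) n (G : seq (ext R n)) w1 w2 z1 z2 :
  eqmod G w1 z2 -> eqmod G w2 z1 -> same_span_mod G w1 w2 z1 z2.
Proof.
move=> [a Ea] [b Eb] w.
have lin c d (p q : 'I_(size G) -> ext R n) :
   \sum_(i < size G) (c *: p i + d *: q i) &^ G`_i =
   c *: (\sum_(i < size G) p i &^ G`_i) + d *: (\sum_(i < size G) q i &^ G`_i).
  rewrite !scaler_sumr -big_split; apply: eq_bigr => i _ /=.
  by rewrite wedgeDl !wedgeZl.
split=> -[c [d [e Ee]]]; exists d, c.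
  exists (fun i => 1 *: e i + 1 *: (c *: a i + d *: b i)); rewrite lin lin -Ea -Eb -Ee.
  apply/ffunP => K; rewrite !ffunE.
  move: (w K : R) (w1 K : R) (w2 K : R) (z1 K : R) (z2 K : R) => *; rewrite /GRing.scale /=; ring.
exists (fun i => 1 *: e i - 1 *: (d *: a i + c *: b i)).
under eq_bigr do rewrite -scaleNr.
rewrite lin lin -Ea -Eb -Ee.
apply/ffunP => K; rewrite !ffunE.
move: (w K : R) (w1 K : R) (w2 K : R) (z1 K : R) (z2 K : R) => *; rewrite /GRing.scale /=; ring.
Qed.

(** What survives of [frame_rel] under pullback to the 6-manifold; the derivatives are dropped. *)
Definition frame_comb (R : realType) n (P0 P1 P2 P3 P4 : ext R n) (u : 'I_5 -> ext R n)
    (f c1 c2 d1 d2 e3 e4 k3 k4 : R) : Prop :=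
  [/\ f != 0, u 0 = f *: P0,
    [/\ u 1 = c1 *: P1 + c2 *: P2, u 2%:R = d1 *: P1 + d2 *: P2,
        u 3%:R = e3 *: P3 + e4 *: P4 & u 4%:R = k3 *: P3 + k4 *: P4],
    c1 * d2 - c2 * d1 = f & e3 * k4 - e4 * k3 = f].

Lemma frame_rel_pull (R : realType) n (J : 'M[R]_(n, 5)) s t (b0 b1 b2 b3 b4 : ext R 5) u du
    f c1 c2 d1 d2 e3 e4 k3 k4 :
  frame_rel s t b0 b1 b2 b3 b4 u du f c1 c2 d1 d2 e3 e4 k3 k4 ->
  frame_comb (pull J b0) (pull J b1) (pull J b2) (pull J b3) (pull J b4) (fun i => pull J (u i))
    f c1 c2 d1 d2 e3 e4 k3 k4.
Proof.
move=> [f0 E0 [E1 E2 E3 E4] [cd ek] _]; split=> //; first by rewrite E0 pullZ.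
by rewrite E1 E2 E3 E4 !pullD !pullZ.
Qed.

Section CombPull.
Context {R : realType} (s t : R) (a0 a1 a2 a3 a4 : dform R 5).
Hypothesis F : mframe s t a0 a1 a2 a3 a4.
Local Notation I := (mideal a0 a1 a2 a3 a4).
Context {n : nat} (J : 'M[R]_(n, 5)).

Variables (x : 'rV[R]_5) (P0 P1 P2 P3 P4 : ext R n).
Hypotheses (E0 : pull J (a0 x) = P0) (E1 : pull J (a1 x) = P1) (E2 : pull J (a2 x) = P2)
  (E3 : pull J (a3 x) = P3) (E4 : pull J (a4 x) = P4).

(** The pulled-back reference frame is given only up to equality, so that the frame of the second
    system can be expressed through that of the first. *)
Lemma G1_comb u : G1 setT I x u -> exists f c1 c2 d1 d2 e3 e4 k3 k4,
  frame_comb P0 P1 P2 P3 P4 (fun i => pull J (u i)) f c1 c2 d1 d2 e3 e4 k3 k4 \/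
  frame_comb P0 P3 P4 P1 P2 (fun i => pull J (u i)) f c1 c2 d1 d2 e3 e4 k3 k4.
Proof.
move=> [U [om [A Ux omu]]]; rewrite -(funext omu) -E0 -E1 -E2 -E3 -E4.
have [f [c1 [c2 [d1 [d2 [e3 [e4 [k3 [k4 H]]]]]]]]] := adapted_frame_rel F A Ux.
exists f, c1, c2, d1, d2, e3, e4, k3, k4.
by case: H => /(frame_rel_pull J); [left | right].
Qed.

(** The coefficients in the formula for V_2 must be those of the frame entering the lifting
    relations, so both come from one coframing. *)
Lemma V_at_comb u V : V_at setT I x u V -> exists f c1 c2 d1 d2 e3 e4 k3 k4,
  (frame_comb P0 P1 P2 P3 P4 (fun i => pull J (u i)) f c1 c2 d1 d2 e3 e4 k3 k4 \/
   frame_comb P0 P3 P4 P1 P2 (fun i => pull J (u i)) f c1 c2 d1 d2 e3 e4 k3 k4) /\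
  f ^+ 2 * co V 2 = c1 * s * e3 - c2 * t * e4.
Proof.
move=> [U [om [A Ux omu Veq]]]; have Veq' := Veq; rewrite -(funext omu) in Veq' *.
rewrite -E0 -E1 -E2 -E3 -E4.
have [f [c1 [c2 [d1 [d2 [e3 [e4 [k3 [k4 [H|H]]]]]]]]]] := adapted_frame_rel F A Ux;
  exists f, c1, c2, d1, d2, e3, e4, k3, k4.
  have [_ _ ?] := frame_rel_V (mf_forms1 F x) (mf_vol F x) H Veq'.
  by split=> //; left; exact: frame_rel_pull H.
have [_ _ ?] := frame_rel_V (mf_forms1 (mf_swap F) x) (mf_vol (mf_swap F) x) H Veq'.
by split=> //; right; exact: frame_rel_pull H.
Qed.
End CombPull.

Section LiftAlgebra.
Context {R : realType} {n : nat}.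
Variables (A0 A1 A2 A3 A4 B0 : ext R n).
Hypothesis h : forms1 [:: A0; A1; A2; A3; A4; B0].
Hypothesis vol0 : A1 &^ A2 &^ A3 &^ A4 &^ A0 &^ B0 != 0.
Local Notation B2 := (A2 + A0 + B0).
Local Notation B4 := (- A4 + A0 - B0).

Lemma free6 c1 c2 c3 c4 c0 cb :
  c1 *: A1 + c2 *: A2 + c3 *: A3 + c4 *: A4 + c0 *: A0 + cb *: B0 = 0 ->
  [/\ c1 = 0, c2 = 0, c3 = 0 & c4 = 0] /\ c0 = 0 /\ cb = 0.
Proof.
move=> E.
have H y : (c1 *: A1 + c2 *: A2 + c3 *: A3 + c4 *: A4 + c0 *: A0 + cb *: B0) &^ y = 0.
  by rewrite E wedge0l.
do !split; apply: (scale_eq0_coef vol0).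
- by rewrite -(H (A2 &^ A3 &^ A4 &^ A0 &^ B0)); ext_ring h.
- by rewrite -oppr0 -(H (A1 &^ A3 &^ A4 &^ A0 &^ B0)); ext_ring h.
- by rewrite -(H (A1 &^ A2 &^ A4 &^ A0 &^ B0)); ext_ring h.
- by rewrite -oppr0 -(H (A1 &^ A2 &^ A3 &^ A0 &^ B0)); ext_ring h.
- by rewrite -(H (A1 &^ A2 &^ A3 &^ A4 &^ B0)); ext_ring h.
- by rewrite -oppr0 -(H (A1 &^ A2 &^ A3 &^ A4 &^ A0)); ext_ring h.
Qed.

(** Excludes liftings that pair a characteristic system of one side with the opposite one of the
    other. *)
Lemma free_planes x y : x *: (A1 &^ A2 &^ A0 &^ B0) = y *: (A3 &^ A4 &^ A0 &^ B0) -> x = 0 /\ y = 0.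
Proof.
move=> E; split; apply: (scale_eq0_coef vol0).
  transitivity ((x *: (A1 &^ A2 &^ A0 &^ B0)) &^ A3 &^ A4); first by ext_ring h.
  by rewrite E; ext_ring h.
transitivity ((y *: (A3 &^ A4 &^ A0 &^ B0)) &^ A1 &^ A2); first by ext_ring h.
by rewrite -E; ext_ring h.
Qed.

Lemma plane12_neq0 : A1 &^ A2 &^ A0 &^ B0 != 0.
Proof.
apply: contraNneq vol0 => E; apply/eqP.
transitivity ((A1 &^ A2 &^ A0 &^ B0) &^ A3 &^ A4); first by ext_ring h.
by rewrite E wedge0l.
Qed.
Lemma plane34_neq0 : A3 &^ A4 &^ A0 &^ B0 != 0.
Proof.
apply: contraNneq vol0 => E; apply/eqP.
transitivity ((A3 &^ A4 &^ A0 &^ B0) &^ A1 &^ A2); first by ext_ring h.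
by rewrite E wedge0l.
Qed.

Variables (al be : 'I_5 -> ext R n) (f c1 c2 d1 d2 e3 e4 k3 k4 : R).
Variables (f' c1' c2' d1' d2' e3' e4' k3' k4' : R).
Variables (s1 s2 s3 s4 t1 t2 t3 t4 mu1 mu2 mu3 mu4 : R).
Hypothesis hal : forall i, homog 1 (al i).
Hypothesis R1 : be 1 = s1 *: al 0 + t1 *: be 0 + mu1 *: al 1.
Hypothesis R2 : be 2%:R = s2 *: al 0 + t2 *: be 0 + mu2 *: al 2%:R.
Hypothesis R3 : be 3%:R = s3 *: al 0 + t3 *: be 0 + mu3 *: al 3%:R.
Hypothesis R4 : be 4%:R = s4 *: al 0 + t4 *: be 0 + mu4 *: al 4%:R.
Hypothesis al0 : al 0 = f *: A0.
Hypothesis be0 : be 0 = f' *: B0.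

(* The components of the relations along [A0] and [B0] are killed by [A0 /\ B0]. *)
Lemma lift_planes :
  be 1 &^ be 2%:R &^ A0 &^ B0 = (mu1 * mu2) *: (al 1 &^ al 2%:R &^ A0 &^ B0) /\
  be 3%:R &^ be 4%:R &^ A0 &^ B0 = (mu3 * mu4) *: (al 3%:R &^ al 4%:R &^ A0 &^ B0).
Proof.
have hh : forms1 [:: A0; B0; al 1; al 2%:R; al 3%:R; al 4%:R].
  by have [? [_ [_ [_ [_ [? _]]]]]] := h; do !split.
by split; rewrite ?R1 ?R2 ?R3 ?R4 al0 be0; ext_ring hh.
Qed.
End LiftAlgebra.

(* Comparing the [A1 /\ A2] and [A3 /\ A4] components of both sides gives
   f' = mu1 mu2 f and - f' = mu3 mu4 f; a lifting pairing different characteristic systems is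
   impossible. For mu1 = mu2 = mu, mu3 = 1/mu, mu4 = eps/mu this reads mu^4 = - eps. *)
Lemma lift_mu (R : realType) n (A0 A1 A2 A3 A4 B0 : ext R n) (al be : 'I_5 -> ext R n)
    f c1 c2 d1 d2 e3 e4 k3 k4 f' c1' c2' d1' d2' e3' e4' k3' k4'
    s1 s2 s3 s4 t1 t2 t3 t4 mu1 mu2 mu3 mu4 :
  let B2 := A2 + A0 + B0 in let B4 := - A4 + A0 - B0 in
  forms1 [:: A0; A1; A2; A3; A4; B0] ->
  A1 &^ A2 &^ A3 &^ A4 &^ A0 &^ B0 != 0 ->
  (forall i, homog 1 (al i)) ->
  be 1 = s1 *: al 0 + t1 *: be 0 + mu1 *: al 1 ->
  be 2%:R = s2 *: al 0 + t2 *: be 0 + mu2 *: al 2%:R ->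
  be 3%:R = s3 *: al 0 + t3 *: be 0 + mu3 *: al 3%:R ->
  be 4%:R = s4 *: al 0 + t4 *: be 0 + mu4 *: al 4%:R ->
  frame_comb A0 A1 A2 A3 A4 al f c1 c2 d1 d2 e3 e4 k3 k4 \/
  frame_comb A0 A3 A4 A1 A2 al f c1 c2 d1 d2 e3 e4 k3 k4 ->
  frame_comb B0 A1 B2 A3 B4 be f' c1' c2' d1' d2' e3' e4' k3' k4' \/
  frame_comb B0 A3 B4 A1 B2 be f' c1' c2' d1' d2' e3' e4' k3' k4' ->
  mu1 * mu2 = - (mu3 * mu4) /\
  ((frame_comb A0 A1 A2 A3 A4 al f c1 c2 d1 d2 e3 e4 k3 k4 /\
    frame_comb B0 A1 B2 A3 B4 be f' c1' c2' d1' d2' e3' e4' k3' k4') \/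
   (frame_comb A0 A3 A4 A1 A2 al f c1 c2 d1 d2 e3 e4 k3 k4 /\
    frame_comb B0 A3 B4 A1 B2 be f' c1' c2' d1' d2' e3' e4' k3' k4')).
Proof.
move=> B2 B4 h v hal R1 R2 R3 R4 HA HB.
have al0 : al 0 = f *: A0 by case: HA => -[].
have be0 : be 0 = f' *: B0 by case: HB => -[].
have f0 : f != 0 by case: HA => -[].
have f'0 : f' != 0 by case: HB => -[].
have [L12 L34] := lift_planes h hal R1 R2 R3 R4 al0 be0.
have N12 := plane12_neq0 h v; have N34 := plane34_neq0 h v.
set X12 := A1 &^ A2 &^ A0 &^ B0 in N12; set X34 := A3 &^ A4 &^ A0 &^ B0 in N34.
have inj x y (X : ext R n) : X != 0 -> x *: X = y *: X -> x = y.
  move=> X0 /eqP; rewrite -subr_eq0 -scalerBl => /eqP/(scale_eq0_coef X0) /eqP.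
  by rewrite subr_eq0 => /eqP.
have alU : frame_comb A0 A1 A2 A3 A4 al f c1 c2 d1 d2 e3 e4 k3 k4 ->
   al 1 &^ al 2%:R &^ A0 &^ B0 = f *: X12 /\ al 3%:R &^ al 4%:R &^ A0 &^ B0 = f *: X34.
  by move=> [_ _ [-> -> -> ->] cd ek]; split; [rewrite -cd|rewrite -ek]; rewrite /X12 /X34; ext_ring h.
have alS : frame_comb A0 A3 A4 A1 A2 al f c1 c2 d1 d2 e3 e4 k3 k4 ->
   al 1 &^ al 2%:R &^ A0 &^ B0 = f *: X34 /\ al 3%:R &^ al 4%:R &^ A0 &^ B0 = f *: X12.
  by move=> [_ _ [-> -> -> ->] cd ek]; split; [rewrite -cd|rewrite -ek]; rewrite /X12 /X34; ext_ring h.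
have beU : frame_comb B0 A1 B2 A3 B4 be f' c1' c2' d1' d2' e3' e4' k3' k4' ->
   be 1 &^ be 2%:R &^ A0 &^ B0 = f' *: X12 /\ be 3%:R &^ be 4%:R &^ A0 &^ B0 = (- f') *: X34.
  by move=> [_ _ [-> -> -> ->] cd ek]; split; [rewrite -cd|rewrite -ek]; rewrite /X12 /X34 /B2 /B4; ext_ring h.
have beS : frame_comb B0 A3 B4 A1 B2 be f' c1' c2' d1' d2' e3' e4' k3' k4' ->
   be 1 &^ be 2%:R &^ A0 &^ B0 = (- f') *: X34 /\ be 3%:R &^ be 4%:R &^ A0 &^ B0 = f' *: X12.
  by move=> [_ _ [-> -> -> ->] cd ek]; split; [rewrite -cd|rewrite -ek]; rewrite /X12 /X34 /B2 /B4; ext_ring h.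
case: HA => HA; case: HB => HB.
- have [a1 a2] := alU HA; have [b1 b2] := beU HB.
  rewrite a1 b1 scalerA in L12; rewrite a2 b2 scalerA in L34.
  have E1 := inj _ _ _ N12 L12; have E2 := inj _ _ _ N34 L34.
  by split; [apply: (mulIf f0); rewrite -E1 mulNr -E2 opprK | left].
- have [a1 a2] := alU HA; have [b1 b2] := beS HB.
  rewrite a2 b2 scalerA in L34.
  by have [/eqP] := free_planes h v L34; rewrite (negbTE f'0).
- have [a1 a2] := alS HA; have [b1 b2] := beU HB.
  rewrite a1 b1 scalerA in L12.
  by have [/eqP] := free_planes h v L12; rewrite (negbTE f'0).
- have [a1 a2] := alS HA; have [b1 b2] := beS HB.
  rewrite a1 b1 scalerA in L12; rewrite a2 b2 scalerA in L34.
  have E1 := inj _ _ _ N34 L12; have E2 := inj _ _ _ N12 L34.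
  by split; [apply: (mulIf f0); rewrite -E1 mulNr -E2 | right].
Qed.

(** al 1 has no A0 or B0 component, while B2 and B4 do: equating be 1 with al 1 kills first the
    primed coefficient c2', then c2, and likewise e4. The determinants, equal to [f], then keep c1
    and e3 away from 0. *)
Lemma lift_lower (R : realType) n (A0 A1 A2 A3 A4 B0 : ext R n) (al be : 'I_5 -> ext R n)
    f c1 c2 d1 d2 e3 e4 k3 k4 f' c1' c2' d1' d2' e3' e4' k3' k4' :
  let B2 := A2 + A0 + B0 in let B4 := - A4 + A0 - B0 in
  forms1 [:: A0; A1; A2; A3; A4; B0] ->
  A1 &^ A2 &^ A3 &^ A4 &^ A0 &^ B0 != 0 ->
  be 1 = al 1 -> be 3%:R = al 3%:R ->
  ((frame_comb A0 A1 A2 A3 A4 al f c1 c2 d1 d2 e3 e4 k3 k4 /\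
    frame_comb B0 A1 B2 A3 B4 be f' c1' c2' d1' d2' e3' e4' k3' k4') \/
   (frame_comb A0 A3 A4 A1 A2 al f c1 c2 d1 d2 e3 e4 k3 k4 /\
    frame_comb B0 A3 B4 A1 B2 be f' c1' c2' d1' d2' e3' e4' k3' k4')) ->
  [/\ c2 = 0, e4 = 0, c1 != 0 & e3 != 0].
Proof.
move=> B2 B4 h v R1 R3 H.
have [c20 e40 f0] : [/\ c2 = 0, e4 = 0 & f != 0].
  case: H => -[[f0 _ [E1 _ E3 _] _ _] [_ _ [F1 _ F3 _] _ _]]; move: R1 R3; rewrite E1 E3 F1 F3 /B2 /B4 => /eqP; rewrite -subr_eq0 => /eqP R1 /eqP; rewrite -subr_eq0 => /eqP R3.
    have : (c1' - c1) *: A1 + (c2' - c2) *: A2 + 0 *: A3 + 0 *: A4 + c2' *: A0 + c2' *: B0 = 0.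
      by rewrite -[RHS]R1; ext_ring h.
    case/(free6 h v) => -[_ c22 _ _] [c20 _].
    have : 0 *: A1 + 0 *: A2 + (e3' - e3) *: A3 + (- e4' - e4) *: A4 + e4' *: A0 + (- e4') *: B0 = 0.
      by rewrite -[RHS]R3; ext_ring h.
    case/(free6 h v) => -[_ _ _ e44] [e40 _].
    by split=> //; [move: c22 | move: e44]; rewrite ?c20 ?e40 ?sub0r ?oppr0 ?sub0r => /eqP; rewrite oppr_eq0 => /eqP.
  have : 0 *: A1 + 0 *: A2 + (c1' - c1) *: A3 + (- c2' - c2) *: A4 + c2' *: A0 + (- c2') *: B0 = 0.
    by rewrite -[RHS]R1; ext_ring h.
  case/(free6 h v) => -[_ _ _ c22] [c20 _].
  have : (e3' - e3) *: A1 + (e4' - e4) *: A2 + 0 *: A3 + 0 *: A4 + e4' *: A0 + e4' *: B0 = 0.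
    by rewrite -[RHS]R3; ext_ring h.
  case/(free6 h v) => -[_ e44 _ _] [e40 _].
  by split=> //; [move: c22 | move: e44]; rewrite ?c20 ?e40 ?sub0r ?oppr0 ?sub0r => /eqP; rewrite oppr_eq0 => /eqP.
have [cd ek] : c1 * d2 - c2 * d1 = f /\ e3 * k4 - e4 * k3 = f by case: H => -[[]].
split=> //; first by apply: contraNneq f0 => c10; rewrite -cd c10 c20 !mul0r subr0.
by apply: contraNneq f0 => e30; rewrite -ek e30 e40 !mul0r subr0.
Qed.

Definition row4 (R : realType) (x1 x2 x3 x4 : R) : 'rV[R]_4 :=
  \row_j nth 0 [:: x1; x2; x3; x4] j.

Lemma co_row4 (R : realType) (x1 x2 x3 x4 : R) :
  [/\ co (row4 x1 x2 x3 x4) 1 = x1, co (row4 x1 x2 x3 x4) 2 = x2,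
      co (row4 x1 x2 x3 x4) 3 = x3 & co (row4 x1 x2 x3 x4) 4 = x4].
Proof. by split; rewrite /co mxE inordK. Qed.

(** This and the next two lemmas bring the shape s a0 + t b0 + mu a of the lifting relations to the
    shape of the frame relations, for the values of s and t in use. *)
Lemma lin_third (R : realType) n (u v w : ext R n) (c : R) : 0 *: u + 0 *: v + c *: w = c *: w.
Proof. by rewrite !scale0r !add0r. Qed.
Lemma lin_plus (R : realType) n (u v w : ext R n) : 1 *: u + 1 *: v + 1 *: w = w + u + v.
Proof. by rewrite !scale1r -[RHS]addrA [RHS]addrC. Qed.
Lemma lin_minus (R : realType) n (u v w : ext R n) : 1 *: u + (-1) *: v + (-1) *: w = - w + u - v.
Proof. by rewrite scale1r !scaleN1r -[RHS]addrA [RHS]addrC. Qed.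

Lemma wedges6 (R : realType) n (u1 u2 u3 u4 u5 u6 : ext R n) :
  wedges [:: u1; u2; u3; u4; u5; u6] = u1 &^ u2 &^ u3 &^ u4 &^ u5 &^ u6.
Proof. by rewrite /wedges /= wedge1r. Qed.

(** * Type III transformations from two related framings *)

Section TypeIII.
Context {R : realType} (s t : R).
Variables (a0 a1 a2 a3 a4 b0 b1 b2 b3 b4 : dform R 5).
Hypotheses (F : mframe s 0 a0 a1 a2 a3 a4) (G : mframe s t b0 b1 b2 b3 b4).
Hypothesis s0 : s != 0.
Variable phi : 'rV[R]_6 -> 'rV[R]_5 * 'rV[R]_5.
Local Notation I := (mideal a0 a1 a2 a3 a4).
Local Notation Ib := (mideal b0 b1 b2 b3 b4).
Local Notation L p w := (pl phi p (w (prl phi p))).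
Local Notation P p w := (pr phi p (w (prr phi p))).
Local Notation NT := (setT : set 'rV[R]_6).

Hypothesis rel1 : forall p, P p b1 = L p a1.
Hypothesis rel2 : forall p, P p b2 = L p a2 + L p a0 + P p b0.
Hypothesis rel3 : forall p, P p b3 = L p a3.
Hypothesis rel4 : forall p, P p b4 = - L p a4 + L p a0 - P p b0.
Hypothesis vol6 : forall p, L p a1 &^ L p a2 &^ L p a3 &^ L p a4 &^ L p a0 &^ P p b0 != 0.

Hypothesis smooth_prlr : smooth_map NT (prl phi) /\ smooth_map NT (prr phi).
Hypothesis phi_inj : injective phi.
Hypothesis phi_homeo : forall p A, nbhs p A ->
    exists2 B, nbhs (phi p) B & forall q, B (phi q) -> A q.
Hypothesis phi_subl : forall p v, exists h, 'd (prl phi) p h = v.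
Hypothesis phi_subr : forall p v, exists h, 'd (prr phi) p h = v.
Hypothesis phi_ker : forall p h, 'd (prl phi) p h = 0 -> 'd (prr phi) p h = 0 -> h = 0.
Hypothesis smooth_a : forall i, smooth_ext NT (fun p => fr5 a0 a1 a2 a3 a4 i (prl phi p)).
Hypothesis smooth_b : forall i, smooth_ext NT (fun p => fr5 b0 b1 b2 b3 b4 i (prr phi p)).

Variables S T : 'rV[R]_4.
Hypothesis coS : [/\ co S 1 = 0, co S 2 = 1, co S 3 = 0 & co S 4 = 1].
Hypothesis coT : [/\ co T 1 = 0, co T 2 = 1, co T 3 = 0 & co T 4 = -1].

Lemma forms6 p : forms1 [:: L p a0; L p a1; L p a2; L p a3; L p a4; P p b0].
Proof.
have [? [? [? [? [? _]]]]] := mf_forms1 F (prl phi p).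
have [? _] := mf_forms1 G (prr phi p).
by do 6?[apply: conj; first exact: homog_pull].
Qed.

Lemma frames_backlund : backlund setT I setT Ib setT phi.
Proof.
constructor.
- exact: openT.
- by exists 0.
- by [].
- exact: smooth_prlr.
- by move=> p q _ _; exact: phi_inj.
- move=> p A _ /phi_homeo[B Bp BA]; exists B => // q _; exact: BA.
- by move=> p _; exact: phi_subl.
- by move=> p _; exact: phi_subr.
- by move=> p _; exact: phi_ker.
move=> p _.
exists (setT : set 'rV[R]_5), a0, (fun x => a1 x &^ a2 x - a3 x &^ a4 x).
exists (setT : set 'rV[R]_5), b0, (fun x => b1 x &^ b2 x - b3 x &^ b4 x).
split; [by []|by []|exact: (mframe_local_generators F)|exact: (mframe_local_generators G)|].
move=> q _ _ _; have h := forms6 q.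
have r1 := rel1 q; have r2 := rel2 q; have r3 := rel3 q; have r4 := rel4 q.
(* The Jacobians are made opaque, so that the pulled-back covectors can serve as atoms for
   [ext_ring]. *)
rewrite /pl /pr in h r1 r2 r3 r4 *; set JL := 'J _ _ in h r1 r2 r3 r4 *.
set JR := 'J _ _ in h r1 r2 r3 r4 *.
clearbody JL JR.
have [m [[_ hm] d0]] := mf_d0 F; have [mb [[_ hmb] db0]] := mf_d0 G.
have [h0 [h1 [h2 [h3 [h4 _]]]]] := mf_forms1 F (prl phi q).
have [k0 [k1 [k2 [k3 [k4 _]]]]] := mf_forms1 G (prr phi q).
have Hm : homog 1 (m (prl phi q)) by exact: hm.
have Hmb : homog 1 (mb (prr phi q)) by exact: hmb.
rewrite d0 db0 !pullD !pullN !pull_wedge // r1 r2 r3 r4.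
have hh : forms1 [:: pull JL (m (prl phi q)); pull JR (mb (prr phi q));
    pull JL (a0 (prl phi q)); pull JL (a1 (prl phi q)); pull JL (a2 (prl phi q));
    pull JL (a3 (prl phi q)); pull JL (a4 (prl phi q)); pull JR (b0 (prr phi q))].
  by apply: conj; [exact: homog_pull|apply: conj; [exact: homog_pull|exact: h]].
(* The multipliers come from expanding b1 b2 and b3 b4 with the relations for b2 and b4; what is
   left modulo a0 and b0 is a1 a2 and - a3 a4. *)
apply: same_span_mod_swap; apply/eqmod2P.
  exists (pull JL (m (prl phi q)) - pull JL (a1 (prl phi q)) + pull JL (a3 (prl phi q))),
    (- pull JL (a1 (prl phi q)) - pull JL (a3 (prl phi q))).
  by ext_ring hh.
exists (pull JL (a1 (prl phi q)) + pull JL (a3 (prl phi q))),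
  (pull JR (mb (prr phi q)) + pull JL (a1 (prl phi q)) - pull JL (a3 (prl phi q))).
by ext_ring hh.
Qed.

Definition frames_lift (p : 'rV[R]_6) : @lift_point R :=
  LiftPoint (prl phi p) (fr5 (a0 (prl phi p)) (a1 (prl phi p)) (a2 (prl phi p)) (a3 (prl phi p)) (a4 (prl phi p)))
    (prr phi p) (fr5 (b0 (prr phi p)) (b1 (prr phi p)) (b2 (prr phi p)) (b3 (prr phi p)) (b4 (prr phi p)))
    S T 1 (-1).

Lemma frames_lifting1 : lifting1 setT I setT Ib setT phi setT frames_lift.
Proof.
have [s1 s2 s3 s4] := coS; have [t1 t2 t3 t4] := coT.
split; last first.
  by move=> p _ /=; rewrite s1 t1 s2 t2 s3 t3 s4 t4 expr1n; split; rewrite ?mulr1 ?opprK ?mul1r.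
split => //; first exact: openT.
  have sc m (v : 'rV[R]_m) : smooth_map NT (fun=> v) by move=> j; apply: smooth_cst; exact: openT.
  split; [exact: smooth_prlr| |by split; exact: sc| |]; last 2 first.
  - by apply: smooth_cst; exact: openT.
  - by apply: smooth_cst; exact: openT.
  by move=> i; split; [have := smooth_a i | have := smooth_b i]; case: i => [[|[|[|[|[|//]]]]] Hi].
move=> p _; cbv zeta; split; [|by []| |].
- split=> //=; [exact: mframe_G1 F _|exact: mframe_G1 G _|by right|].
  by rewrite expr1n mulr1 lt_eqF // (lt_trans (ltrN10 _) ltr01).
- have E1 : P p b1 = co S 1 *: L p a0 + co T 1 *: P p b0 + 1 *: L p a1.
    by rewrite s1 t1 lin_third scale1r; exact: rel1.
  have E2 : P p b2 = co S 2 *: L p a0 + co T 2 *: P p b0 + 1 *: L p a2.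
    by rewrite s2 t2 lin_plus; exact: rel2.
  have E3 : P p b3 = co S 3 *: L p a0 + co T 3 *: P p b0 + 1^-1 *: L p a3.
    by rewrite s3 t3 invr1 lin_third scale1r; exact: rel3.
  have E4 : P p b4 = co S 4 *: L p a0 + co T 4 *: P p b0 + (-1 * 1^-1) *: L p a4.
    by rewrite s4 t4 invr1 mulr1 lin_minus; exact: rel4.
  by split; [exact: E1|exact: E2|exact: E3|exact: E4].
- rewrite wedges6; exact: vol6.
Qed.

Section Lifting.
Variables (W : set 'rV[R]_6) (h : 'rV[R]_6 -> @lift_point R) (p : 'rV[R]_6).
Hypotheses (H : lifting0 setT I setT Ib setT phi W h) (Wp : W p).

Lemma G1_homog (M : set 'rV[R]_5) (J : set (dform R 5)) x u i : G1 M J x u -> homog 1 (u i).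
Proof. by move=> [U [om [A Ux <-]]]; exact: (ad_form A i).2. Qed.

Lemma lifting0_mu : mu (h p) = 1 /\ eps (h p) = -1.
Proof.
have [_ _ _ /(_ p Wp) [[g1 g2 mu1 ep _] [bE bbE] [r1 r2 r3 r4] _]] := H.
have [f [c1 [c2 [d1 [d2 [e3 [e4 [k3 [k4 HA]]]]]]]]] :=
  @G1_comb _ _ _ _ _ _ _ _ F _ ('J (prl phi) p) (base (h p)) (L p a0) (L p a1) (L p a2) (L p a3) (L p a4)
    ltac:(by rewrite bE) ltac:(by rewrite bE) ltac:(by rewrite bE) ltac:(by rewrite bE) ltac:(by rewrite bE) _ g1.
have [f' [c1' [c2' [d1' [d2' [e3' [e4' [k3' [k4' HB]]]]]]]]] :=
  @G1_comb _ _ _ _ _ _ _ _ G _ ('J (prr phi) p) (baseb (h p)) (P p b0) (L p a1) (L p a2 + L p a0 + P p b0) (L p a3)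
    (- L p a4 + L p a0 - P p b0)
    ltac:(by rewrite bbE) ltac:(rewrite bbE; exact: (rel1 p)) ltac:(rewrite bbE; exact: (rel2 p))
    ltac:(rewrite bbE; exact: (rel3 p)) ltac:(rewrite bbE; exact: (rel4 p)) _ g2.
have h6 := forms6 p; have v6 := vol6 p.
have hal i : homog 1 (pl phi p (fr (h p) i)) by apply: homog_pull; exact: G1_homog g1.
have [E _] := lift_mu h6 v6 hal r1 r2 r3 r4 HA HB.
have mu0 : mu (h p) != 0 by rewrite gt_eqF // (lt_le_trans ltr01).
have m4 : mu (h p) ^+ 4 = - eps (h p).
  transitivity (mu (h p) * mu (h p) * mu (h p) ^+ 2); first by ring.
  by rewrite E; field.
(* eps = 1 would make an even power negative; for eps = -1 a nonnegative mu with mu^4 = 1 is 1. *)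
case: ep => ep; rewrite ep in m4 *.
  by have := exprn_even_ge0 (mu (h p)) (isT : ~~ odd 4); rewrite m4 => ?; lra.
split=> //; apply/eqP; move: m4; rewrite opprK => /eqP; by rewrite pexpr_eq1 ?(le_trans ler01).
Qed.
End Lifting.

Lemma frames_special : special setT I setT Ib setT phi.
Proof.
split=> [p _|W h H p Wp]; last by have [] := lifting0_mu H Wp.
by exists setT, frames_lift; split=> //; exact: frames_lifting1.1.
Qed.

(** With mu = 1, a 1-refined lifting identifies the first and third covectors of both frames, so c2
    = e4 = 0 and f^2 V_2 = c1 s e3, a product of nonzero factors. *)
Lemma frames_V2 W h p V : lifting1 setT I setT Ib setT phi W h -> W p ->
  V_at setT I (base (h p)) (fr (h p)) V -> co V 2 != 0.
Proof.
move=> [H H1] Wp HV; have [mu1 _] := lifting0_mu H Wp.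
have [[s1 t1] [s3 t3] _ _] := H1 p Wp.
have [_ _ _ /(_ p Wp) [[g1 g2 _ _ _] [bE bbE] [r1 r2 r3 r4] _]] := H.
have [f [c1 [c2 [d1 [d2 [e3 [e4 [k3 [k4 [HA VE]]]]]]]]]] :=
  @V_at_comb _ _ _ _ _ _ _ _ F _ ('J (prl phi) p) (base (h p)) (L p a0) (L p a1) (L p a2) (L p a3) (L p a4)
    ltac:(by rewrite bE) ltac:(by rewrite bE) ltac:(by rewrite bE) ltac:(by rewrite bE) ltac:(by rewrite bE) _ _ HV.
have [f' [c1' [c2' [d1' [d2' [e3' [e4' [k3' [k4' HB]]]]]]]]] :=
  @G1_comb _ _ _ _ _ _ _ _ G _ ('J (prr phi) p) (baseb (h p)) (P p b0) (L p a1) (L p a2 + L p a0 + P p b0) (L p a3)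
    (- L p a4 + L p a0 - P p b0)
    ltac:(by rewrite bbE) ltac:(rewrite bbE; exact: (rel1 p)) ltac:(rewrite bbE; exact: (rel2 p))
    ltac:(rewrite bbE; exact: (rel3 p)) ltac:(rewrite bbE; exact: (rel4 p)) _ g2.
have h6 := forms6 p; have v6 := vol6 p.
have hal i : homog 1 (pl phi p (fr (h p) i)) by apply: homog_pull; exact: G1_homog g1.
have [_ HAB] := lift_mu h6 v6 hal r1 r2 r3 r4 HA HB.
move: r1 r3; rewrite s1 t1 s3 t3 mu1 invr1 !lin_third !scale1r => r1 r3.
have [c20 e40 c10 e30] := lift_lower h6 v6 r1 r3 HAB.
apply/eqP => V20; have : c1 * s * e3 != 0 by rewrite !mulf_neq0.
by move: VE; rewrite V20 mulr0 c20 !mul0r subr0 => <-; rewrite eqxx.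
Qed.

Theorem frames_type_III : type_III_backlund setT I setT Ib setT phi.
Proof.
split; [exact: frames_backlund|exact: frames_special|exact: mframe_EL F|exact: mframe_EL G|].
split=> [p _|W h H p V Wp]; last exact: frames_V2 H Wp.
by exists setT, frames_lift; split=> //; exact: frames_lifting1.
Qed.
End TypeIII.

(** * The homogeneous example *)

Section Gradient.
Context {R : realType} {n : nat}.
Implicit Types (f g : 'rV[R]_n -> R) (x : 'rV[R]_n).

Definition grad f x : ext R n := \sum_i partial i f x *: dx i.

Lemma gradM f g x : differentiable f x -> differentiable g x ->
  grad (fun y => f y * g y) x = f x *: grad g x + g x *: grad f x.
Proof.
move=> df dg; rewrite /grad !scaler_sumr -big_split; apply: eq_bigr => i _ /=.
by rewrite partialM // scalerDl !scalerA.
Qed.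

Lemma grad_cst c x : grad (fun=> c) x = 0.
Proof. by rewrite /grad big1 // => i _; rewrite partial_cst scale0r. Qed.

Lemma gradZ c f x : differentiable f x -> grad (fun y => c * f y) x = c *: grad f x.
Proof.
move=> df; by rewrite (gradM (f := fun=> c)) ?grad_cst ?scaler0 ?addr0 //; exact: differentiable_cst.
Qed.

Lemma grad_coord_comp (h : R -> R) d j x : is_derive (x 0 j) (1 : R) h d ->
  grad (fun y => h (y 0 j)) x = d *: dx j.
Proof.
move=> hd; rewrite /grad (bigD1 j) //= big1 => [|i ij]; last first.
  by have [_ ->] := is_derive_coord_comp i hd; rewrite (negbTE ij) mul0r scale0r.
by have [_ ->] := is_derive_coord_comp j hd; rewrite eqxx mul1r addr0.
Qed.

Lemma extd_fdx f j x : smooth setT f -> extd (fun y => f y *: dx j) x = grad f x &^ dx j.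
Proof.
move=> Sf; rewrite (extdZ (U := setT) (w := fun=> dx j)) // ?extd_cst ?scaler0 ?addr0 //.
by apply: smooth_ext_cst; exact: openT.
Qed.
End Gradient.

Section DxVolume.
Context {R : realType} {n : nat}.

(** The scalar is a permutation sign; only its nonvanishing is recorded, which makes the order of
    the list irrelevant. *)
Lemma wedges_dx (l : seq 'I_n) : uniq l ->
  exists2 e : R, e != 0 & wedges [seq dx i | i <- l] = e *: ebase [set i in l]%SET.
Proof.
elim: l => [_|i l IH /= /andP[il /IH[e e0 E]]].
  exists 1; rewrite ?oner_neq0 // scale1r /wedges /= ext1_ebase.
  have -> // : [set i in [::]]%SET = finset.set0 :> {set 'I_n}.
  by apply/finset.setP => i; rewrite !finset.inE.
exists (e * (-1) ^+ inversions [set i]%SET [set j in l]%SET); first by rewrite mulf_neq0 // signr_eq0.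
rewrite /wedges /= -/(wedges _) E wedgeZr dx_ebase ebase_wedge ifT; last first.
  by rewrite finset.disjoints1 finset.inE.
rewrite scalerA.
have -> // : [set j in i :: l]%SET = ([set i] :|: [set j in l])%SET.
by apply/finset.setP => j; rewrite !finset.inE.
Qed.

Lemma wedges_dx_neq0 (l : seq 'I_n) : uniq l -> wedges [seq (dx i : ext R n) | i <- l] != 0.
Proof.
move=> /wedges_dx[e e0 ->]; rewrite scaler_eq0 (negbTE e0) /=; apply/eqP => /ffunP/(_ [set i in l]%SET).
by rewrite !ffunE eqxx => /eqP; rewrite oner_eq0.
Qed.
End DxVolume.

Section Select.
Context {R : realType} {n m : nat} (sg : 'I_m -> 'I_n).

(** Coordinate projections realise the quotients by coordinate fields. They are linear, with 0/1
    Jacobians, so pullback merely renames the dx_j. *)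
Definition sel (x : 'rV[R]_n) : 'rV[R]_m := \row_j x 0 (sg j).

Lemma sel_linear : linear sel.
Proof. by move=> a u v; apply/rowP => j; rewrite !mxE. Qed.
HB.instance Definition _ := GRing.isLinear.Build R 'rV[R]_n 'rV[R]_m _ sel sel_linear.

Lemma sel_continuous : continuous sel.
Proof.
move=> u A /nbhs_ballP[e /= e0 eA].
apply/nbhs_ballP; exists e => //= v [_ uv]; apply: eA; split => // i j.
by rewrite !mxE; exact: uv.
Qed.

Lemma diff_sel p : 'd sel p = sel :> (_ -> _).
Proof. by apply: diff_lin; exact: sel_continuous. Qed.

Lemma jacobian_sel p i j : ('J sel p) i j = (i == sg j)%:R.
Proof. by rewrite /jacobian !mxE diff_sel !mxE eqxx eq_sym. Qed.

Lemma pull_sel_dx p j : pull ('J sel p) (dx j) = dx (sg j).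
Proof.
rewrite pull_dx (bigD1 (sg j)) //= big1 => [|i ij]; last by rewrite jacobian_sel (negbTE ij) scale0r.
by rewrite jacobian_sel eqxx scale1r addr0.
Qed.

Lemma smooth_sel : smooth_map setT sel.
Proof.
move=> j; apply: (smooth_eq (f := fun x => x 0 (sg j))); first exact: openT.
  by move=> x _; rewrite mxE.
by apply: smooth_coord; exact: openT.
Qed.
End Select.

(** * The forms A, B, K and their derivatives *)

Section Example.
Context {R : realType} (sg : R) (c s : R -> R).
Hypothesis sg2 : sg * sg = 1.
Hypothesis dc : forall t : R, is_derive t (1 : R) c (sg * s t).
Hypothesis ds : forall t : R, is_derive t (1 : R) s (c t).
Hypothesis cs : forall t, c t * c t - sg * (s t * s t) = 1.

Section Forms.
Context {n : nat} (jT jW ju jv jk : 'I_n).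
Implicit Type x : 'rV[R]_n.
Local Notation TT := (setT : set 'rV[R]_n).

Definition fE x := expR (x 0 jW).
Definition fEc x := fE x * c (x 0 jT).
Definition fEs x := fE x * s (x 0 jT).
Definition fEEu x := fE x * fE x * x 0 ju.

(* Coordinates (T, W, u, v, k): these are E (c du + s dv), - E (s du + sg c dv) and
   E^2 (dk - 2 sg u dv), with E = exp W. *)
Definition eA x : ext R n := fEc x *: dx ju + fEs x *: dx jv.
Definition eB x : ext R n := (-1 * fEs x) *: dx ju + (- sg * fEc x) *: dx jv.
Definition eK x : ext R n := (fE x * fE x) *: dx jk + (- (2%:R * sg) * fEEu x) *: dx jv.

Let oT : open TT := openT.

Lemma smooth_fE : smooth TT fE.
Proof.
apply: (@smooth_coord_comp _ _ (fun h => exists r, h = fun t => r * expR t) expR) => //.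
- move=> h [r ->]; exists (fun t => r * expR t); first by exists r.
  by move=> t; exact: (is_deriveZ r (is_derive_expR t)).
- by move=> h r [r' ->]; exists (r * r'); apply/funext => t; rewrite mulrA.
- by exists 1; apply/funext => t; rewrite mul1r.
Qed.

(** Neither the multiples of [c] nor those of [s] are closed under differentiation, but the span of
    the two is. *)
Lemma smooth_cs r1 r2 : smooth TT (fun x => r1 * c (x 0 jT) + r2 * s (x 0 jT)).
Proof.
apply: (@smooth_coord_comp _ _ (fun h => exists r1 r2, h = fun t => r1 * c t + r2 * s t)
  (fun t => r1 * c t + r2 * s t)) => //; last by exists r1, r2.
- move=> h [q1 [q2 ->]]; exists (fun t => q2 * c t + (q1 * sg) * s t); first by exists q2, (q1 * sg).
  move=> t; have := is_deriveD (is_deriveZ q1 (dc t)) (is_deriveZ q2 (ds t)).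
  by move/is_derive_eq; apply; rewrite /GRing.scale /=; ring.
- move=> h r [q1 [q2 ->]]; exists (r * q1), (r * q2); apply/funext => t; ring.
Qed.

Lemma smooth_c : smooth TT (fun x => c (x 0 jT)).
Proof. by apply: (smooth_eq oT _ (smooth_cs 1 0)) => x _; rewrite mul1r mul0r addr0. Qed.
Lemma smooth_s : smooth TT (fun x => s (x 0 jT)).
Proof. by apply: (smooth_eq oT _ (smooth_cs 0 1)) => x _; rewrite mul1r mul0r add0r. Qed.
Lemma smooth_fEc : smooth TT fEc.
Proof. by apply: smoothM => //; [exact: smooth_fE | exact: smooth_c]. Qed.
Lemma smooth_fEs : smooth TT fEs.
Proof. by apply: smoothM => //; [exact: smooth_fE | exact: smooth_s]. Qed.
Lemma smooth_fEE : smooth TT (fun x => fE x * fE x).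
Proof. by apply: smoothM => //; exact: smooth_fE. Qed.
Lemma smooth_fEEu : smooth TT fEEu.
Proof. by apply: smoothM => //; [exact: smooth_fEE | exact: smooth_coord]. Qed.

Lemma kform_fdx f j : smooth TT f -> kform 1 TT (fun x => f x *: dx j).
Proof.
move=> Sf; apply: kformZ => //; apply: kform_cst => //; exact: homog_dx.
Qed.
Lemma smoothZl r f : smooth TT f -> smooth TT (fun x => r * f x).
Proof. by move=> Sf; apply: smoothM => //; exact: smooth_cst. Qed.

Lemma kform_eA : kform 1 TT eA.
Proof. by apply: kformD => //; apply: kform_fdx; [exact: smooth_fEc | exact: smooth_fEs]. Qed.
Lemma kform_eB : kform 1 TT eB.
Proof. by apply: kformD => //; apply: kform_fdx; apply: smoothZl; [exact: smooth_fEs | exact: smooth_fEc]. Qed.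
Lemma kform_eK : kform 1 TT eK.
Proof. by apply: kformD => //; apply: kform_fdx; [exact: smooth_fEE | apply: smoothZl; exact: smooth_fEEu]. Qed.

Let diffT f x : smooth TT f -> differentiable f x.
Proof. by move=> Sf; exact: smooth_diff Sf _. Qed.

Lemma grad_fE x : grad fE x = fE x *: dx jW.
Proof. exact: (grad_coord_comp (h := expR)). Qed.
Lemma grad_fEc x : grad fEc x = fEc x *: dx jW + (sg * fEs x) *: dx jT.
Proof.
rewrite gradM; [|exact: diffT smooth_fE|exact: diffT smooth_c].
rewrite grad_fE (grad_coord_comp (dc _)) !scalerA addrC; congr (_ *: _ + _ *: _).
  by rewrite mulrC.
by rewrite /fEs; ring.
Qed.
Lemma grad_fEs x : grad fEs x = fEs x *: dx jW + fEc x *: dx jT.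
Proof.
rewrite gradM; [|exact: diffT smooth_fE|exact: diffT smooth_s].
by rewrite grad_fE (grad_coord_comp (ds _)) !scalerA addrC [s _ * _]mulrC.
Qed.
Lemma grad_fEE x : grad (fun x => fE x * fE x) x = (2%:R * (fE x * fE x)) *: dx jW.
Proof.
rewrite gradM; [|exact: diffT smooth_fE|exact: diffT smooth_fE].
by rewrite grad_fE !scalerA -scalerDl; congr (_ *: _); ring.
Qed.
Lemma grad_fEEu x : grad fEEu x = (2%:R * fEEu x) *: dx jW + (fE x * fE x) *: dx ju.
Proof.
rewrite gradM; [|exact: diffT smooth_fEE|exact: diffT (smooth_coord _ _)].
rewrite grad_fEE (grad_coord_comp (h := id) (d := 1)) scale1r addrC scalerA.
by congr (_ *: _ + _); rewrite /fEEu; ring.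
Qed.

Lemma forms_dx : forms1 [:: dx jT; dx jW; dx ju; dx jv; dx jk : ext R n].
Proof. by do !split => //; exact: homog_dx. Qed.

Lemma extd_eA x : extd eA x = dx jW &^ eA x + sg *: (eB x &^ dx jT).
Proof.
rewrite (@extdD _ _ TT (fun x => fEc x *: dx ju)) //; last 2 first.
- exact: (kform_fdx _ smooth_fEc).1.
- exact: (kform_fdx _ smooth_fEs).1.
rewrite !extd_fdx; [|exact: smooth_fEs|exact: smooth_fEc].
rewrite grad_fEc grad_fEs /eA /eB; have h := forms_dx.
(* The term fEc dT dv of dA must match sg times the dv-component - sg fEc of B; this is where 1/sg =
   sg enters. *)
have -> : fEc x *: dx jT = (sg * sg * fEc x) *: (dx jT : ext R n) by rewrite sg2 mul1r.
by ext_ring h.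
Qed.

Lemma extd_eB x : extd eB x = dx jW &^ eB x + eA x &^ dx jT.
Proof.
have S1 : smooth TT (fun x => -1 * fEs x) by apply: smoothZl; exact: smooth_fEs.
have S2 : smooth TT (fun x => - sg * fEc x) by apply: smoothZl; exact: smooth_fEc.
rewrite (@extdD _ _ TT (fun x => (-1 * fEs x) *: dx ju)) //; last 2 first.
- exact: (kform_fdx _ S1).1.
- exact: (kform_fdx _ S2).1.
rewrite !extd_fdx //.
rewrite !gradZ; [|by first [exact: diffT smooth_fEs|exact: diffT smooth_fEc]..].
rewrite grad_fEc grad_fEs /eA /eB; have h := forms_dx.
rewrite !scalerDr !scalerA.
have -> : - sg * (sg * fEs x) = - fEs x by rewrite mulrA mulNr sg2 mulN1r.
by ext_ring h.
Qed.

(** The identity c^2 - sg s^2 = 1 is what removes the dependence on T and leaves E^2 du dv, up to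
    sign. *)
Lemma eA_eB x : eA x &^ eB x = (- sg * (fE x * fE x)) *: (dx ju &^ dx jv).
Proof.
have h := forms_dx; rewrite /eA /eB.
transitivity ((fE x * fE x * (s (x 0 jT) * s (x 0 jT) - sg * (c (x 0 jT) * c (x 0 jT)))) *: (dx ju &^ dx jv : ext R n)).
  by rewrite /fEc /fEs; ext_ring h.
congr (_ *: _); rewrite mulrC; congr (_ * _).
transitivity (- sg * (c (x 0 jT) * c (x 0 jT) - sg * (s (x 0 jT) * s (x 0 jT)))); last by rewrite cs mulr1.
transitivity (sg * sg * (s (x 0 jT) * s (x 0 jT)) - sg * (c (x 0 jT) * c (x 0 jT))); last by ring.
by rewrite sg2 mul1r.
Qed.

(** The summand - 2 sg u dv of K is chosen for the term 2 A B: its derivative, scaled by E^2, is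
    exactly 2 A B by [eA_eB]. *)
Lemma extd_eK x : extd eK x = 2%:R *: (dx jW &^ eK x) + 2%:R *: (eA x &^ eB x).
Proof.
have S2 : smooth TT (fun x => - (2%:R * sg) * fEEu x) by apply: smoothZl; exact: smooth_fEEu.
rewrite (@extdD _ _ TT (fun x => (fE x * fE x) *: dx jk)) //; last 2 first.
- exact: (kform_fdx _ smooth_fEE).1.
- exact: (kform_fdx _ S2).1.
rewrite eA_eB !extd_fdx //; last exact: smooth_fEE.
rewrite gradZ; last exact: diffT smooth_fEEu.
rewrite grad_fEE grad_fEEu /eK; have h := forms_dx.
by ext_ring h.
Qed.
End Forms.
End Example.

Lemma extd_addc (R : realType) n (w : dform R n) (v : ext R n) x : smooth_ext setT w ->
  extd (fun y => w y + v) x = extd w x.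
Proof.
move=> Sw; rewrite (@extdD _ _ setT w (fun=> v)) ?extd_cst ?addr0 //.
by apply: smooth_ext_cst; exact: openT.
Qed.

Lemma extd_scale (R : realType) n (w : dform R n) (r : R) x : smooth_ext setT w ->
  extd (fun y => r *: w y) x = r *: extd w x.
Proof.
move=> Sw; have Sr : smooth (setT : set 'rV[R]_n) (fun=> r) by apply: smooth_cst; exact: openT.
rewrite (extdZ Sr Sw) // big1 ?wedge0l ?add0r // => i _.
by rewrite partial_cst scale0r.
Qed.

(** * The two five-dimensional framings *)

Section Concrete.
Context {R : realType} (sg : R) (c s : R -> R).
Hypothesis sg2 : sg * sg = 1.
Hypothesis dc : forall t : R, is_derive t (1 : R) c (sg * s t).
Hypothesis ds : forall t : R, is_derive t (1 : R) s (c t).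
Hypothesis cs : forall t, c t * c t - sg * (s t * s t) = 1.

Let sg0 : sg != 0.
Proof. by apply: contra_eq_neq sg2 => ->; rewrite mul0r eq_sym oner_neq0. Qed.
Let oT n : open (setT : set 'rV[R]_n) := openT.

(* Coordinates on M: (X, T, W, u, v). *)
Definition mA : dform R 5 := eA c s 1 2%:R 3%:R 4%:R.
Definition mB : dform R 5 := eB sg c s 1 2%:R 3%:R 4%:R.
Definition ma0 : dform R 5 := fun x => mB x - dx 0.
Definition ma1 : dform R 5 := fun x => mA x + dx 2%:R.
Definition ma2 : dform R 5 := fun=> dx 0.
Definition ma3 : dform R 5 := mA.
Definition ma4 : dform R 5 := fun=> dx 1 - dx 0.

(* Coordinates on the second manifold: (T, W, u, v, k). *)
Definition nA : dform R 5 := eA c s 0 1 2%:R 3%:R.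
Definition nB : dform R 5 := eB sg c s 0 1 2%:R 3%:R.
Definition nK : dform R 5 := eK sg 1 2%:R 3%:R 4%:R.
Definition mb0 : dform R 5 := fun x => nK x - nB x.
Definition mb1 : dform R 5 := fun x => nA x + dx 1.
Definition mb2 : dform R 5 := nK.
Definition mb3 : dform R 5 := nA.
Definition mb4 : dform R 5 := fun x => 2%:R *: nB x - nK x - dx 0.

Let kc (v : ext R 5) : homog 1 v -> kform 1 (setT : set 'rV[R]_5) (fun=> v).
Proof. exact: kform_cst. Qed.
Let hdx (i : 'I_5) : homog 1 (dx i : ext R 5) := homog_dx i.
Let kA : kform 1 setT mA := kform_eA dc ds _ _ _ _.
Let kB : kform 1 setT mB := kform_eB dc ds _ _ _ _.
Let kA' : kform 1 setT nA := kform_eA dc ds _ _ _ _.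
Let kB' : kform 1 setT nB := kform_eB dc ds _ _ _ _.
Let kK : kform 1 setT nK := kform_eK _ _ _ _ _.

Lemma dx5_neq0 : dx 0 &^ dx 1 &^ dx 2%:R &^ dx 3%:R &^ dx 4%:R != 0 :> ext R 5.
Proof.
by have := @wedges_dx_neq0 R 5 [:: 0; 1; 2%:R; 3%:R; 4%:R] isT; rewrite /wedges /= wedge1r.
Qed.

Lemma dx6_neq0 : dx 0 &^ dx 1 &^ dx 2%:R &^ dx 3%:R &^ dx 4%:R &^ dx 5%:R != 0 :> ext R 6.
Proof.
by have := @wedges_dx_neq0 R 6 [:: 0; 1; 2%:R; 3%:R; 4%:R; 5%:R] isT; rewrite /wedges /= wedge1r.
Qed.

Lemma forms_dx5 : forms1 [:: dx 0; dx 1; dx 2%:R; dx 3%:R; dx 4%:R : ext R 5].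
Proof. by do 5?[apply: conj; first exact: homog_dx]. Qed.

Lemma forms_M x : forms1 [:: mA x; mB x; dx 0; dx 1; dx 2%:R].
Proof.
apply: conj; first exact: (kA.2 x).
apply: conj; first exact: (kB.2 x).
by do 3?[apply: conj; first exact: homog_dx].
Qed.

Lemma forms_Mb x : forms1 [:: nA x; nB x; nK x; dx 0; dx 1].
Proof.
apply: conj; first exact: (kA'.2 x).
apply: conj; first exact: (kB'.2 x).
apply: conj; first exact: (kK.2 x).
by do 2?[apply: conj; first exact: homog_dx].
Qed.

Lemma kform_ma0 : kform 1 setT ma0. Proof. by apply: kformB => //; exact: kc. Qed.
Lemma kform_ma1 : kform 1 setT ma1. Proof. by apply: kformD => //; exact: kc. Qed.
Lemma kform_ma2 : kform 1 setT ma2. Proof. exact: kc. Qed.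
Lemma kform_ma3 : kform 1 setT ma3. Proof. exact: kA. Qed.
Lemma kform_ma4 : kform 1 setT ma4. Proof. by apply: kc; apply: homogB. Qed.
Lemma kform_mb0 : kform 1 setT mb0. Proof. exact: kformB. Qed.
Lemma kform_mb1 : kform 1 setT mb1. Proof. by apply: kformD => //; exact: kc. Qed.
Lemma kform_mb4 : kform 1 setT mb4.
Proof. by apply: kformB => //; [apply: kformB => //; exact: kformZc | exact: kc]. Qed.

Lemma extd_mA x : extd mA x = dx 2%:R &^ mA x + sg *: (mB x &^ dx 1).
Proof. exact: (extd_eA sg2 dc ds 1 2%:R 3%:R 4%:R 0 x). Qed.
Lemma extd_mB x : extd mB x = dx 2%:R &^ mB x + mA x &^ dx 1.
Proof. exact: (extd_eB sg2 dc ds 1 2%:R 3%:R 4%:R 0 x). Qed.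
Lemma extd_nA x : extd nA x = dx 1 &^ nA x + sg *: (nB x &^ dx 0).
Proof. exact: (extd_eA sg2 dc ds 0 1 2%:R 3%:R 4%:R x). Qed.
Lemma extd_nB x : extd nB x = dx 1 &^ nB x + nA x &^ dx 0.
Proof. exact: (extd_eB sg2 dc ds 0 1 2%:R 3%:R 4%:R x). Qed.
Lemma extd_nK x : extd nK x = 2%:R *: (dx 1 &^ nK x) + 2%:R *: (nA x &^ nB x).
Proof. exact: (extd_eK sg2 cs 0 1 2%:R 3%:R 4%:R x). Qed.

Lemma mA_mB x : mA x &^ mB x = (- sg * (fE 2%:R x * fE 2%:R x)) *: (dx 3%:R &^ dx 4%:R).
Proof. exact: (eA_eB sg2 cs 1 2%:R 3%:R 4%:R 0 x). Qed.
Lemma nA_nB x : nA x &^ nB x = (- sg * (fE 1 x * fE 1 x)) *: (dx 2%:R &^ dx 3%:R).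
Proof. exact: (eA_eB sg2 cs 0 1 2%:R 3%:R 4%:R x). Qed.

(** Everything follows by substituting dW = a1 - a3, dX = a2, dT = a2 + a4, B = a0 + a2, A = a3 in
    the structure equations. The forms a2 and a4 are closed, which is the origin of the entry 0 of
    S_1 and of the degeneracy. *)
Lemma mframe_M : mframe sg 0 ma0 ma1 ma2 ma3 ma4.
Proof.
constructor; [exact: kform_ma0|exact: kform_ma1|exact: kform_ma2|exact: kform_ma3|exact: kform_ma4|..].
(* A and B occur only through their product, a nonzero multiple of du dv, so the volume reduces to
   that of the coordinates. *)
- move=> x; have h := forms_M x; have h5 := forms_dx5.
  have -> : ma0 x &^ ma1 x &^ ma2 x &^ ma3 x &^ ma4 x = - ((mA x &^ mB x) &^ dx 0 &^ dx 1 &^ dx 2%:R).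
    by rewrite /ma0 /ma1 /ma2 /ma3 /ma4; ext_ring h.
  rewrite mA_mB.
  have -> : - (((- sg * (fE 2%:R x * fE 2%:R x)) *: (dx 3%:R &^ dx 4%:R)) &^ dx 0 &^ dx 1 &^ dx 2%:R) =
     (sg * (fE 2%:R x * fE 2%:R x)) *: (dx 0 &^ dx 1 &^ dx 2%:R &^ dx 3%:R &^ dx 4%:R : ext R 5).
    by ext_ring h5.
  by rewrite scaler_eq0 negb_or dx5_neq0 !mulf_neq0 // gt_eqF // expR_gt0.
- exists (fun=> dx 2%:R); split; first exact: kc.
  move=> x; have h := forms_M x.
  rewrite (extd_addc _ _ kB.1) extd_mB /ma0 /ma1 /ma2 /ma3 /ma4; ext_ring h.
- exists (fun x => - ma3 x), (fun x => sg *: (ma0 x - ma4 x)); split.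
  + exact: kformN kform_ma3.
  + by apply: kformZc => //; apply: kformB => //; [exact: kform_ma0|exact: kform_ma4].
  move=> x; have h := forms_M x.
  rewrite (extd_addc _ _ kA.1) extd_mA /ma0 /ma1 /ma2 /ma3 /ma4; ext_ring h.
- exists (fun=> 0), (fun=> 0); split; [by apply: kc; exact: homog0|by apply: kc; exact: homog0|].
  by move=> x; rewrite extd_cst !wedge0l scale0r !addr0.
- exists ma1, (fun x => sg *: (ma0 x + ma2 x)); split.
  + exact: kform_ma1.
  + by apply: kformZc => //; apply: kformD => //; [exact: kform_ma0|exact: kform_ma2].
  move=> x; have h := forms_M x.
  rewrite extd_mA /ma0 /ma1 /ma2 /ma3 /ma4; ext_ring h.
- exists (fun=> 0), (fun=> 0); split; [by apply: kc; exact: homog0|by apply: kc; exact: homog0|].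
  by move=> x; rewrite extd_cst !wedge0l scale0r !addr0.
Qed.

(** Here dW = b1 - b3, A = b3, B = b2 - b0, K = b2 and dT = b2 - 2 b0 - b4. In d b2 = dK the term 2
    A B becomes 2 b3 b2 - 2 b3 b0, and its second half is the origin of the entry 2 of S_1. *)
Lemma mframe_Mb : mframe sg 2%:R mb0 mb1 mb2 mb3 mb4.
Proof.
constructor; [exact: kform_mb0|exact: kform_mb1|exact: kK|exact: kA'|exact: kform_mb4|..].
- move=> x; have h := forms_Mb x; have h5 := forms_dx5.
  have -> : mb0 x &^ mb1 x &^ mb2 x &^ mb3 x &^ mb4 x = - ((nA x &^ nB x) &^ nK x &^ dx 0 &^ dx 1).
    by rewrite /mb0 /mb1 /mb2 /mb3 /mb4; ext_ring h.
  rewrite nA_nB /nK /eK; set e := fE 1 x * fE 1 x; set z := _ * fEEu _ _ _.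
  have -> : - (((- sg * e) *: (dx 2%:R &^ dx 3%:R)) &^ (e *: dx 4%:R + z *: dx 3%:R) &^ dx 0 &^ dx 1) =
     (sg * (e * e)) *: (dx 0 &^ dx 1 &^ dx 2%:R &^ dx 3%:R &^ dx 4%:R : ext R 5).
    by ext_ring h5.
  by rewrite scaler_eq0 negb_or dx5_neq0 !mulf_neq0 // gt_eqF // expR_gt0.
- exists (fun=> dx 1); split; first exact: kc.
  move=> x; have h := forms_Mb x.
  rewrite (@extdD _ _ setT nK (fun x => - nB x)) //; [|by first [exact: kK.1|exact: (kformN (@oT 5) kB').1]..].
  have -> : extd (fun x => - nB x) x = - extd nB x.
    have -> : (fun x => - nB x) = (fun x => (-1) *: nB x) by apply/funext => y; rewrite scaleN1r.
    by rewrite (extd_scale _ _ kB'.1) scaleN1r.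
  by rewrite extd_nK extd_nB /mb0 /mb1 /mb2 /mb3 /mb4; ext_ring h.
- exists (fun x => - mb3 x), (fun x => sg *: (mb0 x + mb4 x)); split.
  + exact: kformN kA'.
  + by apply: kformZc => //; apply: kformD => //; [exact: kform_mb0|exact: kform_mb4].
  move=> x; have h := forms_Mb x.
  rewrite (extd_addc _ _ kA'.1) extd_nA /mb0 /mb1 /mb2 /mb3 /mb4; ext_ring h.
- exists (fun=> 0), (fun x => 2%:R *: mb1 x); split.
  + by apply: kc; exact: homog0.
  + by apply: kformZc => //; exact: kform_mb1.
  move=> x; have h := forms_Mb x.
  rewrite extd_nK /mb0 /mb1 /mb2 /mb3 /mb4; ext_ring h.
- exists mb1, (fun x => sg *: (mb0 x - mb2 x)); split.
  + exact: kform_mb1.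
  + by apply: kformZc => //; apply: kformB => //; exact: kform_mb0.
  move=> x; have h := forms_Mb x.
  rewrite extd_nA /mb0 /mb1 /mb2 /mb3 /mb4; ext_ring h.
- exists (fun=> 0), (fun x => - 2%:R *: mb3 x); split.
  + by apply: kc; exact: homog0.
  + by apply: kformZc => //; exact: kA'.
  move=> x; have h := forms_Mb x.
  rewrite (@extd_addc _ _ (fun x => 2%:R *: nB x - nK x)); last first.
    by case: (kformB (@oT 5) (kformZc 2%:R (@oT 5) kB') kK).
  have -> : (fun x => 2%:R *: nB x - nK x) = (fun x => 2%:R *: nB x + (-1) *: nK x).
    by apply/funext => y; rewrite scaleN1r.
  rewrite (@extdD _ _ setT (fun x => 2%:R *: nB x)) //; [|by first [exact: (kformZc 2%:R (@oT 5) kB').1|exact: (kformZc (-1) (@oT 5) kK).1]..].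
  rewrite (extd_scale _ _ kB'.1) (extd_scale _ _ kK.1) extd_nK extd_nB.
  by rewrite /mb0 /mb1 /mb2 /mb3 /mb4; ext_ring h.
Qed.
End Concrete.

(** * Projections of the 6-manifold to the two quotients *)

Section Pullbacks.
Context {R : realType} (sg : R) (c s : R -> R).
Context {n m : nat} (f : 'I_m -> 'I_n) (p : 'rV[R]_n).
Variables jT jW ju jv jk : 'I_m.

(** The forms are parametrised by the indices of their coordinates precisely so that pullback
    returns the same expression with renamed indices. *)
Lemma pull_eA : pull ('J (sel f) p) (eA c s jT jW ju jv (sel f p)) = eA c s (f jT) (f jW) (f ju) (f jv) p.
Proof. by rewrite /eA pullD !pullZ !pull_sel_dx /fEc /fEs /fE !mxE. Qed.
Lemma pull_eB : pull ('J (sel f) p) (eB sg c s jT jW ju jv (sel f p)) = eB sg c s (f jT) (f jW) (f ju) (f jv) p.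
Proof. by rewrite /eB pullD !pullZ !pull_sel_dx /fEc /fEs /fE !mxE. Qed.
Lemma pull_eK : pull ('J (sel f) p) (eK sg jW ju jv jk (sel f p)) = eK sg (f jW) (f ju) (f jv) (f jk) p.
Proof. by rewrite /eK pullD !pullZ !pull_sel_dx /fEEu /fE !mxE. Qed.
End Pullbacks.

Section SmoothSel.
Context {R : realType} (sg : R) (c s : R -> R).
Hypothesis dc : forall t : R, is_derive t (1 : R) c (sg * s t).
Hypothesis ds : forall t : R, is_derive t (1 : R) s (c t).
Context {n m : nat} (f : 'I_m -> 'I_n).
Variables jT jW ju jv jk : 'I_m.
Local Notation NT := (setT : set 'rV[R]_n).
Let oT : open NT := openT.

Lemma smooth_scaled (g : 'rV[R]_n -> R) (v : ext R m) : smooth NT g -> smooth_ext NT (fun p => g p *: v).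
Proof. by move=> Sg; apply: smooth_extZ => //; exact: smooth_ext_cst. Qed.

Lemma smooth_eA_sel : smooth_ext NT (fun p => eA c s jT jW ju jv (sel f p)).
Proof.
apply: (smooth_ext_eq (w := fun p => fEc c (f jT) (f jW) p *: dx ju + fEs s (f jT) (f jW) p *: dx jv)) => //.
  by move=> p _; rewrite /eA /fEc /fEs /fE !mxE.
by apply: smooth_extD => //; apply: smooth_scaled; [exact: (smooth_fEc dc ds) | exact: (smooth_fEs dc ds)].
Qed.
Lemma smooth_eB_sel : smooth_ext NT (fun p => eB sg c s jT jW ju jv (sel f p)).
Proof.
apply: (smooth_ext_eq (w := fun p => (-1 * fEs s (f jT) (f jW) p) *: dx ju + (- sg * fEc c (f jT) (f jW) p) *: dx jv)) => //.
  by move=> p _; rewrite /eB /fEc /fEs /fE !mxE.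
by apply: smooth_extD => //; apply: smooth_scaled; apply: smoothZl; first [exact: (smooth_fEs dc ds) | exact: (smooth_fEc dc ds)].
Qed.
Lemma smooth_eK_sel : smooth_ext NT (fun p => eK sg jW ju jv jk (sel f p)).
Proof.
apply: (smooth_ext_eq (w := fun p => (fE (f jW) p * fE (f jW) p) *: dx jk + (- (2%:R * sg) * fEEu (f jW) (f ju) p) *: dx jv)) => //.
  by move=> p _; rewrite /eK /fEEu /fE !mxE.
by apply: smooth_extD => //; apply: smooth_scaled; [exact: smooth_fEE | apply: smoothZl; exact: smooth_fEEu].
Qed.
End SmoothSel.

(** With coordinates ordered as (X, T, W, u, v, k), keeping the first five forgets k and keeping the
    last five forgets X. *)
Definition first5 : 'I_5 -> 'I_6 := @widen_ord 5 6 isT.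
Definition last5 : 'I_5 -> 'I_6 := lift ord0.

Lemma first5E : [/\ first5 0 = 0, first5 1 = 1, first5 2%:R = 2%:R, first5 3%:R = 3%:R & first5 4%:R = 4%:R].
Proof. by split; apply/val_inj. Qed.
Lemma last5E : [/\ last5 0 = 1, last5 1 = 2%:R, last5 2%:R = 3%:R, last5 3%:R = 4%:R & last5 4%:R = 5%:R].
Proof. by split; apply/val_inj. Qed.

(** Every coordinate is seen by at least one projection; this makes the pair of projections an
    embedding. *)
Lemma first_last (i : 'I_6) : (exists j, i = first5 j) \/ (exists j, i = last5 j).
Proof.
have [i5|i5] := ltnP i 5; first by left; exists (Ordinal i5); exact/val_inj.
right; exists 4%:R; apply/val_inj => /=; apply/eqP.
by rewrite eqn_leq i5 -ltnS ltn_ord.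
Qed.

Section Phi.
Context {R : realType}.

Definition ex_phi (p : 'rV[R]_6) : 'rV[R]_5 * 'rV[R]_5 := (sel first5 p, sel last5 p).

Lemma ex_phi_inj : injective ex_phi.
Proof.
move=> p q [/rowP E1 /rowP E2]; apply/rowP => i.
have [[j ->]|[j ->]] := first_last i; [have := E1 j|have := E2 j]; by rewrite !mxE.
Qed.

(** Balls are defined coordinatewise, so closeness of both projections is closeness in all six
    coordinates, with the same radius. *)
Lemma ex_phi_homeo (p : 'rV[R]_6) A : nbhs p A ->
    exists2 B, nbhs (ex_phi p) B & forall q, B (ex_phi q) -> A q.
Proof.
move=> /nbhs_ballP[e /= e0 eA]; exists (ball (ex_phi p) e); first exact: nbhsx_ballx.
move=> q [[_ B1] [_ B2]]; apply: eA; split=> // i j; rewrite !ord1.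
have [[k ->]|[k ->]] := first_last j; [have := B1 0 k|have := B2 0 k]; by rewrite !mxE.
Qed.

Lemma sel_first_surj (v : 'rV[R]_5) : exists h, sel first5 h = v.
Proof.
exists (\row_i v 0 (inord i)); apply/rowP => j; rewrite !mxE; congr (v 0 _).
exact: (inord_val j).
Qed.
Lemma sel_last_surj (v : 'rV[R]_5) : exists h, sel last5 h = v.
Proof.
exists (\row_i v 0 (inord i.-1)); apply/rowP => j; rewrite !mxE; congr (v 0 _).
exact: (inord_val j).
Qed.
End Phi.

Section Main.
Context {R : realType} (sg : R) (c s : R -> R).
Hypothesis sg2 : sg * sg = 1.
Hypothesis dc : forall t : R, is_derive t (1 : R) c (sg * s t).
Hypothesis ds : forall t : R, is_derive t (1 : R) s (c t).
Hypothesis cs : forall t, c t * c t - sg * (s t * s t) = 1.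

Let sg0 : sg != 0.
Proof. by apply: contra_eq_neq sg2 => ->; rewrite mul0r eq_sym oner_neq0. Qed.

Local Notation N_A p := (eA c s 1 2%:R 3%:R 4%:R p : ext R 6).
Local Notation N_B p := (eB sg c s 1 2%:R 3%:R 4%:R p : ext R 6).
Local Notation N_K p := (eK sg 2%:R 3%:R 4%:R 5%:R p : ext R 6).
Local Notation NT := (setT : set 'rV[R]_6).

Lemma pl_ma p : [/\ pl ex_phi p (ma0 sg c s (prl ex_phi p)) = N_B p - dx 0,
  pl ex_phi p (ma1 c s (prl ex_phi p)) = N_A p + dx 2%:R,
  pl ex_phi p (ma2 (prl ex_phi p)) = dx 0,
  pl ex_phi p (ma3 c s (prl ex_phi p)) = N_A p
  & pl ex_phi p (ma4 (prl ex_phi p)) = dx 1 - dx 0].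
Proof.
have [f0 f1 f2 f3 f4] := first5E.
rewrite /pl -[prl ex_phi]/(sel first5) /ma0 /ma1 /ma2 /ma3 /ma4 /mA /mB.
split.
- by rewrite pullD pullN pull_eB pull_sel_dx f0 f1 f2 f3 f4.
- by rewrite pullD pull_eA pull_sel_dx f1 f2 f3 f4.
- by rewrite pull_sel_dx f0.
- by rewrite pull_eA f1 f2 f3 f4.
- by rewrite pullD pullN !pull_sel_dx f0 f1.
Qed.

Lemma pr_mb p : [/\ pr ex_phi p (mb0 sg c s (prr ex_phi p)) = N_K p - N_B p,
  pr ex_phi p (mb1 c s (prr ex_phi p)) = N_A p + dx 2%:R,
  pr ex_phi p (mb2 sg (prr ex_phi p)) = N_K p,
  pr ex_phi p (mb3 c s (prr ex_phi p)) = N_A p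
  & pr ex_phi p (mb4 sg c s (prr ex_phi p)) = 2%:R *: N_B p - N_K p - dx 1].
Proof.
have [f0 f1 f2 f3 f4] := last5E.
rewrite /pr -[prr ex_phi]/(sel last5) /mb0 /mb1 /mb2 /mb3 /mb4 /nA /nB /nK.
split.
- by rewrite pullD pullN pull_eK pull_eB f0 f1 f2 f3 f4.
- by rewrite pullD pull_eA pull_sel_dx f0 f1 f2 f3.
- by rewrite pull_eK f1 f2 f3 f4.
- by rewrite pull_eA f0 f1 f2 f3.
- by rewrite !(pullD _ (_ - _)) pullD !pullN pullZ pull_eB pull_eK pull_sel_dx f0 f1 f2 f3 f4.
Qed.

Lemma forms_N p : forms1 [:: N_A p; N_B p; N_K p; dx 0; dx 1; dx 2%:R].
Proof.
apply: conj; first exact: ((kform_eA dc ds _ _ _ _).2 p).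
apply: conj; first exact: ((kform_eB dc ds _ _ _ _).2 p).
apply: conj; first exact: ((kform_eK _ _ _ _ _).2 p).
by do 3?[apply: conj; first exact: homog_dx].
Qed.

Lemma forms_dx6 : forms1 [:: dx 0; dx 1; dx 2%:R; dx 3%:R; dx 4%:R; dx 5%:R : ext R 6].
Proof. by do 6?[apply: conj; first exact: homog_dx]. Qed.

Lemma ex_type_III : type_III_backlund setT (mideal (ma0 sg c s) (ma1 c s) ma2 (ma3 c s) ma4)
  setT (mideal (mb0 sg c s) (mb1 c s) (mb2 sg) (mb3 c s) (mb4 sg c s)) setT ex_phi.
Proof.
(* The rows s = (0, 1, 0, 1) and t = (0, 1, 0, -1) are the coefficients of a0 and b0 in b2 = a2 + a0
   + b0 and b4 = - a4 + a0 - b0. *)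
refine (frames_type_III (mframe_M sg2 dc ds cs) (mframe_Mb sg2 dc ds cs) sg0
  _ _ _ _ _ _ _ _ _ _ _ _ _ (co_row4 0 1 0 1) (co_row4 0 1 0 (-1))).
- by move=> p; have [A0 A1 A2 A3 A4] := pl_ma p; have [B0 B1 B2 B3 B4] := pr_mb p; rewrite B1 A1.
- move=> p; have [A0 A1 A2 A3 A4] := pl_ma p; have [B0 B1 B2 B3 B4] := pr_mb p; rewrite B2 A2 A0 B0.
  by have h := forms_N p; ext_ring h.
- by move=> p; have [A0 A1 A2 A3 A4] := pl_ma p; have [B0 B1 B2 B3 B4] := pr_mb p; rewrite B3 A3.
- move=> p; have [A0 A1 A2 A3 A4] := pl_ma p; have [B0 B1 B2 B3 B4] := pr_mb p; rewrite B4 A4 A0 B0.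
  by have h := forms_N p; ext_ring h.
- move=> p; have [A0 A1 A2 A3 A4] := pl_ma p; have [B0 B1 B2 B3 B4] := pr_mb p; rewrite A1 A2 A3 A4 A0 B0.
  have h := forms_N p; have h6 := forms_dx6.
  have -> : (N_A p + dx 2%:R) &^ dx 0 &^ N_A p &^ (dx 1 - dx 0) &^ (N_B p - dx 0) &^ (N_K p - N_B p) =
      (N_A p &^ N_B p) &^ N_K p &^ dx 0 &^ dx 1 &^ dx 2%:R by ext_ring h.
  rewrite (eA_eB sg2 cs 1 2%:R 3%:R 4%:R 5%:R p) /eK.
  set e := fE 2%:R p * fE 2%:R p; set z := _ * fEEu _ _ _.
  have -> : ((- sg * e) *: (dx 3%:R &^ dx 4%:R)) &^ (e *: dx 5%:R + z *: dx 4%:R) &^ dx 0 &^ dx 1 &^ dx 2%:R =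
     (sg * (e * e)) *: (dx 0 &^ dx 1 &^ dx 2%:R &^ dx 3%:R &^ dx 4%:R &^ dx 5%:R : ext R 6).
    by ext_ring h6.
  by rewrite scaler_eq0 negb_or dx6_neq0 !mulf_neq0 // gt_eqF // expR_gt0.
- by split; [exact: (smooth_sel first5) | exact: (smooth_sel last5)].
- exact: ex_phi_inj.
- exact: ex_phi_homeo.
- move=> p v; have [h hv] := sel_first_surj v; exists h; rewrite -hv.
  by rewrite -[prl ex_phi]/(sel first5) diff_sel.
- move=> p v; have [h hv] := sel_last_surj v; exists h; rewrite -hv.
  by rewrite -[prr ex_phi]/(sel last5) diff_sel.
- move=> p h.
  have d1 : 'd (prl ex_phi) p h = sel first5 h by rewrite -[prl ex_phi]/(sel first5) diff_sel.
  have d2 : 'd (prr ex_phi) p h = sel last5 h by rewrite -[prr ex_phi]/(sel last5) diff_sel.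
  move=> /(etrans (esym d1)) E1 /(etrans (esym d2)) E2.
  (* The projections are linear and equal their differentials, so injectivity of the map already
     gives the trivial common kernel. *)
  by apply: ex_phi_inj; rewrite /ex_phi E1 E2 !linear0.
- have oT : open NT := openT.
  have SA : smooth_ext NT (fun p => mA c s (sel first5 p)) := smooth_eA_sel dc ds _ _ _ _ _.
  have SB : smooth_ext NT (fun p => mB sg c s (sel first5 p)) := smooth_eB_sel dc ds _ _ _ _ _.
  have SC v : smooth_ext NT (fun=> v : ext R 5) by exact: smooth_ext_cst.
  case=> [[|[|[|[|[|//]]]]] Hi].
  + exact: smooth_extB.
  + exact: smooth_extD.
  + exact: SC.
  + exact: SA.
  + exact: SC.
- have oT : open NT := openT.
  have SA : smooth_ext NT (fun p => nA c s (sel last5 p)) := smooth_eA_sel dc ds _ _ _ _ _.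
  have SB : smooth_ext NT (fun p => nB sg c s (sel last5 p)) := smooth_eB_sel dc ds _ _ _ _ _.
  have SK : smooth_ext NT (fun p => nK sg (sel last5 p)) := smooth_eK_sel _ _ _ _ _ _.
  have SC v : smooth_ext NT (fun=> v : ext R 5) by exact: smooth_ext_cst.
  case=> [[|[|[|[|[|//]]]]] Hi].
  + exact: smooth_extB.
  + exact: smooth_extD.
  + exact: SK.
  + exact: SA.
  + apply: smooth_extB => //; apply: smooth_extB => //; apply: smooth_extZ => //.
    exact: smooth_cst.
Qed.
End Main.

(** * The functions for sg = 1, and the theorem *)

Section Hyperbolic.
Context {R : realType}.
Definition cosh (t : R) := 2^-1 * expR t + 2^-1 * expR (- t).
Definition sinh (t : R) := 2^-1 * expR t - 2^-1 * expR (- t).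

Lemma is_derive_expRN (t : R) : is_derive t (1 : R) (fun t => expR (- t)) (- expR (- t)).
Proof.
have := is_derive1_comp (is_derive_expR (- t)) (is_deriveN (is_derive_id t (1 : R))).
by move/is_derive_eq; apply; rewrite /GRing.scale /=; ring.
Qed.

Lemma is_derive_cosh (t : R) : is_derive t (1 : R) cosh (sinh t).
Proof.
have := is_deriveD (is_deriveZ 2^-1 (is_derive_expR t)) (is_deriveZ 2^-1 (is_derive_expRN t)).
by move/is_derive_eq; apply; rewrite /sinh /GRing.scale /=; ring.
Qed.
Lemma is_derive_sinh (t : R) : is_derive t (1 : R) sinh (cosh t).
Proof.
have := is_deriveB (is_deriveZ 2^-1 (is_derive_expR t)) (is_deriveZ 2^-1 (is_derive_expRN t)).
by move/is_derive_eq; apply; rewrite /cosh /GRing.scale /=; ring.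
Qed.
Lemma cosh2_sinh2 (t : R) : cosh t * cosh t - sinh t * sinh t = 1.
Proof.
transitivity (expR t * expR (- t)); first by rewrite /cosh /sinh; field.
by rewrite -expRD subrr expR0.
Qed.
End Hyperbolic.

Theorem mainTheorem4 (R : realType) :
  let exists_example (bar_class : set 'rV[R]_5 -> set (dform R 5) -> Prop) :=
    exists (M : set 'rV[R]_5) (I : set (dform R 5))
           (Mb : set 'rV[R]_5) (Ib : set (dform R 5))
           (N : set 'rV[R]_6) (phi : 'rV[R]_6 -> 'rV[R]_5 * 'rV[R]_5),
      degenerate_EL M I /\ bar_class Mb Ib /\
      type_III_backlund M I Mb Ib N phi in
  exists_example nondegenerate_EL /\
  exists_example positive_EL /\
  exists_example negative_EL.
Proof.
(* The class of the second system is left abstract: it depends only on the sign of the product of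
   the entries sg and 2 of its framing. *)
have ex (sg : R) (c s : R -> R) (bar_class : set 'rV[R]_5 -> set (dform R 5) -> Prop) :
    sg * sg = 1 -> (forall t : R, is_derive t (1 : R) c (sg * s t)) ->
    (forall t : R, is_derive t (1 : R) s (c t)) -> (forall t, c t * c t - sg * (s t * s t) = 1) ->
    (forall b0 b1 b2 b3 b4, mframe sg 2%:R b0 b1 b2 b3 b4 -> bar_class setT (mideal b0 b1 b2 b3 b4)) ->
  exists (M : set 'rV[R]_5) (I : set (dform R 5)) (Mb : set 'rV[R]_5) (Ib : set (dform R 5))
      (N : set 'rV[R]_6) (phi : 'rV[R]_6 -> 'rV[R]_5 * 'rV[R]_5),
    degenerate_EL M I /\ bar_class Mb Ib /\ type_III_backlund M I Mb Ib N phi.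
  move=> sg2 dc ds cs Hb; do 6!eexists; split; last split; last exact: (ex_type_III sg2 dc ds cs).
    by apply: mframe_degenerate (mframe_M sg2 dc ds cs) _.
  exact: Hb (mframe_Mb sg2 dc ds cs).
(* The circular case: sg = -1 makes the product of the entries - 2, so the determinant of S_1 is
   positive; it also witnesses the non-degenerate class. *)
have exP bar_class : (forall b0 b1 b2 b3 b4, mframe (-1 : R) 2%:R b0 b1 b2 b3 b4 ->
    bar_class setT (mideal b0 b1 b2 b3 b4)) -> _ := fun H => ex (-1) (@cos R) (@sin R) bar_class
  ltac:(by rewrite mulrNN mulr1) ltac:(by move=> t; rewrite mulN1r; exact: is_derive_cos) (@is_derive_sin R)
  ltac:(by move=> t; rewrite mulN1r opprK -!expr2 cos2Dsin2) H.
have pos b0 b1 b2 b3 b4 : mframe (-1 : R) 2%:R b0 b1 b2 b3 b4 -> positive_EL setT (mideal b0 b1 b2 b3 b4).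
  by move=> /mframe_positive; apply; rewrite mulN1r oppr_lt0.
split; [|split].
- by apply: exP => *; left; exact: pos.
- exact: exP.
(* With sg = 1 the product of the entries is 2, and the determinant of S_1 is negative. *)
- apply: (ex 1 cosh sinh); [exact: mulr1| | exact: is_derive_sinh | |].
  + by move=> t; rewrite mul1r; exact: is_derive_cosh.
  + by move=> t; rewrite mul1r; exact: cosh2_sinh2.
  by move=> b0 b1 b2 b3 b4 /mframe_negative; apply; rewrite mul1r.
Qed.
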